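(* Let $r\ge 2$ and $t\ge 1$ be integers. Then: (1) if $r=3$ and $t=1$, then for every $n\ge 3$, $\mathrm{ex}^{\mathrm{col}}(n,(S_3,M_1),C_4)=\mathcal N(S_3,F_n)$; (2) if $r\ge 4$ and $t<2(r-1)/3$, then for $n$ large enough, $\mathrm{ex}^{\mathrm{col}}(n,(S_r,M_t),C_4)=\mathcal N^{\mathrm{col}}(S_r,M_t;F_n^* )$; (3) if $r=4$ and $t=2$, then for $n$ large enough, $\mathrm{ex}^{\mathrm{col}}(n,(S_4,M_2),C_4)=\mathcal N^{\mathrm{col}}(S_4,M_2;F_n^* )$; (4) for all other pairs $(r,t)$ (i.e. $t\ge 2(r-1)/3$ and $(r,t)\notin\{(3,1),(4,2)\}$), for $n$ large enough, $\mathrm{ex}^{\mathrm{col}}(n,(S_r,M_t),C_4)=\mathrm{ex}(n,M_t,C_4)$.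
   Context: $S_r$ is the star with $r$ vertices, $M_t$ is the matching with $t$ edges, $C_4$ is the 4-cycle. $F_n$ is the graph obtained from the star $S_n$ by adding a matching of size $\lfloor (n-1)/2\rfloor$ on its leaves; $F_n^*$ is $F_n$ with the star edges colored 1 (blue) and the matching edges colored 2 (red). $\mathcal N(H,G)$ is the number of subgraphs of $G$ isomorphic to $H$, and $\mathrm{ex}(n,H,F)$ is its maximum over $F$-free $n$-vertex $G$. For a graph $G$ with edges colored $1,2$, $G_i$ is the subgraph of edges of color $i$, and $\mathcal N^{\mathrm{col}}(H_1,H_2;G)=\mathcal N(H_1,G_1)+\mathcal N(H_2,G_2)$; $\mathrm{ex}^{\mathrm{col}}(n,(H_1,H_2),F)$ is the maximum of $\mathcal N^{\mathrm{col}}(H_1,H_2;G)$ over all $F$-free $n$-vertex graphs $G$ and all 2-colorings of their edges. *)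

(* Defs.v *)
From mathcomp Require Import all_boot.
Set Implicit Arguments. Unset Strict Implicit. Unset Printing Implicit Defensive.

Definition is_graph (n : nat) (E : {set {set 'I_n}}) : bool :=
  [forall e in E, #|e| == 2].

(* copies of H (on vertex set 'I_k) in G (on 'I_n): the edge subsets F of G
   that are the image of E(H) under some injective vertex map 'I_k -> 'I_n,
   i.e. the subgraphs of G isomorphic to H (H has no isolated vertices in all
   uses below). *)
Definition copies (k n : nat) (H : {set {set 'I_k}}) (G : {set {set 'I_n}})
  : {set {set {set 'I_n}}} :=
  [set F : {set {set 'I_n}} | (F \subset G) &&
     [exists f : {ffun 'I_k -> 'I_n}, injectiveb f && (F == [set f @: e | e : {set 'I_k} in H])]].

Definition Ncount (k n : nat) (H : {set {set 'I_k}}) (G : {set {set 'I_n}}) : nat :=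
  #|copies H G|.

Definition Sstar (r : nat) : {set {set 'I_r}} :=
  [set e : {set 'I_r} | [exists i : 'I_r, exists j : 'I_r, ((val i == 0) && (val j != 0)) && (e == [set i; j])]].

Definition Mmatch (t : nat) : {set {set 'I_(2 * t)}} :=
  [set e : {set 'I_(2 * t)} | [exists i : 'I_(2 * t), exists j : 'I_(2 * t), (~~ odd i && (val j == i.+1)) && (e == [set i; j])]].

Definition C4 : {set {set 'I_4}} :=
  [set e : {set 'I_4} | [exists i : 'I_4, exists j : 'I_4, (val j == (i.+1 %% 4)) && (e == [set i; j])]].

Definition Fn_blue (n : nat) : {set {set 'I_n}} := Sstar n.
Definition Fn_red (n : nat) : {set {set 'I_n}} :=
  [set e : {set 'I_n} | [exists i : 'I_n, exists j : 'I_n, (odd i && (val j == i.+1)) && (e == [set i; j])]].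
Definition Fn (n : nat) : {set {set 'I_n}} := Fn_blue n :|: Fn_red n.

Definition ex (k m n : nat) (H : {set {set 'I_k}}) (F : {set {set 'I_m}}) : nat :=
  \max_(E : {set {set 'I_n}} | is_graph E && (Ncount F E == 0)) Ncount H E.

Definition Ncol (k1 k2 n : nat) (H1 : {set {set 'I_k1}}) (H2 : {set {set 'I_k2}})
  (E1 E2 : {set {set 'I_n}}) : nat :=
  Ncount H1 E1 + Ncount H2 E2.

(* ex^col(n, (H1, H2), F): max over F-free graphs E and 2-colorings of E,
   a coloring being given by the set E1 of color-1 edges (color 2 = E \ E1) *)
Definition excol (k1 k2 m n : nat) (H1 : {set {set 'I_k1}}) (H2 : {set {set 'I_k2}})
  (F : {set {set 'I_m}}) : nat :=
  \max_(E : {set {set 'I_n}} | is_graph E && (Ncount F E == 0))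
     \max_(E1 : {set {set 'I_n}} | E1 \subset E) Ncol H1 H2 E1 (E :\: E1).

(* Main.v *)
(** The copies of the star with k = r - 1 leaves are counted by the binomials C(d(v), k), the
copies of M_t by t-sets of disjoint edges, and being C4-free means that two vertices have at
most one common neighbor, so that sum_v C(d(v), 2) <= C(n, 2).

(1) Red edges with an endpoint of degree 1 are pairs without a common neighbor; any other red
edge is paid for, half by each endpoint, by the cherries it spoils. Hence the value is at most
C(n, 2), and for even n equality would force the friendship property, whose graphs have an odd
number of vertices.

(2), (3) Let a + 1 be the number of vertices that are not blue neighbors of a vertex v of largest
blue degree d. If a = 0, every other vertex has degree at most 2 and the red edges form a
matching. If a > 0, then sum_u d(u)(d(u) - 1) <= n(n - 1) leaves a budget of order a n to the
other blue degrees and to the red degrees, and what these can gain is less than the loss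
C(n - 1, k) - C(d, k).

(4) Let B be the set of vertices of blue degree larger than n^(3/4). If B is empty, recoloring
every blue edge red does not decrease the value. If not, replace the edges meeting the union A of
the blue neighborhoods of B, among which there are few red ones, by a dense C4-free graph
on A. When 3t = 2k both counts have order n^k, and the comparison of the leading constants, which
is tightest for (k, t) = (6, 4), needs C4-free graphs with (3/7) m^(3/2) edges for every large m.
These are subgraphs of polarity graphs over fields whose order lies close enough to sqrt m;
Chebyshev's quotient (30 n)! n! / ((15 n)! (10 n)! (6 n)!), which locates prime powers
up to a factor 6/5 + o(1), is precise enough. *)

From Stdlib Require Import Reals Lra Psatz.
Require Import Defs.
From mathcomp Require Import all_boot all_algebra all_field.
From mathcomp Require Import zify.
Set Implicit Arguments. Unset Strict Implicit. Unset Printing Implicit Defensive.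
Delimit Scope R_scope with Re.

(** * Graphs and their C4-free structure *)

Section FiniteCounting.

(** The boundary 3t = 2k explains the pair (4, 2). There a full star counts about n^k / k!, while a
    C4-free graph with c n^(3/2) edges has about c^t n^k / t! matchings, c being at most 1/2 + o(1);
    matchings win when t! < c^t k!. For (k, t) = (3, 2) this fails even at c = 1/2, since 8 > 6. For
    (6, 4) it asks c^4 > 1/30, and 3/7 = 0.4286 lies just above the threshold 0.4273. Reaching every
    c < 1/2 for all large m by this construction would require prime powers in ]N, (1 + o(1)) N];
    the distance from 3/7 to 1/2 is what makes Chebyshev's elementary bound sufficient. The exponent
    3/4 in (4) balances two improvements. A blue edge between vertices of blue degree at most
    n^(3/4) lies in O(n^(3(k-1)/4)) blue stars, whereas in the presence of order n^(3/2) red edges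
    its recoloring creates order n^(3(t-1)/2) red matchings, which is more because k + 2 <= 2t.
    Vertices above the threshold number O(n^(1/2)), so their neighborhoods are almost disjoint and
    clearing these costs few red edges. *)

Lemma sum_card_exchange (I X : finType) (P : pred I) (F : I -> {set X}) :
  \sum_(i | P i) #|F i| = \sum_(x : X) #|[set i | P i & x \in F i]|.
Proof.
under eq_bigr do rewrite -sum1_card big_mkcond /=.
rewrite exchange_big /=; apply: eq_bigr => x _.
rewrite -sum1_card -big_mkcondr /=; apply: eq_bigl => i.
by rewrite inE.
Qed.

Lemma sum_card_disjoint (I X : finType) (P : pred I) (F : I -> {set X}) (Y : {set X}) :
  (forall i, P i -> F i \subset Y) ->
  (forall i j x, P i -> P j -> x \in F i -> x \in F j -> i = j) ->
  \sum_(i | P i) #|F i| <= #|Y|.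
Proof.
move=> sFY inj; rewrite sum_card_exchange (bigID (mem Y)) /=.
rewrite [X in _ + X]big1 ?addn0; last first.
  move=> x xY; apply/eqP; rewrite cards_eq0; apply/eqP/setP => i; rewrite !inE.
  by apply/negP => /andP[Pi xi]; rewrite (subsetP (sFY i Pi) x xi) in xY.
rewrite -sum1_card; apply: leq_sum => x _.
rewrite leqNgt; apply/negP => /card_gt1P[i [j [+ + /eqP]]].
by rewrite !inE => /andP[Pi xi] /andP[Pj xj]; apply; apply: inj xi xj.
Qed.

Lemma leq_card_bigcup (I X : finType) (P : pred I) (F : I -> {set X}) :
  #|\bigcup_(i | P i) F i| <= \sum_(i | P i) #|F i|.
Proof.
elim/big_rec2: _ => [|i m A _ IH]; first by rewrite cards0.
by apply: leq_trans (leq_card_setU _ _) _; rewrite leq_add2l.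
Qed.

End FiniteCounting.

Section Graphs.
Variable T : finType.
Implicit Types (E : {set {set T}}) (u v w : T) (e : {set T}).

(** [is_graph] over an arbitrary finite vertex type, so that it also applies to polarity graphs,
    whose vertices are pairs of field elements. *)
Definition graph E := [forall e in E, #|e| == 2].
Definition nb E v := [set u | [set v; u] \in E].
Definition deg E v := #|nb E v|.
(** The cycle v u w u' exists exactly when both alternatives fail. *)
Definition c4free E := forall v w u u',
  u \in nb E v -> u \in nb E w -> u' \in nb E v -> u' \in nb E w ->
  v = w \/ u = u'.

Lemma in_nb E u v : (u \in nb E v) = ([set v; u] \in E).
Proof. by rewrite inE. Qed.

Lemma nbC E u v : (u \in nb E v) = (v \in nb E u).
Proof. by rewrite !in_nb setUC. Qed.

Lemma graphP E e : graph E -> e \in E -> #|e| = 2.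
Proof. by move/forall_inP => g /g /eqP. Qed.

Lemma graph_sub E E' : E' \subset E -> graph E -> graph E'.
Proof. by move=> /subsetP s /forall_inP g; apply/forall_inP => e /s /g. Qed.

Lemma nb_neq E u v : graph E -> u \in nb E v -> v != u.
Proof. by move=> g; rewrite in_nb => /(graphP g) /eqP; rewrite cards2; case: (v != u). Qed.

Lemma nb_irr E v : graph E -> v \notin nb E v.
Proof. by move=> g; apply/negP => /(nb_neq g); rewrite eqxx. Qed.

Lemma nb_sub E E' v : E' \subset E -> nb E' v \subset nb E v.
Proof. by move=> /subsetP s; apply/subsetP => u; rewrite !in_nb => /s. Qed.

Lemma deg_sub E E' v : E' \subset E -> deg E' v <= deg E v.
Proof. by move=> s; apply/subset_leq_card/nb_sub. Qed.

Lemma c4free_sub E E' : E' \subset E -> c4free E -> c4free E'.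
Proof.
move=> s c v w u u' h1 h2 h3 h4.
by apply: c; rewrite (subsetP (nb_sub _ s)).
Qed.

Lemma edge2P E e : graph E -> e \in E ->
  exists u v, [/\ u != v, e = [set u; v] & v \in nb E u].
Proof.
move=> g eE; have /eqP/cards2P[u [v [uv ev]]] := graphP g eE.
by exists u, v; split; rewrite // in_nb -ev.
Qed.

Lemma edge_at E e v : graph E -> e \in E -> v \in e ->
  exists2 u, u \in nb E v & e = [set v; u].
Proof.
move=> g eE ve; have [a [b [ab eab ba]]] := edge2P g eE.
move: ve; rewrite eab !inE => /orP[] /eqP ->; first by exists b.
by exists a; rewrite ?[[set b; a]]setUC // nbC.
Qed.

Lemma set2_injr v : injective (fun u => [set v; u]).
Proof.
move=> u u' /setP eq; have := eq u; have := eq u'; rewrite !inE !eqxx !orbT.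
by case: (u' =P v) => [->|_] /=; [rewrite orbb => _ /esym/eqP|move=> /eqP].
Qed.

Lemma edges_at_nb E v : graph E ->
  [set e in E | v \in e] = [set [set v; u] | u in nb E v].
Proof.
move=> g; apply/setP => e; rewrite inE; apply/andP/imsetP.
  by case=> eE ve; have [u] := edge_at g eE ve; exists u.
by case=> u; rewrite in_nb => h ->; rewrite h !inE eqxx.
Qed.

Lemma degE E v : graph E -> deg E v = #|[set e in E | v \in e]|.
Proof. by move=> g; rewrite edges_at_nb // card_imset //; apply: set2_injr. Qed.

Lemma handshake E : graph E -> \sum_v deg E v = 2 * #|E|.
Proof.
move=> g; under eq_bigr do rewrite degE //.
rewrite (sum_card_exchange xpredT) (bigID (mem E)) /= [X in _ + X]big1 ?addn0.
  rewrite mulnC -sum_nat_const; apply: eq_bigr => e eE.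
  rewrite -(graphP g eE); apply: eq_card => v.
  by rewrite !inE eE.
move=> e eE; apply/eqP; rewrite cards_eq0; apply/eqP/setP => v.
by rewrite !inE (negbTE eE).
Qed.

Definition pairs_in (A : {set T}) := [set p : {set T} | p \subset A & #|p| == 2].

Lemma card_pairs_in A : #|pairs_in A| = 'C(#|A|, 2).
Proof. exact: cards_draws. Qed.

Lemma cherry_center E p v w : c4free E ->
  p \in pairs_in (nb E v) -> p \in pairs_in (nb E w) -> v = w.
Proof.
move=> c; rewrite !inE => /andP[/subsetP sv /cards2P[a [b [ab pE]]]] /andP[/subsetP sw _].
have ap : a \in p by rewrite pE !inE eqxx.
have bp : b \in p by rewrite pE !inE eqxx orbT.
case: (c v w a b) => //; try by [apply: sv|apply: sw].
by move=> e; rewrite e eqxx in ab.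
Qed.

Lemma sum_cherries_leq E : c4free E -> \sum_v 'C(deg E v, 2) <= 'C(#|T|, 2).
Proof.
move=> c; rewrite -[#|T|]cardsT -card_pairs_in.
under eq_bigr do rewrite -card_pairs_in.
apply: sum_card_disjoint => [v _|v w p _ _]; last exact: cherry_center.
by apply/subsetP => p; rewrite !inE subsetT => /andP[].
Qed.

Lemma deg_setD E E1 v : E1 \subset E -> deg E v = deg E1 v + deg (E :\: E1) v.
Proof.
move=> s; rewrite /deg -(cardsID (nb E1 v) (nb E v)); congr (_ + _).
  by rewrite (setIidPr (nb_sub _ s)).
by apply: eq_card => u; rewrite !inE.
Qed.

Definition avoiding E (A : {set T}) := [set e in E | [disjoint e & A]].

Lemma avoiding_sub E A : avoiding E A \subset E.
Proof. by apply/subsetP => e; rewrite inE => /andP[]. Qed.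

End Graphs.

(** * Copies of stars, matchings and C4 inside a graph *)

Section Copies.
Variable n : nat.
Implicit Types (E : {set {set 'I_n}}) (F : {set {set 'I_n}}).

Lemma copiesP k (H : {set {set 'I_k}}) E F :
  reflect (F \subset E /\ exists2 f : 'I_k -> 'I_n, injective f & F = [set f @: e | e : {set 'I_k} in H])
          (F \in copies H E).
Proof.
rewrite inE; apply: (iffP andP) => -[sFE].
  by case/existsP=> f /andP[/injectiveP fi /eqP FE]; split=> //; exists f.
case=> f fi FE; split=> //; apply/existsP; exists [ffun i => f i].
apply/andP; split; first by apply/injectiveP => i j; rewrite !ffunE; apply: fi.
apply/eqP; rewrite FE; apply: eq_imset => e.
by apply: eq_imset => i; rewrite ffunE.
Qed.

Lemma Sstar_imset k : Sstar k.+1 = [set [set ord0; j] | j in [set~ (ord0 : 'I_k.+1)]].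
Proof.
apply/setP => e; rewrite inE; apply/existsP/imsetP.
  case=> i /existsP[j /andP[/andP[/eqP i0 j0] /eqP ->]].
  exists j; first by rewrite !inE -val_eqE.
  by congr [set _; _]; apply: val_inj.
case=> j; rewrite !inE -val_eqE /= => j0 ->.
by exists ord0; apply/existsP; exists j; rewrite /= j0 eqxx.
Qed.

Lemma card_Sstar k : #|Sstar k.+1| = k.
Proof. by rewrite Sstar_imset card_imset ?cardsC1 ?card_ord //; apply: set2_injr. Qed.

Definition substars k E v := [set F : {set {set 'I_n}} | F \subset [set e in E | v \in e] & #|F| == k].

Lemma card_substars k E v : graph E -> #|substars k E v| = 'C(deg E v, k).
Proof. by move=> g; rewrite cards_draws degE. Qed.

Lemma Ncount_star_leq k E : graph E -> Ncount (Sstar k.+1) E <= \sum_v 'C(deg E v, k).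
Proof.
move=> g; under eq_bigr do rewrite -card_substars //.
apply: leq_trans (leq_card_bigcup _ _); apply/subset_leq_card/subsetP => F.
case/copiesP=> sFE [f fi FE]; apply/bigcupP; exists (f ord0) => //.
rewrite inE [in X in _ && X]FE card_imset ?card_Sstar ?eqxx ?andbT; last exact: imset_inj.
apply/subsetP => e eF; rewrite inE (subsetP sFE) //=.
move: eF; rewrite FE Sstar_imset => /imsetP[_ /imsetP[j _ ->] ->].
by rewrite imset_f // !inE eqxx.
Qed.

(** Two distinct edges share at most one vertex, so a star with k >= 2 leaves determines its center
    and is counted once on the left; a single edge would be counted at both ends. *)
Lemma Ncount_star_geq k E : graph E -> 2 <= k ->
  \sum_v 'C(deg E v, k) <= Ncount (Sstar k.+1) E.
Proof.
move=> g k2; under eq_bigr do rewrite -card_substars //.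
apply: sum_card_disjoint => [v _|v w F _ _]; last first.
  rewrite !inE => /andP[/subsetP sv /eqP cF] /andP[/subsetP sw _].
  have /card_gt1P[e [e' [eF e'F ee']]] : 1 < #|F| by rewrite cF.
  apply/eqP/negPn/negP => vw; case/negP: ee'.
  have E2 a : a \in F -> a = [set v; w].
    move=> aF; have:= sv _ aF; have:= sw _ aF; rewrite !inE => /andP[aE wa] /andP[_ va].
    apply/esym/eqP; rewrite eqEcard (graphP g aE) cards2 vw leqnn andbT.
    by apply/subsetP => x; rewrite !inE => /orP[] /eqP ->.
  by rewrite (E2 e) // (E2 e').
apply/subsetP => F; rewrite inE => /andP[/subsetP sF /eqP cF].
have sFE : F \subset E by apply/subsetP => e /sF; rewrite inE => /andP[].
apply/copiesP; split => //.
pose U := nb F v.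
have vU : v \notin U by apply: nb_irr; apply: graph_sub sFE g.
have FU : F = [set [set v; u] | u in U].
  rewrite -edges_at_nb; last exact: graph_sub sFE g.
  by apply/setP => e; rewrite inE; case eF: (e \in F) => //=; have := sF _ eF; rewrite inE => /andP[].
have cU : size (enum U) = k by rewrite -cardE -cF FU card_imset //; apply: set2_injr.
exists (fun i : 'I_k.+1 => nth v (v :: enum U) i).
  move=> i j /eqP; rewrite nth_uniq /= ?cU //; first by move/eqP/val_inj.
  by rewrite mem_enum vU enum_uniq.
rewrite Sstar_imset -imset_comp {1}FU; apply/setP => e; apply/imsetP/imsetP.
  case=> u uU ->; have iU : index u (enum U) < k by rewrite -cU index_mem mem_enum.
  exists (Ordinal (iU : (index u (enum U)).+1 < k.+1)); first by rewrite !inE.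
  by rewrite /= imsetU1 imset_set1 /= nth_index // mem_enum.
case=> -[[|j] jk]; first by rewrite !inE.
move=> _ ->; exists (nth v (enum U) j); first by rewrite -mem_enum mem_nth // cU.
by rewrite /= imsetU1 imset_set1.
Qed.

Definition matchings k E :=
  [set F : {set {set 'I_n}} | [&& F \subset E, #|F| == k & trivIset F]].

Lemma Mmatch_edge_subproof k (i : 'I_k) (b : bool) : i.*2 + b < 2 * k.
Proof. by case: i b => i ik [] /=; lia. Qed.
Definition Mmatch_vertex k (b : bool) (i : 'I_k) : 'I_(2 * k) := Ordinal (Mmatch_edge_subproof i b).

Lemma Mmatch_imset k :
  Mmatch k = [set [set Mmatch_vertex false i; Mmatch_vertex true i] | i in 'I_k].
Proof.
apply/setP => e; rewrite inE; apply/existsP/imsetP.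
  case=> i /existsP[j /andP[/andP[oi /eqP ij] /eqP ->]].
  have ik : i./2 < k by have := ltn_ord i; lia.
  exists (Ordinal ik) => //; congr [set _; _]; apply: val_inj; move: oi ij => /= oi ij; lia.
case=> i _ ->; exists (Mmatch_vertex false i); apply/existsP; exists (Mmatch_vertex true i).
by rewrite eqxx andbT /=; lia.
Qed.

Lemma Mmatch_disjoint k (e e' : {set 'I_(2 * k)}) :
  e \in Mmatch k -> e' \in Mmatch k -> e != e' -> [disjoint e & e'].
Proof.
rewrite Mmatch_imset => /imsetP[i _ ->] /imsetP[j _ ->] ij.
have {}ij : i != j by apply: contraNneq ij => ->.
rewrite -setI_eq0; apply/eqP/setP => x; rewrite !inE -!val_eqE /=.
have : val i <> val j by move=> h; rewrite (val_inj h) eqxx in ij.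
by move=> /=; lia.
Qed.

Lemma card_Mmatch k : #|Mmatch k| = k.
Proof.
rewrite Mmatch_imset card_imset ?card_ord // => i j /setP /(_ (Mmatch_vertex false i)).
rewrite !inE eqxx -!val_eqE /= => h; apply: val_inj => /=; lia.
Qed.

Lemma Ncount_match k E : graph E -> 0 < k -> Ncount (Mmatch k) E = #|matchings k E|.
Proof.
move=> g k0; apply: eq_card => F; rewrite [RHS]inE; apply/copiesP/idP.
  case=> -> [f fi FE] /=; rewrite [in X in X && _]FE card_imset ?card_Mmatch ?eqxx /=; last exact: imset_inj.
  apply/trivIsetP => A B; rewrite FE => /imsetP[e eM ->] /imsetP[e' e'M ->] ee'.
  have {ee'} ee' : e != e' by apply: contraNneq ee' => ->.
  rewrite -setI_eq0 -imsetI; last by move=> x y _ _; apply: fi.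
  by have := Mmatch_disjoint eM e'M ee'; rewrite -setI_eq0 => /eqP ->; rewrite imset0.
case/and3P=> sFE /eqP cF /trivIsetP tF; split=> //.
have c2 e : e \in F -> size (enum e) = 2 by move=> /(subsetP sFE) /(graphP g); rewrite -cardE.
have [x0 _] : exists x : 'I_n, true.
  have /card_gt0P[e eF] : 0 < #|F| by rewrite cF.
  by have := c2 _ eF; case: (enum e) => // x; exists x.
have sF : size (enum F) = k by rewrite -cardE.
pose ed i := nth set0 (enum F) i.
have edF i : i < k -> ed i \in F by move=> ik; rewrite -mem_enum mem_nth ?sF.
(* Vertices 2j and 2j + 1 go to the two ends of the j-th edge of [F]; [x0] is a default value for
   [nth]. *)
pose f (i : 'I_(2 * k)) := nth x0 (enum (ed i./2)) (odd i).
have half_lt (i : 'I_(2 * k)) : i./2 < k by have := ltn_ord i; lia.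
have fe i : f i \in ed i./2.
  by rewrite -mem_enum mem_nth // c2 ?edF //; case: (odd i).
exists f.
  move=> i j fij; have eij : ed i./2 = ed j./2.
    apply/eqP/negPn/negP => /tF; rewrite !edF // => /(_ isT isT).
    by rewrite -setI_eq0 => /eqP/setP/(_ (f i)); rewrite !inE fe fij fe.
  have hij : i./2 = j./2.
    by move/eqP: (eij); rewrite nth_uniq ?sF ?enum_uniq // => /eqP.
  move/eqP: fij; rewrite /f eij nth_uniq ?enum_uniq ?c2 ?edF // ?[_ < 2]ltnS ?leq_b1 //.
  move=> /eqP oij; apply: val_inj => /=; rewrite -(odd_double_half i) -(odd_double_half j).
  by rewrite hij oij.
have fed (i : 'I_k) : f @: [set Mmatch_vertex false i; Mmatch_vertex true i] = ed i.
  rewrite imsetU1 imset_set1 /f /=.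
  have -> : (i.*2 + 0)./2 = i by lia.
  have -> : (i.*2 + 1)./2 = i by lia.
  have -> : odd (i.*2 + 0) = false by lia.
  have -> : odd (i.*2 + 1) = true by lia.
  have := c2 _ (edF i (ltn_ord i)); case El: (enum _) => [|x [|y []]] //= _.
  by apply/setP => z; rewrite -[in RHS]mem_enum El !inE.
rewrite Mmatch_imset -imset_comp; apply/setP => e; apply/idP/imsetP.
  move=> eF; have ik : index e (enum F) < k by rewrite -sF index_mem mem_enum.
  by exists (Ordinal ik) => //; rewrite /= fed /ed nth_index // mem_enum.
by case=> i _ -> /=; rewrite fed edF.
Qed.

Lemma C4_edges : C4 = [set [set inord 0; inord 1]; [set inord 1; inord 2];
                          [set inord 2; inord 3]; [set inord 3; inord 0]].
Proof.
apply/setP => e; rewrite !inE; apply/existsP/idP.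
  case=> i /existsP[j /andP[/eqP ji /eqP ->]].
  have -> : i = inord i by rewrite inord_val.
  have -> : j = inord (i.+1 %% 4) by apply: val_inj; rewrite /= inordK // ltn_mod.
  by case: i {ji} => -[|[|[|[|]]]] //= _; rewrite eqxx ?orbT.
rewrite -!orbA => /or4P[] /eqP ->; [exists (inord 0)|exists (inord 1)|exists (inord 2)|exists (inord 3)];
  apply/existsP; [exists (inord 1)|exists (inord 2)|exists (inord 3)|exists (inord 0)];
  by rewrite eqxx andbT /= !inordK.
Qed.

Lemma C4_freeP E : graph E -> (Ncount C4 E == 0) <-> c4free E.
Proof.
move=> g; split=> [|c].
  rewrite cards_eq0 => /eqP noC v w u u' uv uw u'v u'w.
  case: (v =P w) => [|/eqP vw]; first by left.
  case: (u =P u') => [|/eqP uu']; first by right.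
  exfalso; pose s := [:: v; u; w; u'].
  have us : uniq s.
    by rewrite /= !inE !negb_or vw uu' (nb_neq g uv) (nb_neq g u'v) (nb_neq g u'w) [u == w]eq_sym (nb_neq g uw).
  pose f (i : 'I_4) := nth v s i.
  suff : [set f @: e | e : {set 'I_4} in C4] \in copies C4 E by rewrite noC inE.
  apply/copiesP; split; last first.
    by exists f => // i j /eqP; rewrite /f nth_uniq // => /eqP/val_inj.
  apply/subsetP => _ /imsetP[e + ->].
  rewrite C4_edges !inE -!orbA => /or4P[] /eqP ->; rewrite imsetU1 imset_set1 /f !inordK //=.
  - by rewrite -in_nb.
  - by rewrite setUC -in_nb.
  - by rewrite -in_nb.
  - by rewrite setUC -in_nb.
rewrite cards_eq0; apply/eqP/setP => F; rewrite [RHS]inE; apply/negP.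
case/copiesP=> /subsetP sFE [f fi FE].
have ed (i j : 'I_4) : [set i; j] \in C4 -> f j \in nb E (f i).
  by move=> h; rewrite in_nb; apply: sFE; rewrite FE; apply/imsetP; exists [set i; j]; rewrite // imsetU1 imset_set1.
have [||||/fi/(congr1 val)|/fi/(congr1 val)] := c (f (inord 0)) (f (inord 2)) (f (inord 1)) (f (inord 3)).
- by apply: ed; rewrite C4_edges !inE eqxx.
- by rewrite nbC; apply: ed; rewrite C4_edges !inE eqxx !orbT.
- by rewrite nbC; apply: ed; rewrite C4_edges !inE eqxx !orbT.
- by apply: ed; rewrite C4_edges !inE eqxx !orbT.
- by rewrite /= !inordK.
- by rewrite /= !inordK.
Qed.

End Copies.

(** * Bounds on the number of matchings *)

Section Matchings.
Variable n : nat.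
Implicit Types (E F : {set {set 'I_n}}) (e : {set 'I_n}).

Lemma deg_leq E v : deg E v <= n.
Proof. by rewrite -[n in _ <= n]card_ord max_card. Qed.

Lemma card_avoiding E A : graph E -> #|E| <= #|avoiding E A| + #|A| * n.
Proof.
move=> g; rewrite -(cardsID (avoiding E A) E) (setIidPr (avoiding_sub E A)) leq_add2l.
have /subset_leq_card/leq_trans-> // :
    E :\: avoiding E A \subset \bigcup_(v in A) [set e in E | v \in e].
  apply/subsetP => e; rewrite !inE => /andP[+ eE]; rewrite eE /= -setI_eq0 => /set0Pn[v].
  by rewrite inE => /andP[ve vA]; apply/bigcupP; exists v; rewrite // inE eE.
apply: leq_trans (leq_card_bigcup _ _) _; rewrite -sum_nat_const.
by apply: leq_sum => v _; rewrite -degE ?deg_leq.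
Qed.

Lemma card_cover_matching k E F : graph E -> F \in matchings k E -> #|cover F| <= 2 * k.
Proof.
move=> g; rewrite inE => /and3P[/subsetP s /eqP <- _].
apply: leq_trans (leq_card_bigcup _ _) _.
rewrite mulnC -sum_nat_const; apply: leq_sum => e /s eE.
by rewrite (graphP g eE).
Qed.

Lemma setU1_matching k E F e : graph E -> F \in matchings k E ->
  e \in avoiding E (cover F) -> e \notin F /\ e |: F \in matchings k.+1 E.
Proof.
move=> g; rewrite !inE => /and3P[sF /eqP cF /trivIsetP tF] /andP[eE dis].
have e0 : e != set0 by rewrite -card_gt0 (graphP g eE).
have dis1 a : a \in F -> [disjoint e & a].
  by move=> aF; apply: disjointWr dis; apply: (bigcup_max a).
have eF : e \notin F.
  by apply: contraNN e0 => /dis1; rewrite -setI_eq0 setIid.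
split; rewrite // cardsU1 eF cF add1n eqxx subUset sub1set eE sF /=.
apply/trivIsetP => a b; rewrite !inE => /predU1P[->|aF] /predU1P[->|bF]; rewrite ?eqxx //.
- by move=> _; apply: dis1.
- by move=> _; rewrite disjoint_sym; apply: dis1.
- exact: tF.
Qed.

(** Double counting of the pairs formed by a (k + 1)-matching and one of its edges: a k-matching
    covers at most 2k vertices, so all but 2kn edges extend it. *)
Lemma matchings_extend k E : graph E ->
  #|matchings k E| * (#|E| - 2 * k * n) <= k.+1 * #|matchings k.+1 E|.
Proof.
move=> g; rewrite -sum_nat_const.
pose X F := [set (e |: F, e) | e in avoiding E (cover F)].
pose Y := [set p : {set {set 'I_n}} * {set 'I_n} | (p.1 \in matchings k.+1 E) && (p.2 \in p.1)].
apply: (@leq_trans (\sum_(F in matchings k E) #|X F|)).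
  apply: leq_sum => F FM; rewrite card_imset; last by move=> ? ? [].
  rewrite leq_subLR addnC; apply: leq_trans (card_avoiding (cover F) g) _.
  by rewrite leq_add2l leq_mul2r (card_cover_matching g FM) orbT.
apply: (@leq_trans #|Y|).
  apply: sum_card_disjoint => [F FM|F F' x FM F'M].
    apply/subsetP => _ /imsetP[e eA ->]; rewrite !inE /= eqxx /= andbT.
    by have [_] := setU1_matching g FM eA; rewrite inE.
  case/imsetP=> e eA -> /imsetP[e' e'A [eq ee']]; move: eq; rewrite -{}ee' in e'A *.
  have [eF _] := setU1_matching g FM eA; have [eF' _] := setU1_matching g F'M e'A.
  by move=> eq; rewrite -(setU1K eF) eq setU1K.
have -> : #|Y| = \sum_(F in matchings k.+1 E) #|F|.
  rewrite -sum1_card (eq_bigl _ _ (in_set _)) -(pair_big_dep (mem (matchings k.+1 E)) (fun F e => e \in F) (fun _ _ => 1)) /=.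
  by apply: eq_bigr => F _; rewrite sum1_card.
rewrite mulnC -sum_nat_const; apply: leq_sum => F.
by rewrite inE => /and3P[_ /eqP -> _].
Qed.

(** Iterated extension. The error 2kn is negligible when the edges have order n^(3/2), and then the
    bound agrees with [matchings_leq] to first order. *)
Lemma matchings_geq k E : graph E ->
  (#|E| - 2 * k * n) ^ k <= k`! * #|matchings k E|.
Proof.
move=> g; elim: k => [|k IH].
  rewrite expn0 mul1n card_gt0; apply/set0Pn; exists set0.
  by rewrite inE sub0set cards0 eqxx; apply/trivIsetP => a b; rewrite inE.
apply: (@leq_trans ((#|E| - 2 * k * n) ^ k.+1)).
  by rewrite leq_exp2r //; nia.
rewrite expnSr; apply: leq_trans (leq_mul IH (leqnn _)) _.
rewrite factS -[k.+1 * _ * _]mulnA [_ * (k`! * _)]mulnCA -mulnA leq_mul2l matchings_extend ?orbT //.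
Qed.

Lemma matchings_leq k E : k`! * #|matchings k E| <= #|E| ^ k.
Proof.
apply: (@leq_trans (#|E| ^_ k)).
  rewrite -bin_ffact mulnC leq_mul2r -cards_draws orbC subset_leq_card //.
  by apply/subsetP => F; rewrite !inE => /and3P[-> ->].
elim: k => // k IH; rewrite ffactnSr expnSr leq_mul // leq_subr //.
Qed.

(* Counts the matchings of [E] with exactly one edge in [E1]. *)
Lemma matchings_recolor k E E1 : graph E -> E1 \subset E ->
  k`! * #|matchings k.+1 (E :\: E1)| + #|E1| * (#|E :\: E1| - 2 * k.+1 * n) ^ k
    <= k`! * #|matchings k.+1 E|.
Proof.
move=> g sE1; set E2 := E :\: E1.
have sE2 : E2 \subset E by apply: subsetDl.
have sM : matchings k.+1 E2 \subset matchings k.+1 E.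
  by apply/subsetP => F; rewrite !inE => /and3P[s -> ->]; rewrite (subset_trans s).
rewrite -(cardsID (matchings k.+1 E2) (matchings k.+1 E)) (setIidPr sM) mulnDr leq_add2l.
have gE2 (b : {set 'I_n}) : graph (avoiding E2 b).
  by apply: graph_sub g; apply: subset_trans (avoiding_sub _ _) sE2.
apply: (@leq_trans (k`! * \sum_(b in E1) #|matchings k (avoiding E2 b)|)).
  rewrite -sum_nat_const big_distrr /=; apply: leq_sum => b bE1.
  apply: leq_trans (matchings_geq k (gE2 b)).
  case: (posnP k) => [->|k0]; first by rewrite !expn0.
  rewrite leq_exp2r //.
  have := card_avoiding b (graph_sub sE2 g); rewrite (graphP g (subsetP sE1 _ bE1)).
  have -> : 2 * k.+1 * n = 2 * k * n + 2 * n by rewrite mulnS mulnDl addnC.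
  by move: (2 * k * n) #|E2| #|avoiding E2 b|; clear; lia.
rewrite leq_mul2l; apply/orP; right.
have MP b F : b \in E1 -> F \in matchings k (avoiding E2 b) ->
    b \notin F /\ b |: F \in matchings k.+1 E.
  move=> bE1; rewrite inE => /and3P[sF cF tF].
  apply: setU1_matching => //.
    rewrite inE cF tF andbT andbT.
    by apply: subset_trans sF (subset_trans (avoiding_sub _ _) sE2).
  rewrite inE (subsetP sE1) //= disjoint_sym -setI_eq0 -subset0.
  apply/subsetP => x; rewrite inE => /andP[/bigcupP[e eF xe] xb].
  move: (subsetP sF e eF); rewrite inE => /andP[_]; rewrite -setI_eq0 => /eqP/setP/(_ x).
  by rewrite !inE xe xb.
apply: (@leq_trans (\sum_(b in E1) #|[set b |: F | F in matchings k (avoiding E2 b)]|)).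
  apply: leq_sum => b bE1; rewrite card_in_imset // => F F' /(MP b _ bE1)[bF _] /(MP b _ bE1)[bF' _] eq.
  by rewrite -(setU1K bF) eq setU1K.
apply: sum_card_disjoint => [b bE1|b b' G bE1 b'E1].
  apply/subsetP => _ /imsetP[F FM ->]; have [_ h] := MP b F bE1 FM.
  rewrite inE h andbT; apply/negP; rewrite inE => /andP[/subsetP/(_ b)].
  by rewrite !inE eqxx bE1 => /(_ isT).
case/imsetP=> F FM -> /imsetP[F' F'M eq].
have : b \in b' |: F' by rewrite -eq setU11.
case/setU1P => // bF'; move: F'M; rewrite inE => /and3P[/subsetP/(_ b bF')].
by rewrite !inE bE1.
Qed.

End Matchings.

(** * Neighborhoods and degree sums in C4-free graphs *)

Section C4freeStructure.
Variable T : finType.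
Implicit Types (E K : {set {set T}}) (A B : {set T}) (u v w : T).

Lemma card_common_nb E v w : c4free E -> v != w -> #|nb E v :&: nb E w| <= 1.
Proof.
move=> c vw; rewrite leqNgt; apply/negP => /card_gt1P[u [u' []]].
rewrite !in_setI => /andP[uv uw] /andP[u'v u'w] uu'.
by case: (c v w u u' uv uw u'v u'w) => h; [rewrite h eqxx in vw|rewrite h eqxx in uu'].
Qed.

(** A vertex adjacent to m >= 1 points of [B] is counted m <= 1 + C(m, 2) times on the left. Each
    pair of points of [B] has at most one common neighbor, so the excesses add up to at most C(|B|,
    2). *)
Lemma sum_deg_leq_bigcup E B : c4free E ->
  \sum_(v in B) deg E v <= #|\bigcup_(v in B) nb E v| + 'C(#|B|, 2).
Proof.
move=> c; rewrite sum_card_exchange.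
apply: (@leq_trans (\sum_x ((x \in \bigcup_(v in B) nb E v) + #|pairs_in (nb E x :&: B)|))).
  apply: leq_sum => x _; rewrite card_pairs_in.
  have -> : [set v | v \in B & x \in nb E v] = nb E x :&: B.
    by apply/setP => v; rewrite !inE [[set x; v]]setUC andbC.
  case: (posnP #|nb E x :&: B|) => [->//|/card_gt0P[v]].
  rewrite inE => /andP[vx vB].
  have -> /= : x \in \bigcup_(v in B) nb E v by apply/bigcupP; exists v; rewrite // nbC.
  by case: #|_| => // m; rewrite binS bin1; lia.
rewrite big_split /= leq_add //.
  by rewrite -sum1_card [X in _ <= X]big_mkcond /=; apply: leq_sum => x _; case: (_ \in _).
rewrite -card_pairs_in; apply: sum_card_disjoint => [x _|x y p _ _].
  by apply/subsetP => p; rewrite !inE => /andP[/subsetIP[_ ->]].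
by rewrite !(inE, subsetI) -!andbA => /and3P[px _ cp] /and3P[py _ _];
  apply: (cherry_center c (p := p)); rewrite inE ?px ?py.
Qed.

(* An edge of color 2 from [u] to a point of [nb E1 v] is determined by [(u, v)]. *)
Lemma card_avoiding_bigcup_nb E E1 B : graph E -> c4free E -> E1 \subset E ->
  #|E :\: E1| <= #|avoiding (E :\: E1) (\bigcup_(v in B) nb E1 v)| + #|B| * #|T|.
Proof.
move=> g c sE1; set E2 := E :\: E1; set A := \bigcup_(v in B) _.
have sE2 : E2 \subset E by apply: subsetDl.
have g2 := graph_sub sE2 g.
rewrite -(cardsID (avoiding E2 A) E2) (setIidPr (avoiding_sub E2 A)) leq_add2l.
pose K u v := [set [set u; a] | a in nb E2 u :&: nb E1 v].
apply: (@leq_trans #|\bigcup_(v in B) \bigcup_u K u v|).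
  apply/subset_leq_card/subsetP => e; rewrite inE => /andP[+ eE2].
  rewrite inE eE2 /= -setI_eq0 => /set0Pn[a]; rewrite inE => /andP[ae /bigcupP[v vB av]].
  have [u ua eu] := edge_at g2 eE2 ae; apply/bigcupP; exists v => //; apply/bigcupP; exists u => //.
  by apply/imsetP; exists a; [rewrite inE av nbC ua|rewrite setUC].
apply: leq_trans (leq_card_bigcup _ _) _; rewrite -sum_nat_const; apply: leq_sum => v vB.
apply: leq_trans (leq_card_bigcup _ _) _; rewrite -sum1_card; apply: leq_sum => u _.
apply: leq_trans (leq_imset_card _ _) _.
case: (eqVneq u v) => [->|uv].
  rewrite (_ : _ :&: _ = set0) ?cards0 //; apply/setP => a; rewrite !inE.
  by case: (_ \in E1) => //; rewrite andbF.
apply: leq_trans (card_common_nb c uv); apply/subset_leq_card/setISS; exact: nb_sub.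
Qed.

Lemma graphU E K : graph E -> graph K -> graph (E :|: K).
Proof.
by move=> gE gK; apply/forall_inP => e /setUP[] h; rewrite ?(graphP gE h) ?(graphP gK h).
Qed.

Section Glue.
Variables (E K : {set {set T}}) (A : {set T}).
Hypotheses (gE : graph E) (gK : graph K).
Hypotheses (dE : forall e, e \in E -> [disjoint e & A]) (sK : forall e, e \in K -> e \subset A).

Lemma nb_glue v : nb (E :|: K) v = if v \in A then nb K v else nb E v.
Proof.
apply/setP => u; case: ifP => vA; rewrite !inE.
  rewrite orb_idl // => /dE; rewrite -setI_eq0 => /eqP/setP/(_ v).
  by rewrite !inE eqxx vA.
by rewrite orb_idr // => /sK/subsetP/(_ v); rewrite !inE eqxx vA => /(_ isT).
Qed.

Lemma c4free_glue : c4free E -> c4free K -> c4free (E :|: K).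
Proof.
have nbA v u : u \in nb (E :|: K) v -> (u \in A) = (v \in A).
  rewrite nb_glue; case: ifP => vA; rewrite in_nb => h.
    by move: (subsetP (sK h) u); rewrite !inE eqxx orbT => ->.
  move: (dE h); rewrite -setI_eq0 => /eqP/setP/(_ u).
  by rewrite !inE eqxx orbT.
move=> cE cK v w u u' uv uw u'v u'w.
have wv : (w \in A) = (v \in A) by rewrite -(nbA _ _ uv) -(nbA _ _ uw).
move: uv uw u'v u'w; rewrite !nb_glue wv; case: ifP => _; [exact: cK|exact: cE].
Qed.

Lemma card_glue : #|E :|: K| = #|E| + #|K|.
Proof.
apply/eqP; rewrite (leq_card_setU E K).2 -setI_eq0; apply/eqP/setP => e; rewrite !inE.
apply/negP => /andP[eE eK]; move: (dE eE); rewrite -setI_eq0 (setIidPl (sK eK)).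
by rewrite -cards_eq0 (graphP gE eE).
Qed.

End Glue.

Lemma double_bin2 m : 2 * 'C(m, 2) = m * m.-1.
Proof. by rewrite mulnC -[2]/(2`!) bin_ffact ffactnS ffactn1. Qed.

Lemma sum_deg_pred E : c4free E ->
  \sum_v deg E v * (deg E v).-1 <= #|T| * #|T|.-1.
Proof.
move=> c; under eq_bigr do rewrite -double_bin2.
by rewrite -big_distrr -double_bin2 leq_mul2l; apply: sum_cherries_leq.
Qed.

Lemma sum_deg_pred_colored E E1 : c4free E -> E1 \subset E ->
  \sum_v deg E1 v * (deg E1 v).-1 + \sum_v deg (E :\: E1) v * (deg (E :\: E1) v).-1
    <= #|T| * #|T|.-1.
Proof.
move=> c sE1; apply: leq_trans (sum_deg_pred c); rewrite -big_split /=.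
by apply: leq_sum => v _; rewrite (deg_setD v sE1); nia.
Qed.

(** Cauchy-Schwarz, by summing 2 d(v) d(w) <= d(v)^2 + d(w)^2 over all pairs. *)
Lemma sum_square_geq (d : T -> nat) : (\sum_v d v) ^ 2 <= #|T| * \sum_v d v ^ 2.
Proof.
rewrite -(@leq_pmul2l 2) // -mulnn big_distrlr /=.
have -> : 2 * (#|T| * \sum_v d v ^ 2) = \sum_v \sum_w (d v ^ 2 + d w ^ 2).
  under [RHS]eq_bigr do rewrite big_split /= sum_nat_const.
  by rewrite big_split /= sum_nat_const -big_distrr /= mul2n addnn.
rewrite big_distrr /=; apply: leq_sum => v _; rewrite big_distrr /=; apply: leq_sum => w _.
by rewrite (nat_Cauchy _ _).1.
Qed.

(** Cauchy-Schwarz with d^2 = d (d - 1) + d; it turns a budget for d (d - 1) into a bound on the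
    number of edges. *)
Lemma edges_square_leq E : graph E ->
  4 * #|E| ^ 2 <= #|T| * (\sum_v deg E v * (deg E v).-1 + 2 * #|E|).
Proof.
move=> g; have := sum_square_geq (deg E); rewrite handshake // expnMn.
move/leq_trans; apply; rewrite leq_mul2l; apply/orP; right.
rewrite -handshake // -big_split /=; apply: leq_sum => v _.
by rewrite -mulnn; case: (deg E v) => // m; nia.
Qed.

Section BigVertex.
Variables (E E1 : {set {set T}}) (v : T).
Hypotheses (gE : graph E) (cE : c4free E) (sE1 : E1 \subset E).
Let A := nb E1 v.
Let W := ~: (v |: A).
Let E2 := E :\: E1.

Lemma card_nb_capA u : u != v -> #|nb E u :&: A| <= 1.
Proof.
move=> uv; apply: leq_trans (card_common_nb cE uv).
by apply/subset_leq_card/setIS/nb_sub.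
Qed.

(** Of the blue neighborhood of [v], the vertex [u] sees at most one point, and only |T| minus the
    blue degree of [v] vertices lie outside it. *)
Lemma deg_other u : u != v -> deg E u + deg E1 v <= #|T|.+1.
Proof.
move=> uv; have := card_nb_capA uv; rewrite -/A /deg -/A.
have : #|nb E u :\: A| + #|A| <= #|T|.
  by rewrite -(cardsC A) addnC leq_add2l; apply/subset_leq_card; rewrite setDE subsetIr.
by rewrite -(cardsID A (nb E u)); lia.
Qed.

Lemma card_outside : #|W| + deg E1 v = #|T|.-1.
Proof.
have vA : v \notin A by apply: nb_irr; apply: graph_sub sE1 gE.
by rewrite -(cardsC (v |: A)) cardsU1 vA /= addnC.
Qed.

Lemma sub_VAW (S : {set T}) : #|S| <= (v \in S) + #|S :&: A| + #|S :&: W|.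
Proof.
rewrite -(cardsID (v |: A) S) setDE leq_add //.
rewrite setIUr; apply: leq_trans (leq_card_setU _ _) _; rewrite leq_add2r.
rewrite setIC; case vS: (v \in S).
  by rewrite (setIidPl _) ?cards1 // sub1set.
by rewrite leqn0 cards_eq0; apply/eqP/setP => x; rewrite !inE; case: eqP => // ->.
Qed.

(** The red degrees are summed over [A], [v] and [W]. The red neighbors of [v] lie in [W]. A point
    of [A] has at most one red neighbor in [A], and the edges between [A] and [W] number at most
    |W|, as each w in [W] sees at most one point of [A]. A point of [W] has red degree at most |W| +
    2. *)
Lemma edges_color2_leq : 2 * #|E2| <= #|T|.-1 + #|W| ^ 2 + 3 * #|W|.
Proof.
have sE2 : E2 \subset E by apply: subsetDl.
have g2 := graph_sub sE2 gE.
have nbA2 u : u \in A -> v \notin nb E2 u.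
  by rewrite nbC !inE => ->.
rewrite -handshake // (bigID (mem A)) /= (bigD1 v (P := fun u => u \notin A)) /=; last first.
  by apply: nb_irr; apply: graph_sub sE1 gE.
have dv : deg E2 v <= #|W|.
  apply/subset_leq_card/subsetP => u u2; rewrite !inE negb_or.
  rewrite eq_sym (nb_neq g2 u2) /=; by move: u2; rewrite !inE => /andP[].
have dA : \sum_(u in A) deg E2 u <= deg E1 v + #|W|.
  apply: (@leq_trans (\sum_(u in A) (1 + #|nb E u :&: W|))).
    apply: leq_sum => u uA; apply: leq_trans (sub_VAW _) _.
    have uv : u != v by rewrite eq_sym (nb_neq (graph_sub sE1 gE) uA).
    rewrite (negbTE (nbA2 u uA)) add0n leq_add //.
      apply: leq_trans (card_nb_capA uv); apply/subset_leq_card/setSI/nb_sub/sE2.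
    by apply/subset_leq_card/setSI/nb_sub/sE2.
  rewrite big_split /= sum1_card leq_add2l sum_card_exchange.
  rewrite (bigID (mem W)) /= [X in _ + X]big1 ?addn0; last first.
    move=> x xW; apply/eqP; rewrite cards_eq0; apply/eqP/setP => u.
    by rewrite in_set in_setI (negbTE (xW : x \notin W)) !andbF in_set0.
  rewrite -sum1_card; apply: leq_sum => w; rewrite !inE negb_or => /andP[wv _].
  apply: leq_trans (card_nb_capA wv); apply/subset_leq_card/subsetP => u.
  by rewrite !in_set => /andP[-> /andP[+ _]]; rewrite [[set w; u]]setUC => ->.
have dW : \sum_(u | (u \notin A) && (u != v)) deg E2 u <= #|W| * (#|W| + 2).
  rewrite (eq_bigl (mem W)); last by move=> u; rewrite !inE negb_or andbC.
  rewrite -sum_nat_const; apply: leq_sum => u; rewrite !inE negb_or => /andP[uv _].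
  apply: leq_trans (sub_VAW _) _; rewrite addnC.
  apply: leq_add; first exact/subset_leq_card/subsetIr.
  apply: (leq_add (leq_b1 _)).
  by apply: leq_trans (card_nb_capA uv); apply/subset_leq_card/setSI/nb_sub/sE2.
apply: leq_trans (leq_add dA (leq_add dv dW)) _.
by have := card_outside; move: #|W| (deg E1 v) #|T|.-1; clear; nia.
Qed.

End BigVertex.
End C4freeStructure.

(** * Stars on three vertices against edges *)

Section Friendship.
Variable T : finType.
Variables (E : {set {set T}}).
Hypotheses (gE : graph E) (cE : c4free E).
Hypothesis friend : forall p : {set T}, #|p| = 2 -> exists v, p \subset nb E v.

Lemma friend_nb u v : u != v -> #|nb E u :&: nb E v| = 1.
Proof.
move=> uv; apply/eqP; rewrite eqn_leq (card_common_nb cE uv) card_gt0.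
have [|w /subsetP sw] := friend (p := [set u; v]); first by rewrite cards2 uv.
by apply/set0Pn; exists w; rewrite in_setI !(nbC E w) !sw // !inE eqxx ?orbT.
Qed.

(** The neighborhood of [v] induces a perfect matching: each u in it has exactly one common neighbor
    with [v]. *)
Lemma friend_deg_even v : 2 %| deg E v.
Proof.
pose E' := [set e in E | e \subset nb E v].
have gE' : graph E' by apply: graph_sub gE; apply/subsetP => e; rewrite inE => /andP[].
apply/dvdnP; exists #|E'|; rewrite mulnC -handshake // (bigID (mem (nb E v))) /=.
rewrite [X in _ + X]big1 ?addn0; last first.
  move=> u uv; apply/eqP; rewrite cards_eq0; apply/eqP/setP => w; rewrite !in_set.
  by apply/negP => /andP[_ /subsetP/(_ u)]; rewrite !inE eqxx in uv * => /(_ isT); apply/negP.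
rewrite -[deg E v]muln1 -sum_nat_const; apply: eq_bigr => u uv; rewrite -(@friend_nb u v).
  apply: eq_card => w; rewrite !in_set; apply: andb_id2l => uw.
  by rewrite subUset !sub1set uv in_nb.
by rewrite eq_sym (nb_neq gE uv).
Qed.

(** Every vertex other than [v] is the end of exactly one path of length two from [v]. Hence |T| - 1
    is the sum of d(u) - 1 over the neighbors u of [v], which is even because all degrees are. *)
Lemma friend_odd : 0 < #|T| -> odd #|T|.
Proof.
case/card_gt0P=> v _.
have e1 : \sum_(u in nb E v) #|nb E u :\ v| = #|T|.-1.
  rewrite sum_card_exchange -(cardsC1 v) -[RHS]sum1_card [RHS]big_mkcond /=.
  apply: eq_bigr => x _; rewrite !inE; case: (eqVneq x v) => [->|xv].
    by apply/eqP; rewrite cards_eq0; apply/eqP/setP => u; rewrite !inE eqxx andbF.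
  rewrite -(friend_nb xv); apply: eq_card => u.
  by rewrite in_setI in_set !inE xv /= andbC [[set u; x]]setUC.
have e2 : \sum_(u in nb E v) #|nb E u :\ v| + deg E v = \sum_(u in nb E v) deg E u.
  rewrite -[deg E v]muln1 -sum_nat_const -big_split /=; apply: eq_bigr => u uv.
  by rewrite addnC [RHS](cardsD1 v) nbC uv.
have : 2 %| \sum_(u in nb E v) deg E u.
  by apply: dvdn_sum => u _; apply: friend_deg_even.
rewrite -e2 dvdn_addl ?friend_deg_even // e1.
have : 0 < #|T| by apply/card_gt0P; exists v.
by rewrite dvdn2; case: #|T| => //= k _; rewrite negbK.
Qed.

End Friendship.

Section CherriesAndEdges.
Variable T : finType.
Variables (E E1 : {set {set T}}).
Hypotheses (gE : graph E) (cE : c4free E) (sE1 : E1 \subset E).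
Let E2 := E :\: E1.
Let Z := [set e in E2 | [exists u in e, deg E u == 1]].
Let R := E2 :\: Z.

Let sE2 : E2 \subset E. Proof. exact: subsetDl. Qed.

Lemma leaf_nb u v w : deg E u = 1 -> v \in nb E u -> w \in nb E u -> v = w.
Proof. by move=> /eqP/cards1P[x ->]; rewrite !inE => /eqP -> /eqP ->. Qed.

(* A pair in [Z] has a leaf, hence no common neighbor. *)
Lemma cherry_notin_Z v p : p \in pairs_in (nb E v) -> p \notin Z.
Proof.
rewrite inE => /andP[/subsetP sp cp]; rewrite inE; apply/negP => /andP[pE /exists_inP[u up /eqP du]].
have pE' := subsetP sE2 _ pE.
have [w wu pw] := edge_at gE pE' up.
have wp : w \in p by rewrite pw !inE eqxx orbT.
have uv : v \in nb E u by rewrite nbC sp.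
have := nb_irr v gE; rewrite (leaf_nb du uv wu) => /negP; apply.
by rewrite -(leaf_nb du uv wu) -[X in X \in _](leaf_nb du wu uv) sp.
Qed.

(** [Q] holds further pairs without a common neighbor: it is empty for the weak inequality and a
    single pair for the strict one. *)
Lemma sum_cherries_Z (Q : {set {set T}}) :
  Q \subset pairs_in setT -> (forall v p, p \in pairs_in (nb E v) -> p \notin Q) ->
  \sum_v 'C(deg E v, 2) + #|Z :|: Q| <= 'C(#|T|, 2).
Proof.
move=> sQ nQ; rewrite -[#|T|]cardsT -card_pairs_in.
have sZQ : Z :|: Q \subset pairs_in setT.
  rewrite subUset sQ andbT; apply/subsetP => e; rewrite !inE subsetT => /andP[/andP[_ eE] _].
  by rewrite (graphP gE eE).
rewrite -(cardsID (Z :|: Q) (pairs_in _)) (setIidPr sZQ) addnC leq_add2l.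
under eq_bigr do rewrite -card_pairs_in.
apply: sum_card_disjoint => [v _|v w p _ _]; last exact: cherry_center.
apply/subsetP => p pv; rewrite in_setD in_setU negb_or (cherry_notin_Z pv) (nQ _ _ pv).
by move: pv; rewrite !inE subsetT => /andP[].
Qed.

(** With b blue and c red edges at [v], coloring destroys b c + C(c, 2) cherries, and twice this
    number is at least c as soon as b + c >= 2. An end of an edge of [R] has degree at least 2. The
    inequality is strict if one of the red edges at [v] lies in [Z]. *)
Lemma nonleaf_charge v : 2 * 'C(deg E1 v, 2) + deg R v <= 2 * 'C(deg E v, 2) /\
  (2 <= deg E v -> deg R v < deg E2 v ->
   2 * 'C(deg E1 v, 2) + deg R v < 2 * 'C(deg E v, 2)).
Proof.
have dR : deg R v <= deg E2 v by apply/deg_sub/subsetDl.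
have d2 : 0 < deg R v -> 2 <= deg E v.
  case/card_gt0P=> u; rewrite in_nb inE => /andP[+ h]; rewrite inE h /= => /exists_inPn/(_ v).
  rewrite !inE eqxx => /(_ isT).
  have : 0 < deg E v by apply/card_gt0P; exists u; rewrite in_nb (subsetP sE2).
  by case: (deg E v) => [|[]].
rewrite !double_bin2; move: dR d2; rewrite (deg_setD v sE1) -/E2.
by case: (deg R v) (deg E1 v) (deg E2 v) => [|a] [|b] [|c] //; nia.
Qed.

Lemma sum_charge : \sum_v 'C(deg E1 v, 2) + #|R| <= \sum_v 'C(deg E v, 2).
Proof.
have gR : graph R by apply: graph_sub gE; apply: subset_trans (subsetDl _ _) sE2.
rewrite -(leq_pmul2l (n1 := _) (isT : 0 < 2)) mulnDr -handshake // !big_distrr -big_split /=.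
by apply: leq_sum => v _; case: (nonleaf_charge v).
Qed.

Lemma sum_charge_lt v : 2 <= deg E v -> deg R v < deg E2 v ->
  \sum_v 'C(deg E1 v, 2) + #|R| < \sum_v 'C(deg E v, 2).
Proof.
move=> d2 dR.
have gR : graph R by apply: graph_sub gE; apply: subset_trans (subsetDl _ _) sE2.
rewrite -(ltn_pmul2l (isT : 0 < 2)) mulnDr -handshake // !big_distrr -big_split /=.
rewrite (bigD1 v) //= [X in _ < X](bigD1 v) //= -addSn leq_add //.
  by case: (nonleaf_charge v) => _; apply.
by apply: leq_sum => w _; case: (nonleaf_charge w).
Qed.

Lemma card_E2_split : #|E2| = #|R| + #|Z|.
Proof.
rewrite -(cardsID Z E2) addnC; congr (_ + #|_ : {set _}|); apply/setIidPr.
by apply/subsetP => e; rewrite inE => /andP[].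
Qed.

Lemma cherries_edges_leq : \sum_v 'C(deg E1 v, 2) + #|E2| <= 'C(#|T|, 2).
Proof.
have := @sum_cherries_Z set0 (sub0set _) (fun v p _ => negbT (in_set0 p)).
rewrite setU0 card_E2_split; have := sum_charge.
by move: #|R| #|Z|; clear; lia.
Qed.

Lemma missing_pair_lt p : p \in pairs_in setT -> p \notin Z ->
  (forall v, ~~ (p \subset nb E v)) -> \sum_v 'C(deg E1 v, 2) + #|E2| < 'C(#|T|, 2).
Proof.
move=> p2 pZ np; have := @sum_cherries_Z [set p]; rewrite sub1set p2 => /(_ isT).
have h v q : q \in pairs_in (nb E v) -> q \notin [set p].
  by rewrite !inE => /andP[sq _]; apply: contraNneq (np v) => <-.
move=> /(_ h); rewrite setUC cardsU1 pZ card_E2_split; have := sum_charge.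
by move: #|R| #|Z|; clear; lia.
Qed.

(** A unit of loss is located in each case. Without leaf edges in red, parity rules out the
    friendship property, so some pair has no common neighbor. A red leaf edge whose other end has
    degree at least 2 makes the charge at that end strict. *)
Lemma cherries_edges_lt : 2 < #|T| -> ~~ odd #|T| ->
  \sum_v 'C(deg E1 v, 2) + #|E2| < 'C(#|T|, 2).
Proof.
move=> T3 oT; case: (set_0Vmem Z) => [Z0|[e eZ]].
  case: (boolP [forall p : {set T}, (#|p| == 2) ==> [exists v, p \subset nb E v]]).
    move=> /forall_inP fr; case/negP: oT; apply: (friend_odd gE cE); last by apply: ltn_trans T3.
    by move=> p /eqP/fr/existsP.
  rewrite negb_forall => /existsP[p]; rewrite negb_imply => /andP[p2 /existsPn np].
  by apply: (@missing_pair_lt p) => //; rewrite ?Z0 ?inE // subsetT p2.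
have := eZ; rewrite inE => /andP[eE2 /exists_inP[u ue /eqP du]].
have eE := subsetP sE2 _ eE2.
have [v vu ev] := edge_at gE eE ue.
have uv : u \in nb E v by rewrite nbC.
case: (ltnP 1 (deg E v)) => dv.
  have dR : deg R v < deg E2 v.
    apply/proper_card/properP; split; first exact/nb_sub/subsetDl.
    exists u; first by rewrite in_nb setUC -ev.
    by rewrite in_nb setUC -ev inE eZ.
  have := @sum_cherries_Z set0 (sub0set _) (fun v p _ => negbT (in_set0 p)).
  rewrite setU0 card_E2_split; have := sum_charge_lt dv dR.
  by move: #|R| #|Z|; clear; lia.
have {}dv : deg E v = 1.
  by apply/eqP; rewrite eqn_leq dv; apply/card_gt0P; exists u.
(* The red edge uv is now an isolated edge, so u and any third vertex x form a pair outside [Z]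
   without a common neighbor. *)
have /card_gt0P[x] : 0 < #|~: [set u; v]|.
  by rewrite -(ltn_add2l #|[set u; v]|) cardsC addn0 cards2 (leq_ltn_trans _ T3) // ltnS leq_b1.
rewrite !inE negb_or => /andP[xu xv].
have ux : x \notin nb E u by apply: contra xv => /(leaf_nb du vu) ->.
apply: (@missing_pair_lt [set u; x]).
- by rewrite inE subsetT cards2 [u == x]eq_sym xu.
- by apply: contra ux; rewrite in_nb !in_set => /andP[/andP[_ ->]].
move=> w; rewrite subUset !sub1set; apply/negP => /andP[uw xw].
have wv : w = v by apply: (leaf_nb du _ vu); rewrite nbC.
by rewrite wv in xw; rewrite (leaf_nb dv xw uv) eqxx in xu.
Qed.

End CherriesAndEdges.

(** * Extremal numbers and the graph F_n *)

Section Extremal.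
Variable n : nat.
Implicit Types E : {set {set 'I_n}}.

Lemma excol_leq k1 k2 (H1 : {set {set 'I_k1}}) (H2 : {set {set 'I_k2}}) m :
  (forall E E1, graph E -> c4free E -> E1 \subset E -> Ncol H1 H2 E1 (E :\: E1) <= m) ->
  excol n H1 H2 C4 <= m.
Proof.
move=> h; apply/bigmax_leqP => E /andP[g /(C4_freeP g) c].
by apply/bigmax_leqP => E1 s; apply: h.
Qed.

Lemma excol_geq k1 k2 (H1 : {set {set 'I_k1}}) (H2 : {set {set 'I_k2}}) E E1 :
  graph E -> c4free E -> E1 \subset E -> Ncol H1 H2 E1 (E :\: E1) <= excol n H1 H2 C4.
Proof.
move=> g /(C4_freeP g) c s.
apply: (bigmax_sup E); first exact/andP.
exact: (bigmax_sup E1).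
Qed.

Lemma ex_geq k (H : {set {set 'I_k}}) E : graph E -> c4free E -> Ncount H E <= ex n H C4.
Proof.
move=> g /(C4_freeP g) c.
by apply: (bigmax_sup E) => //; apply/andP.
Qed.

Lemma ex_leq k (H : {set {set 'I_k}}) m :
  (forall E, graph E -> c4free E -> Ncount H E <= m) -> ex n H C4 <= m.
Proof. by move=> h; apply/bigmax_leqP => E /andP[g /(C4_freeP g)]; apply: h. Qed.

Lemma Ncount_star0 k : 0 < k -> Ncount (Sstar k.+1) (set0 : {set {set 'I_n}}) = 0.
Proof.
move=> k0; apply/eqP; rewrite cards_eq0; apply/eqP/setP => F; rewrite [RHS]inE.
apply/negP => /copiesP[+ [f fi FE]]; rewrite subset0 FE -cards_eq0 card_imset ?card_Sstar.
  by rewrite gtn_eqF.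
exact: imset_inj.
Qed.

End Extremal.

Lemma eq_set2 (T : finType) (a b c d : T) :
  ([set a; b] == [set c; d]) = ((a == c) && (b == d)) || ((a == d) && (b == c)).
Proof.
apply/eqP/orP => [eq|[] /andP[/eqP-> /eqP->] //]; last by rewrite setUC.
have := set2_injr (v := c); have : a \in [set c; d] by rewrite -eq !inE eqxx.
rewrite !inE => /orP[] /eqP ea _; rewrite {}ea in eq *.
  by left; rewrite eqxx (set2_injr eq) eqxx.
by right; rewrite eqxx (set2_injr (etrans eq (setUC _ _))) eqxx.
Qed.

Section Fan.
Variable n : nat.

Lemma in_Fn_blue (u v : 'I_n) :
  ([set u; v] \in Fn_blue n) = ((val u == 0) && (val v != 0)) || ((val v == 0) && (val u != 0)).
Proof.
rewrite inE; apply/existsP/orP => [[i /existsP[j /andP[+ ]]]|].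
  by rewrite eq_set2 => ij /orP[] /andP[/eqP-> /eqP->]; [left|right].
by case=> h; [exists u; apply/existsP; exists v|exists v; apply/existsP; exists u];
  rewrite h /= // setUC.
Qed.

Lemma in_Fn_red (u v : 'I_n) :
  ([set u; v] \in Fn_red n) = (odd u && (val v == u.+1)) || (odd v && (val u == v.+1)).
Proof.
rewrite inE; apply/existsP/orP => [[i /existsP[j /andP[+ ]]]|].
  by rewrite eq_set2 => ij /orP[] /andP[/eqP-> /eqP->]; [left|right].
by case=> h; [exists u; apply/existsP; exists v|exists v; apply/existsP; exists u];
  rewrite h /= // setUC.
Qed.

Lemma Fn_edgeP e : e \in Fn n -> exists u v : 'I_n, e = [set u; v].
Proof.
by rewrite !inE => /orP[] /existsP[i /existsP[j /andP[_ /eqP ->]]]; exists i, j.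
Qed.

Lemma Fn_graph : graph (Fn n).
Proof.
apply/forall_inP => e eF; have [u [v ev]] := Fn_edgeP eF; move: eF.
rewrite ev inE in_Fn_blue in_Fn_red cards2; case: (eqVneq u v) => //= <-.
by move: (val u) => x; lia.
Qed.

Lemma Fn_c4free : c4free (Fn n).
Proof.
move=> v w u u'; rewrite !in_nb !in_setU !in_Fn_blue !in_Fn_red => h1 h2 h3 h4.
have [e|e] : val v = val w \/ val u = val u'.
  move: h1 h2 h3 h4; rewrite /=.
  by move: (nat_of_ord v) (nat_of_ord w) (nat_of_ord u) (nat_of_ord u') => a b c d; clear; lia.
- by left; apply: val_inj.
- by right; apply: val_inj.
Qed.

Lemma Fn_colors : Fn n :\: Fn_blue n = Fn_red n.
Proof.
apply/setP => e; rewrite /Fn in_setD in_setU.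
case eB: (e \in Fn_blue n) => //=; apply/esym/negP => eR.
have [u [v ev]] : exists u v : 'I_n, e = [set u; v] by apply: Fn_edgeP; rewrite inE eB.
move: eB eR; rewrite ev in_Fn_blue in_Fn_red /=.
by move: (nat_of_ord u) (nat_of_ord v) => a b; lia.
Qed.

Lemma card_Fn_red : n.-1./2 <= #|Fn_red n|.
Proof.
case: (posnP n.-1./2) => [->//|h0].
have n0 : 0 < n by lia.
pose f (i : nat) : 'I_n := insubd (Ordinal n0) i.
have fE i : i < n -> val (f i) = i by move=> lt; rewrite insubdK.
rewrite -[n.-1./2]card_ord -(card_imset (f := fun i : 'I_(n.-1./2) => [set f i.*2.+1; f i.*2.+2])).
  apply/subset_leq_card/subsetP => _ /imsetP[i _ ->]; have ih := ltn_ord i.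
  by rewrite in_Fn_red !fE; lia.
move=> i j /eqP; have ih := ltn_ord i; have jh := ltn_ord j.
rewrite eq_set2 -!val_eqE !fE; try by move: (nat_of_ord i) (nat_of_ord j) ih jh; clear; lia.
by move=> h'; apply: val_inj; move: h' => /=; move: (nat_of_ord i) (nat_of_ord j); clear; lia.
Qed.

Lemma Fn_red_disjoint : trivIset (Fn_red n).
Proof.
apply/trivIsetP => a b aR bR ab; rewrite -setI_eq0; apply/eqP/setP => x; rewrite [RHS]inE.
apply/negP; rewrite inE => /andP[xa xb]; case/negP: ab.
have g : graph (Fn_red n) by apply: graph_sub Fn_graph; apply: subsetUr.
have [u uE ->] := edge_at g aR xa; have [v vE ->] := edge_at g bR xb.
suff -> : u = v by [].
apply: val_inj; move: uE vE; rewrite !in_nb !in_Fn_red /=.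
by move: (nat_of_ord u) (nat_of_ord v) (nat_of_ord x) => i j k; lia.
Qed.

Lemma card_Fn_blue : #|Fn_blue n| = n.-1.
Proof.
case: (n) => [|m]; last exact: card_Sstar.
by apply/eqP; rewrite cards_eq0; apply/eqP/setP => e; rewrite !inE; apply/existsP => -[[]].
Qed.

Lemma deg_Fn_blue (v : 'I_n) : val v = 0 -> deg (Fn_blue n) v = n.-1.
Proof.
move=> v0; have := cardsC1 v; rewrite card_ord => <-; apply: eq_card => u.
rewrite in_nb in_Fn_blue !inE -val_eqE /= (v0 : nat_of_ord v = 0).
by case: (nat_of_ord u).
Qed.

Lemma Ncount_Fn_blue k : 2 <= k -> 'C(n.-1, k) <= Ncount (Sstar k.+1) (Fn_blue n).
Proof.
move=> k2; case: (posnP n) => [n0|n0]; first by rewrite bin_small //; lia.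
have g : graph (Fn_blue n) by apply: graph_sub Fn_graph; apply: subsetUl.
apply: leq_trans (Ncount_star_geq g k2).
by rewrite (bigD1 (Ordinal n0)) //= deg_Fn_blue // leq_addr.
Qed.

Lemma Ncount_Fn_red k : 0 < k -> 'C(n.-1./2, k) <= Ncount (Mmatch k) (Fn_red n).
Proof.
move=> k0; rewrite Ncount_match //; last by apply: graph_sub Fn_graph; apply: subsetUr.
apply: leq_trans (leq_bin2l _ card_Fn_red) _.
rewrite -cards_draws; apply/subset_leq_card/subsetP => F; rewrite !inE => /andP[sF ->].
by rewrite sF; apply: trivIsetS sF Fn_red_disjoint.
Qed.

Lemma Ncount_Fn : 'C(n.-1, 2) + 2 * n.-1./2 <= Ncount (Sstar 3) (Fn n).
Proof.
case: (posnP n) => [n0|n0]; first by rewrite n0.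
apply: leq_trans (Ncount_star_geq Fn_graph _); last by [].
pose o := Ordinal n0.
have d0 : deg (Fn n) o = n.-1.
  rewrite (deg_setD o (subsetUl _ _ : Fn_blue n \subset Fn n)) deg_Fn_blue // Fn_colors.
  rewrite (_ : deg _ _ = 0) ?addn0 //; apply/eqP; rewrite cards_eq0; apply/eqP/setP => u.
  by rewrite in_nb in_Fn_red inE /=; case: (nat_of_ord u) => [|?]; rewrite ?andbF.
have cF : n.-1 + n.-1./2 <= #|Fn n|.
  have := cardsID (Fn_blue n) (Fn n); rewrite (setIidPr (subsetUl _ _)) card_Fn_blue Fn_colors => <-.
  by rewrite leq_add2l card_Fn_red.
have := handshake Fn_graph; rewrite (bigD1 o) //= d0 => hs.
rewrite (bigD1 o) //= d0 leq_add2l.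
(* The inequality d <= C(d, 2) + 1 holds for all d and turns the handshake identity into a count of
   cherries outside the center. *)
have : \sum_(i < n | i != o) deg (Fn n) i <= \sum_(i < n | i != o) ('C(deg (Fn n) i, 2) + 1).
  by apply: leq_sum => i _; have := double_bin2 (deg (Fn n) i); move: 'C(deg (Fn n) i, 2) (deg (Fn n) i); clear; case=> [|c] [|[|d]]; nia.
rewrite big_split /= sum1_card.
have -> : #|(fun i : 'I_n => i != o)| = n.-1.
  by have := cardsC1 o; rewrite card_ord => <-; apply: eq_card => i; rewrite !inE.
by move: (\sum_(i < n | i != o) _) (\sum_(i < n | i != o) _) #|Fn n| cF hs; clear; lia.
Qed.

End Fan.

Theorem excol_S3_M1 n : 3 <= n -> excol n (Sstar 3) (Mmatch 1) C4 = Ncount (Sstar 3) (Fn n).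
Proof.
move=> n3; apply/eqP; rewrite eqn_leq; apply/andP; split; last first.
  apply: leq_trans (excol_geq _ _ (Fn_graph n) (@Fn_c4free n) (subxx _)).
  by rewrite /Ncol leq_addr.
apply: excol_leq => E E1 g c s; apply: leq_trans (Ncount_Fn n).
have g1 := graph_sub s g; have g2 := graph_sub (subsetDl E E1) g.
have m1 : Ncount (Mmatch 1) (E :\: E1) <= #|E :\: E1|.
  by rewrite Ncount_match //; have := matchings_leq 1 (E :\: E1); rewrite mul1n expn1.
apply: leq_trans (leq_add (Ncount_star_leq 2 g1) m1) _.
have eC : 'C(n, 2) = 'C(n.-1, 2) + n.-1 by case: (n) n3 => // m _; rewrite binS bin1.
(* The quantity [2 * n.-1./2] is n - 1 for odd n, where the bound C(n, 2) is attained, and n - 2 for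
   even n, where the strict bound is required. *)
case: (boolP (odd n)) => on.
  have := cherries_edges_leq g c s; rewrite card_ord eC => /leq_trans; apply.
  by rewrite leq_add2l; lia.
have := cherries_edges_lt g c s; rewrite card_ord => /(_ n3 on); rewrite eC.
by move: 'C(n.-1, 2) (\sum_v _ + _) => a b; lia.
Qed.

(** * Prime powers in short intervals *)

Section PrimePowers.

(* [lcm_upto n] is lcm(1, ..., n), the exponential of Chebyshev's function psi. *)
Definition lcm_upto n := \prod_(p < n.+1 | prime p) p ^ trunc_log p n.

Lemma lcm_upto_gt0 n : 0 < lcm_upto n.
Proof. by apply: prodn_cond_gt0 => p pp; rewrite expn_gt0 prime_gt0. Qed.

Lemma logn_lcm_upto p n : prime p -> logn p (lcm_upto n) = trunc_log p n.
Proof.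
move=> pp; have cop (P : pred 'I_n.+1) : (forall q, P q -> prime q && (val q != p)) ->
    logn p (\prod_(q < n.+1 | P q) q ^ trunc_log q n) = 0.
  move=> PP; apply: logn_coprime; elim/big_rec: _ => [|q x /PP/andP[pq qp] cx].
    exact: coprimen1.
  by rewrite coprimeMr cx andbT coprimeXr // prime_coprime // dvdn_prime2 // eq_sym.
case: (ltnP p n.+1) => pn; last first.
  rewrite /lcm_upto cop; last first.
    move=> q pq; rewrite pq /=; apply: contraTneq pn => <-.
    by rewrite -ltnNge ltn_ord.
  apply/esym/eqP; rewrite -leqn0 leqNgt; apply/negP => h.
  have n0 : 0 < n by case: (n) h => //; rewrite trunc_log0.
  have := trunc_logP (prime_gt1 pp) n0; rewrite leqNgt => /negP; apply.
  by apply: leq_trans pn _; rewrite -{1}[p]expn1 leq_exp2l // prime_gt1.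
rewrite /lcm_upto (bigD1 (Ordinal pn)) //=; set r := \prod_(_ | _) _.
have r0 : 0 < r by apply: prodn_cond_gt0 => q /andP[pq _]; rewrite expn_gt0 prime_gt0.
by rewrite lognM // ?expn_gt0 ?prime_gt0 // pfactorK // cop ?addn0.
Qed.

Lemma dvdn_from_logn m n : 0 < m -> 0 < n ->
  (forall p, prime p -> logn p m <= logn p n) -> m %| n.
Proof.
move=> m0 n0 h; apply/dvdn_partP => // p; rewrite mem_primes => /and3P[pp _ _].
by rewrite p_part pfactor_dvdn // h.
Qed.

Lemma logn_fact_widen p m n : prime p -> m <= n ->
  logn p m`! = \sum_(1 <= k < n.+1) m %/ p ^ k.
Proof.
move=> pp mn; rewrite logn_fact // [RHS](big_cat_nat (n := m.+1)) //= [X in _ + X]big_nat_cond [X in _ + X]big1 ?addn0 //.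
move=> k /andP[/andP[mk _] _]; apply: divn_small.
by apply: leq_trans mk _; apply: ltnW; apply: ltn_expl; apply: prime_gt1.
Qed.

Lemma trunc_log_sum p m n : prime p -> m <= n ->
  trunc_log p m = \sum_(1 <= k < n.+1) (p ^ k <= m).
Proof.
move=> pp mn; have p1 := prime_gt1 pp.
have tm : trunc_log p m <= n.
  case: (posnP m) => [->|m0]; first by rewrite trunc_log0.
  by apply: leq_trans mn; apply: leq_trans (trunc_logP p1 m0); apply: ltnW; apply: ltn_expl.
rewrite (big_cat_nat (n := (trunc_log p m).+1)) //= ?ltnS //.
rewrite [X in _ + X]big_nat_cond [X in _ + X]big1 ?addn0; last first.
  move=> k /andP[/andP[tk _] _]; apply/eqP; rewrite eqb0 -ltnNge.
  by apply: leq_trans (trunc_log_ltn m p1) _; rewrite leq_exp2l.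
case: (posnP m) => [->|m0]; first by rewrite trunc_log0 big_geq.
rewrite big_nat_cond (eq_bigr (fun=> 1)); last first.
  move=> k /andP[/andP[_ kt] _]; rewrite (leq_trans _ (trunc_logP p1 m0)) //.
  by rewrite leq_exp2l.
by rewrite -big_nat_cond sum_nat_const_nat subn1 muln1.
Qed.

(** Chebyshev's quotient with n in place of 30 n, each argument rounded down so that every n is
    allowed. *)
Definition cheb_num n := n`! * (n %/ 30)`!.
Definition cheb_den n := (n %/ 2)`! * (n %/ 3)`! * (n %/ 5)`!.

Let cheb_den_gt0 n : 0 < cheb_den n. Proof. by rewrite !muln_gt0 !fact_gt0. Qed.
Let cheb_num_gt0 n : 0 < cheb_num n. Proof. by rewrite !muln_gt0 !fact_gt0. Qed.

Lemma logn_cheb_num p n : prime p ->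
  logn p (cheb_num n) = \sum_(1 <= k < n.+1) (n %/ p ^ k + n %/ p ^ k %/ 30).
Proof.
move=> pp; rewrite lognM ?fact_gt0 // !(logn_fact_widen (n := n)) ?leq_div //.
by rewrite -big_split; apply: eq_bigr => k _; rewrite divnAC.
Qed.

Lemma logn_cheb_den p n : prime p -> logn p (cheb_den n) =
  \sum_(1 <= k < n.+1) (n %/ p ^ k %/ 2 + n %/ p ^ k %/ 3 + n %/ p ^ k %/ 5).
Proof.
move=> pp; rewrite !lognM ?muln_gt0 ?fact_gt0 // !(logn_fact_widen (n := n)) ?leq_div //.
by rewrite -!big_split; apply: eq_bigr => k _; rewrite /= ![n %/ _ %/ p ^ k]divnAC.
Qed.

(** For each prime power, with u the integer part of n / p^k, the contribution to the quotient is u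
    + [u/30] - [u/2] - [u/3] - [u/5]. It is periodic in u with period 30, takes only the values 0
    and 1, and vanishes at u = 0. *)
Lemma cheb_num_dvd n : cheb_num n %| lcm_upto n * cheb_den n.
Proof.
apply: dvdn_from_logn => // [|p pp]; first by rewrite muln_gt0 lcm_upto_gt0 cheb_den_gt0.
rewrite (lognM p (lcm_upto_gt0 n) (cheb_den_gt0 n)) logn_lcm_upto // logn_cheb_num // logn_cheb_den //.
rewrite (@trunc_log_sum p n n) // -big_split; apply: leq_sum => k _ /=.
have -> : (p ^ k <= n) = (0 < n %/ p ^ k) by rewrite divn_gt0 // expn_gt0 prime_gt0.
by move: (n %/ p ^ k) => u; lia.
Qed.

(** The same periodic function equals 1 for u = 1, ..., 5, so it fails to detect u >= 1 only when u
    >= 6, that is when p^k <= n / 6. *)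
Lemma cheb_den_dvd n : lcm_upto n * cheb_den n %| cheb_num n * lcm_upto (n %/ 6).
Proof.
apply: dvdn_from_logn => [||p pp]; rewrite ?muln_gt0 ?lcm_upto_gt0 ?fact_gt0 //.
rewrite (lognM p (lcm_upto_gt0 n) (cheb_den_gt0 n)) (lognM p (cheb_num_gt0 n) (lcm_upto_gt0 _)).
rewrite !logn_lcm_upto // logn_cheb_num // logn_cheb_den //.
rewrite (@trunc_log_sum p n n) // (@trunc_log_sum p (n %/ 6) n) ?leq_div //.
rewrite -!big_split; apply: leq_sum => k _ /=.
have pk : 0 < p ^ k by rewrite expn_gt0 prime_gt0.
have -> : (p ^ k <= n) = (0 < n %/ p ^ k) by rewrite divn_gt0.
have -> : (p ^ k <= n %/ 6) = (6 <= n %/ p ^ k) by rewrite !leq_divRL // mulnC.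
by move: (n %/ p ^ k) => u; lia.
Qed.

Lemma lcm_upto_no_prime_power m n : m <= n ->
  (forall p k, prime p -> 0 < k -> m < p ^ k -> p ^ k <= n -> False) ->
  lcm_upto n <= lcm_upto m.
Proof.
move=> mn npp; apply: (dvdn_leq (lcm_upto_gt0 m)).
apply: dvdn_from_logn; rewrite ?lcm_upto_gt0 // => p pp.
rewrite !logn_lcm_upto // !(@trunc_log_sum p _ n) //.
rewrite big_nat_cond [X in _ <= X]big_nat_cond; apply: leq_sum => k /andP[/andP[k0 _] _].
case: (leqP (p ^ k) n) => // pn; case: (leqP (p ^ k) m) => // pm; case: (npp p k pp k0 pm pn).
Qed.

End PrimePowers.

(** * Chebyshev's bounds for lcm(1, ..., n) *)

Section ChebyshevBounds.
Local Open Scope R_scope.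

Lemma ln_le_pred x : 0 < x -> ln x <= x - 1.
Proof.
move=> x0; have := exp_ineq1_le (ln x); rewrite exp_ln //; lra.
Qed.

Lemma ln_ge_1_minus_inv x : 0 < x -> 1 - / x <= ln x.
Proof.
move=> x0; have := ln_le_pred (Rinv_0_lt_compat x x0); rewrite ln_Rinv //; lra.
Qed.

Lemma ln_le x y : 0 < x -> x <= y -> ln x <= ln y.
Proof. by move=> x0 [h|->]; [apply/Rlt_le/ln_increasing|apply: Rle_refl]. Qed.

Lemma ln_div x y : 0 < x -> 0 < y -> ln (x / y) = ln x - ln y.
Proof.
by move=> x0 y0; have iy := Rinv_0_lt_compat y y0; rewrite /Rdiv ln_mult // ln_Rinv.
Qed.

Lemma Rle_div_l a b c : 0 < c -> a / c <= b <-> a <= b * c.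
Proof.
move=> c0; have e : a = a / c * c by field; lra.
by split=> h; [rewrite e; apply: Rmult_le_compat_r; lra|apply: (Rmult_le_reg_r c); lra].
Qed.

Lemma Rle_div_r a b c : 0 < c -> a <= b / c <-> a * c <= b.
Proof.
move=> c0; have e : b = b / c * c by field; lra.
by split=> h; [rewrite e; apply: Rmult_le_compat_r; lra|apply: (Rmult_le_reg_r c); lra].
Qed.

Lemma Rlt_div_l a b c : 0 < c -> a / c < b <-> a < b * c.
Proof.
move=> c0; have e : a = a / c * c by field; lra.
by split=> h; [rewrite e; apply: Rmult_lt_compat_r|apply: (Rmult_lt_reg_r c); lra].
Qed.

Definition stirling x := x * ln x - x.

Lemma ln_sub_le x y : 0 < x -> 0 < y -> y - x <= y * (ln y - ln x).
Proof.
move=> x0 y0; have xy : 0 < y / x by apply: Rdiv_lt_0_compat.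
have := ln_ge_1_minus_inv xy; rewrite ln_div //.
move=> h; have e : y - x = y * (1 - / (y / x)) by field; lra.
rewrite e; apply: Rmult_le_compat_l => //; lra.
Qed.

Lemma stirling_mono x y : 1 <= x -> x <= y -> stirling x <= stirling y.
Proof.
move=> x1 xy; rewrite /stirling; have := @ln_sub_le x y ltac:(lra) ltac:(lra).
have lx : 0 <= ln x by rewrite -ln_1; apply: ln_le; lra.
nra.
Qed.

Lemma ln_fact_bounds n : (0 < n)%N ->
  stirling (INR n) <= ln (INR n`!) <= stirling (INR n) + ln (INR n) + 1.
Proof.
elim: n => // -[_ _|n IH _].
  by rewrite /stirling /= ln_1; lra.
have {}IH := IH isT; rewrite factS mult_INR; set m := n.+1 in IH *.
have m1 : 1 <= INR m by rewrite S_INR; have := pos_INR n; lra.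
have f0 : 0 < INR m`! by apply/lt_0_INR/ltP/fact_gt0.
have m2 : 0 < INR m.+1 by rewrite S_INR; lra.
rewrite ln_mult //; move: IH; rewrite /stirling S_INR.
have := @ln_sub_le (INR m) (INR m + 1) ltac:(lra) ltac:(lra).
have := @ln_sub_le (INR m + 1) (INR m) ltac:(lra) ltac:(lra).
move: (ln (INR m)) (ln (INR m + 1)) (ln (INR m`!)) (INR m) m1 => a b c d; nra.
Qed.

Lemma INR_divn n d : (0 < d)%N ->
  INR (n %/ d) <= INR n / INR d /\ INR n / INR d < INR (n %/ d) + 1.
Proof.
move=> d0; have d0' : 0 < INR d by apply/lt_0_INR/ltP.
have e : INR n = INR (n %/ d) * INR d + INR (n %% d) by rewrite {1}(divn_eq n d) plus_INR mult_INR.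
have lo := pos_INR (n %% d); have hi : INR (n %% d) < INR d by apply/lt_INR/ltP/ltn_pmod.
split; first by apply/Rle_div_r => //; lra.
by apply/Rlt_div_l => //; lra.
Qed.

Lemma ln_fact_div_bounds n d : (0 < d)%N -> (d <= n)%N ->
  stirling (INR n / INR d) - (ln (INR n + 1) + 1) <= ln (INR (n %/ d)`!)
   <= stirling (INR n / INR d) + (ln (INR n + 1) + 1).
Proof.
move=> d0 dn; have [lo hi] := INR_divn n d0.
have d1 : 1 <= INR d by rewrite -[1]/(INR 1); apply/le_INR/leP.
have n1 : INR d <= INR n by apply/le_INR/leP.
have m0 : (0 < n %/ d)%N by rewrite divn_gt0.
have m1 : 1 <= INR (n %/ d) by rewrite -[1]/(INR 1); apply/le_INR/leP.
have xn : INR n / INR d <= INR n.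
  by apply/Rle_div_l; [lra|nra].
have [_ up] := ln_fact_bounds m0.
have := ln_fact_bounds (ltn0Sn (n %/ d)); rewrite factS mult_INR ln_mult; last first.
- by apply/lt_0_INR/ltP/fact_gt0.
- by apply/lt_0_INR/ltP.
rewrite S_INR => -[lo' _].
have h1 := stirling_mono m1 lo.
have h2 := @stirling_mono (INR n / INR d) (INR (n %/ d) + 1) ltac:(lra) ltac:(lra).
have h3 : ln (INR (n %/ d)) <= ln (INR n + 1) by apply: ln_le; lra.
have h4 : ln (INR (n %/ d) + 1) <= ln (INR n + 1) by apply: ln_le; lra.
lra.
Qed.

(** Chebyshev's constant 0.92129... Both bounds for ln lcm(1, ..., n) are proportional to it, so in
    their ratio its value cancels and its sign suffices. *)
Definition cheb_const := ln 2 / 2 + ln 3 / 3 + ln 5 / 5 - ln 30 / 30.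

Lemma cheb_const_gt0 : 0 < cheb_const.
Proof.
rewrite /cheb_const (_ : 30 = 2 * (3 * 5)); last by lra.
rewrite !ln_mult; try lra.
have l2 : 0 < ln 2 by rewrite -ln_1; apply: ln_increasing; lra.
have l3 : 0 < ln 3 by rewrite -ln_1; apply: ln_increasing; lra.
have l5 : 0 < ln 5 by rewrite -ln_1; apply: ln_increasing; lra.
lra.
Qed.

Lemma stirling_div x d : 0 < x -> 0 < d -> stirling (x / d) = (x * ln x - x - x * ln d) / d.
Proof. by move=> x0 d0; rewrite /stirling ln_div //; field; lra. Qed.

(* The coefficients of [n ln n] cancel since 1 + 1/30 = 1/2 + 1/3 + 1/5. *)
Lemma cheb_quotient_bounds n : (30 <= n)%N ->
  cheb_const * INR n - 5 * (ln (INR n + 1) + 1) <= ln (INR (cheb_num n)) - ln (INR (cheb_den n))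
   <= cheb_const * INR n + 5 * (ln (INR n + 1) + 1).
Proof.
move=> n30; have fp m : 0 < INR m`! by apply/lt_0_INR/ltP/fact_gt0.
have n0 : 0 < INR n by apply/lt_0_INR/ltP; apply: leq_trans n30.
rewrite /cheb_num /cheb_den !mult_INR !ln_mult //; last by apply: Rmult_lt_0_compat.
have := @ln_fact_div_bounds n 1 isT (leq_trans _ n30).
have := @ln_fact_div_bounds n 30 isT n30.
have := @ln_fact_div_bounds n 2 isT (leq_trans _ n30).
have := @ln_fact_div_bounds n 3 isT (leq_trans _ n30).
have := @ln_fact_div_bounds n 5 isT (leq_trans _ n30).
rewrite divn1 !INR_IZR_INZ /= -!INR_IZR_INZ.
rewrite !stirling_div //; try lra.
rewrite ln_1 /cheb_const => /(_ isT) h5 /(_ isT) h3 /(_ isT) h2 h30 /(_ isT) h1.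
lra.
Qed.

Lemma ln_sublinear eta : 0 < eta -> exists C, forall n : nat, 5 * (ln (INR n + 1) + 1) <= eta * INR n + C.
Proof.
move=> e0; pose K := eta / 5; have K0 : 0 < K by rewrite /K; lra.
exists (5 * (K - ln K)) => n; have n0 := pos_INR n.
have := @ln_le_pred (K * (INR n + 1)) ltac:(nra); rewrite ln_mult; try lra.
rewrite /K => h; nra.
Qed.

Lemma ln_lcm_upto_geq eta : 0 < eta -> exists C, forall n : nat, (30 <= n)%N ->
  (cheb_const - eta) * INR n - C <= ln (INR (lcm_upto n)).
Proof.
move=> /ln_sublinear[C HC]; exists C => n n30.
have [lo _] := cheb_quotient_bounds n30; have := HC n.
have d0 : (0 < cheb_den n)%N by rewrite !muln_gt0 !fact_gt0.
have /leP/le_INR : (cheb_num n <= lcm_upto n * cheb_den n)%N.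
  by apply: dvdn_leq (cheb_num_dvd n); rewrite muln_gt0 lcm_upto_gt0.
have c0 : 0 < INR (cheb_num n) by apply/lt_0_INR/ltP; rewrite muln_gt0 !fact_gt0.
have l0 : 0 < INR (lcm_upto n) by apply/lt_0_INR/ltP/lcm_upto_gt0.
have d0' : 0 < INR (cheb_den n) by apply/lt_0_INR/ltP.
by move=> /(ln_le c0); rewrite (mult_INR (lcm_upto n)) (ln_mult _ _ l0 d0'); lra.
Qed.

Lemma ln_lcm_upto_step eta : 0 < eta -> exists C, forall n : nat, (30 <= n)%N ->
  ln (INR (lcm_upto n)) <= (cheb_const + eta) * INR n + C + ln (INR (lcm_upto (n %/ 6))).
Proof.
move=> /ln_sublinear[C HC]; exists C => n n30.
have [_ up] := cheb_quotient_bounds n30; have := HC n.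
have d0 : 0 < INR (cheb_den n) by apply/lt_0_INR/ltP; rewrite !muln_gt0 !fact_gt0.
have c0 : 0 < INR (cheb_num n) by apply/lt_0_INR/ltP; rewrite muln_gt0 !fact_gt0.
have l0 m : 0 < INR (lcm_upto m) by apply/lt_0_INR/ltP/lcm_upto_gt0.
have /leP/le_INR : (lcm_upto n * cheb_den n <= cheb_num n * lcm_upto (n %/ 6))%N.
  by apply: dvdn_leq (cheb_den_dvd n); rewrite !muln_gt0 lcm_upto_gt0 !fact_gt0.
rewrite (mult_INR (lcm_upto n)) (mult_INR (cheb_num n)).
move=> /(ln_le (Rmult_lt_0_compat _ _ (l0 n) d0)).
rewrite (ln_mult _ _ (l0 n) d0) (ln_mult _ _ c0 (l0 _)); lra.
Qed.

Lemma nat_upper_bound x : exists n : nat, x <= INR n.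
Proof.
case: (Rle_lt_dec x 0) => [h|h]; first by exists 0%N; rewrite /=; lra.
have [n [hn n0]] := archimed_cor1 (/ x) (Rinv_0_lt_compat _ h).
exists n; have n0' : 0 < INR n by apply: lt_0_INR.
apply: Rlt_le; rewrite -(Rinv_inv x) -(Rinv_inv (INR n)).
by apply: Rinv_lt_contravar => //; apply: Rmult_lt_0_compat; apply: Rinv_0_lt_compat.
Qed.

Lemma finite_upper_bound (f : nat -> R) m : exists C, forall n : nat, (n < m)%N -> f n <= C.
Proof.
elim: m => [|m [C HC]]; first by exists 0.
exists (Rmax C (f m)) => n; rewrite ltnS leq_eqVlt => /orP[/eqP ->|/HC h].
  exact: Rmax_r.
exact: Rle_trans h (Rmax_l _ _).
Qed.

(** Iterating the step from n / 6 to n sums the geometric series 1 + 1/6 + 1/36 + ... = 6/5. The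
    additive constant of each step is absorbed by half of [eta] once n is large. *)
Lemma ln_lcm_upto_leq eta : 0 < eta -> exists C, forall n : nat,
  ln (INR (lcm_upto n)) <= 6 / 5 * (cheb_const + eta) * INR n + C.
Proof.
move=> e0; have [C HC] := @ln_lcm_upto_step (eta / 2) ltac:(lra).
have [n1 Hn1] := nat_upper_bound (C / (eta / 2)).
have Cn n : (n1 <= n)%N -> C <= eta / 2 * INR n.
  move=> /leP/le_INR h; have : C / (eta / 2) <= INR n by lra.
  by move/Rle_div_l => /(_ ltac:(lra)); lra.
have [C' HC'] := finite_upper_bound (fun n => ln (INR (lcm_upto n))) (maxn 30 n1).
exists C'; have A0 := cheb_const_gt0.
elim/ltn_ind => n IH; have n0 := pos_INR n.
case: (ltnP n (maxn 30 n1)) => [/HC' h|]; first by nra.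
rewrite geq_max => /andP[n30 nn1].
have lt6 : (n %/ 6 < n)%N by apply: ltn_Pdiv => //; apply: leq_trans n30.
have := IH _ lt6; have := HC _ n30; have := Cn _ nn1.
have [+ _] := @INR_divn n 6 isT; rewrite [INR 6]INR_IZR_INZ /=; nra.
Qed.

(** The ratio 243/200 = 1.215 exceeds 6/5. Without a prime power in ]N, M] the numbers lcm(1, ...,
    M) and lcm(1, ..., N) would agree, contradicting the bounds with relative error 1/1000, as 0.999
    * 1.215 > 1.2 * 1.001. *)
Theorem prime_power_between : exists N0 : nat, forall N : nat, (N0 <= N)%N ->
  exists p k : nat, [/\ prime p, (0 < k)%N, (N < p ^ k)%N & (200 * p ^ k <= 243 * N)%N].
Proof.
have A0 := cheb_const_gt0.
have [C HC] := @ln_lcm_upto_geq (cheb_const / 1000) ltac:(lra).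
have [C' HC'] := @ln_lcm_upto_leq (cheb_const / 1000) ltac:(lra).
have [N1 HN1] := nat_upper_bound ((C + C' + 2 * cheb_const) / (cheb_const / 100)).
exists (maxn 100 N1) => N; rewrite geq_max => /andP[N100 N1N].
pose M := (243 * N %/ 200)%N; have NM : (N <= M)%N by rewrite /M leq_divRL //; lia.
have M30 : (30 <= M)%N by apply: leq_trans NM; apply: leq_trans N100.
case: (boolP [exists p : 'I_M.+1, exists k : 'I_M.+1, [&& prime p, 0 < k & N < p ^ k <= M]%N]).
  case/existsP=> p /existsP[k /and4P[pp k0 Nk kM]]; exists p, k; split=> //.
  by rewrite mulnC -leq_divRL.
rewrite negb_exists => /forallP npp; exfalso.
have /leP/le_INR : (lcm_upto M <= lcm_upto N)%N.
  apply: lcm_upto_no_prime_power => // p k pp k0 Np pM.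
  have pM' : (p < M.+1)%N.
    by rewrite ltnS (leq_trans _ pM) // -{1}[p]expn1 leq_exp2l // prime_gt1.
  have kM' : (k < M.+1)%N.
    by rewrite ltnS (leq_trans _ pM) // ltnW // ltn_expl // prime_gt1.
  have := npp (Ordinal pM'); rewrite negb_exists => /forallP/(_ (Ordinal kM')).
  by rewrite /= pp k0 Np pM.
have l0 : 0 < INR (lcm_upto M) by apply/lt_0_INR/ltP/lcm_upto_gt0.
move=> /(ln_le l0); have := HC _ M30; have := HC' N.
have [_] := @INR_divn (243 * N) 200 isT; rewrite mult_INR -/M.
rewrite [INR 200]INR_IZR_INZ [INR 243]INR_IZR_INZ /=.
have : C + C' + 2 * cheb_const <= cheb_const / 100 * INR N.
  have /leP/le_INR h := N1N; have : (C + C' + 2 * cheb_const) / (cheb_const / 100) <= INR N by lra.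
  by move/Rle_div_l => /(_ ltac:(lra)); lra.
have N0 := pos_INR N; move: (INR N) (INR M) N0 => x y x0 h1 h2 h3 h4 h5.
have h6 : cheb_const * (243 * x / 200 - 1) <= cheb_const * y by apply: Rmult_le_compat_l; lra.
have : cheb_const * x >= 0 by nra.
nra.
Qed.

End ChebyshevBounds.

(** * Dense C4-free graphs *)

Section PolarityGraph.
Import GRing.Theory.
Local Open Scope ring_scope.
Variable F : finFieldType.
Local Notation V := (F * F)%type.

(** The affine part of the Erdos-Renyi polarity graph: (a, b) is joined to the other points of the
    line y = a x - b. Distinct vertices give distinct lines, which share at most one point. *)
Definition polarity_graph : {set {set V}} :=
  [set e | [exists u : V, exists v : V, [&& u != v, u.2 + v.2 == u.1 * v.1 & e == [set u; v]]]].

Lemma in_polarity (u v : V) :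
  ([set u; v] \in polarity_graph) = (u != v) && (u.2 + v.2 == u.1 * v.1).
Proof.
rewrite inE; apply/existsP/idP => [[a /existsP[b /and3P[ab e]]]|/andP[uv e]].
  rewrite eq_set2 => /orP[] /andP[/eqP-> /eqP->]; first by rewrite ab e.
  by rewrite eq_sym ab addrC mulrC e.
by exists u; apply/existsP; exists v; rewrite uv e eqxx.
Qed.

Lemma polarity_is_graph : graph polarity_graph.
Proof.
apply/forall_inP => e; rewrite inE => /existsP[u /existsP[v /and3P[uv _ /eqP ->]]].
by rewrite cards2 uv.
Qed.

Lemma polarity_c4free : c4free polarity_graph.
Proof.
move=> v w u u'; rewrite !in_nb !in_polarity.
move=> /andP[_ /eqP h1] /andP[_ /eqP h2] /andP[_ /eqP h3] /andP[_ /eqP h4].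
have d1 : (v.1 - w.1) * u.1 = v.2 - w.2.
  by rewrite mulrBl -h1 -h2 opprD addrACA subrr addr0.
have d2 : (v.1 - w.1) * u'.1 = v.2 - w.2.
  by rewrite mulrBl -h3 -h4 opprD addrACA subrr addr0.
case: (eqVneq v.1 w.1) => [e1|n1].
  left; move: d1; rewrite e1 subrr mul0r => /esym/eqP; rewrite subr_eq0 => /eqP e2.
  by case: (v) (w) e1 e2 => [? ?] [? ?] /= -> ->.
right; have e1 : u.1 = u'.1.
  by apply: (@mulfI _ (v.1 - w.1)); rewrite ?subr_eq0 // d1 d2.
have e2 : u.2 = u'.2 by apply: (@addrI _ v.2); rewrite h1 h3 e1.
by case: (u) (u') e1 e2 => [? ?] [? ?] /= -> ->.
Qed.

Lemma polarity_deg (u : V) : (#|F|.-1 <= deg polarity_graph u)%N.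
Proof.
pose f x : V := (x, u.1 * x - u.2).
have fi : injective f by move=> x y [].
have sN : [set f x | x in F] :\ u \subset nb polarity_graph u.
  apply/subsetP => v /setD1P[vu /imsetP[x _ ev]].
  by rewrite in_nb in_polarity eq_sym vu ev /= addrC subrK eqxx.
have := cardsD1 u [set f x | x in F]; rewrite card_imset // => ->.
apply: leq_trans (subset_leq_card sN); by case: (_ \in _) => /=; lia.
Qed.

Lemma polarity_edges : (#|F| ^ 2 * #|F|.-1 <= 2 * #|polarity_graph|)%N.
Proof.
rewrite -(handshake polarity_is_graph) -mulnn -[(#|F| * #|F|)%N]card_prod -sum_nat_const.
by apply: leq_sum => u _; apply: polarity_deg.
Qed.

End PolarityGraph.

(** * Dense induced subgraphs and their transport to other vertex sets *)

Section Subgraphs.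
Variables (T : finType) (E : {set {set T}}).
Hypothesis gE : graph E.

Definition induced (S : {set T}) := [set e in E | e \subset S].

(** Averaging over v: an edge inside [S] survives the deletion of |S| - 2 of the vertices. *)
Lemma induced_deletion (S : {set T}) : 0 < #|S| ->
  exists2 v, v \in S & #|induced S| * (#|S| - 2) <= #|S| * #|induced (S :\ v)|.
Proof.
move=> S0; have e1 : \sum_(v in S) #|induced (S :\ v)| = #|induced S| * (#|S| - 2).
  rewrite sum_card_exchange -sum_nat_const [RHS]big_mkcond /=; apply: eq_bigr => e _.
  rewrite [e \in _]inE; case eE: (e \in E) => /=; last first.
    by apply/eqP; rewrite cards_eq0; apply/eqP/setP => v; rewrite !inE eE /= andbF.
  case: (boolP (e \subset S)) => eS; last first.
    apply/eqP; rewrite cards_eq0; apply/eqP/setP => v; rewrite !inE eE /= subsetD1.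
    by rewrite (negbTE eS) andbF.
  have -> : #|S| - 2 = #|S :\: e| by rewrite cardsD (setIidPr eS) (graphP gE eE).
  apply: eq_card => v.
  by rewrite !inE eE /= subsetD1 eS andbC.
case: (boolP [exists v in S, #|induced S| * (#|S| - 2) <= #|S| * #|induced (S :\ v)|]).
  by case/exists_inP=> v; exists v.
move=> /exists_inPn h; exfalso.
have : #|S| * (\sum_(v in S) #|induced (S :\ v)|) + #|S| <= #|S| * (#|induced S| * (#|S| - 2)).
  rewrite big_distrr /= -[X in _ + X]muln1 -2!sum_nat_const -big_split /=.
  by apply: leq_sum => v /h; rewrite -ltnNge addn1.
by rewrite e1 -[X in _ <= X]addn0 leq_add2l leqNgt S0.
Qed.

(** Vertices are deleted one at a time without ever decreasing the edge density |E| / C(|T|, 2). *)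
Lemma dense_induced m : m <= #|T| -> exists2 S : {set T}, #|S| = m &
  #|E| * (m * m.-1) <= #|T| * #|T|.-1 * #|induced S|.
Proof.
move=> mT; rewrite -(subKn mT); elim: (#|T| - m) => [|d [S cS IH]].
  exists setT; first by rewrite cardsT subn0.
  rewrite subn0 mulnC leq_mul2l; apply/orP; right; apply/subset_leq_card/subsetP => e eE.
  by rewrite inE eE subsetT.
case: (posnP #|S|) => [S0|S0].
  have e0 : #|T| - d.+1 = 0 by lia.
  by exists set0; rewrite ?cards0 e0 // muln0.
have [v vS hv] := induced_deletion S0.
have cS' : #|S :\ v| = #|T| - d.+1 by have := cardsD1 v S; rewrite vS; lia.
exists (S :\ v) => //; rewrite -cS'.
move: IH; rewrite -cS; have := cardsD1 v S; rewrite vS add1n => cSv.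
move: hv S0; rewrite cSv /= => hv _ IH.
rewrite -(@leq_pmul2l (#|S :\ v|.+1)) //.
move: (#|S :\ v|) (#|induced S|) (#|induced (S :\ v)|) (#|E|) (#|T| * #|T|.-1) hv IH => s a b e N hv IH.
apply: (@leq_trans (N * a * s.-1)); first by apply: leq_trans (leq_mul IH (leqnn s.-1)); lia.
have -> : s.-1 = s.+1 - 2 by lia.
by apply: leq_trans (_ : N * (s.+1 * b) <= _); rewrite -?mulnA ?leq_mul2l ?hv ?orbT //; lia.
Qed.

End Subgraphs.

Section Transport.
Variables (T U : finType) (h : T -> U) (S : {set T}) (E : {set {set T}}).
Hypotheses (gE : graph E) (hi : {in S &, injective h}) (sE : forall e, e \in E -> e \subset S).

Definition transport := [set h @: e | e : {set T} in E].

Lemma card_transport_edge e : e \in E -> #|h @: e| = #|e|.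
Proof. by move=> eE; apply: card_in_imset => x y xe ye; apply: hi; apply: (subsetP (sE eE)). Qed.

Lemma transport_graph : graph transport.
Proof.
apply/forall_inP => _ /imsetP[e eE ->]; rewrite card_transport_edge //.
by rewrite (graphP gE eE).
Qed.

Lemma card_transport : #|transport| = #|E|.
Proof.
apply: card_in_imset => e e' eE e'E eq; apply/setP => x.
have main a b : a \in E -> b \in E -> h @: a = h @: b -> x \in a -> x \in b.
  move=> aE bE ab xa; have : h x \in h @: b by rewrite -ab imset_f.
  case/imsetP=> y yb /hi -> //; first exact: (subsetP (sE aE)).
  exact: (subsetP (sE bE)).
by apply/idP/idP; apply: main.
Qed.

Lemma transport_nb u v : u \in nb transport v ->
  exists x y, [/\ x \in S, y \in S, v = h x, u = h y & y \in nb E x].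
Proof.
rewrite in_nb => /imsetP[e eE]; have [x [y [xy ee yx]]] := edge2P gE eE.
have xS : x \in S by apply: (subsetP (sE eE)); rewrite ee !inE eqxx.
have yS : y \in S by apply: (subsetP (sE eE)); rewrite ee !inE eqxx orbT.
rewrite ee imsetU1 imset_set1 => /eqP; rewrite eq_set2 => /orP[] /andP[/eqP-> /eqP->].
  by exists x, y.
by exists y, x; split; rewrite // nbC.
Qed.

Lemma transport_c4free : c4free E -> c4free transport.
Proof.
move=> cE v w u u' /transport_nb[x1 [y1 [x1S y1S -> -> n1]]].
move=> /transport_nb[x2 [y2 [x2S y2S -> /hi e2 n2]]].
move=> /transport_nb[x3 [y3 [x3S y3S /hi e3 -> n3]]].
move=> /transport_nb[x4 [y4 [x4S y4S /hi e4 /hi e4' n4]]].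
rewrite -e2 // in n2; rewrite -e3 // in n3; rewrite -e4 // -e4' // in n4.
by case: (cE x1 x2 y1 y3) => // ->; [left|right].
Qed.

End Transport.

Lemma embed_c4free (T U : finType) (E : {set {set T}}) (S : {set T}) (A : {set U}) :
  graph E -> c4free E -> #|S| <= #|A| ->
  exists K : {set {set U}}, [/\ graph K, c4free K, forall e, e \in K -> e \subset A
    & #|K| = #|induced E S|].
Proof.
move=> gE cE; case: (set_0Vmem A) => [->|[a aA]] le.
  have S0 : S = set0 by apply/eqP; rewrite -cards_eq0 -leqn0 -(cards0 U).
  exists set0; split; rewrite ?cards0.
  - by apply/forall_inP => e; rewrite inE.
  - by move=> v w u u'; rewrite in_nb inE.
  - by move=> e; rewrite inE.
  apply/esym/eqP; rewrite cards_eq0; apply/eqP/setP => e; rewrite !inE S0 subset0.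
  by apply/negP => /andP[/(graphP gE) + /eqP e0]; rewrite e0 cards0.
pose h x := nth a (enum A) (index x (enum S)).
have ltS x : x \in S -> index x (enum S) < size (enum A).
  by move=> xS; rewrite -cardE; apply: leq_trans le; rewrite cardE index_mem mem_enum.
have hi : {in S &, injective h}.
  move=> x y xS yS /eqP; rewrite nth_uniq ?enum_uniq ?ltS // => /eqP eq.
  by rewrite -(nth_index x (_ : x \in enum S)) ?mem_enum // eq nth_index // mem_enum.
have gI : graph (induced E S) by apply: graph_sub gE; apply/subsetP => e; rewrite inE => /andP[].
have cI : c4free (induced E S) by apply: c4free_sub cE; apply/subsetP => e; rewrite inE => /andP[].
have sI e : e \in induced E S -> e \subset S by rewrite inE => /andP[].
exists (transport h (induced E S)); split.
- exact: transport_graph gI hi sI.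
- exact: transport_c4free gI hi sI cI.
- move=> _ /imsetP[e eI ->]; apply/subsetP => _ /imsetP[x xe ->].
  by rewrite -mem_enum mem_nth // ltS // (subsetP (sI e eI)).
- exact: card_transport hi sI.
Qed.

Section DenseGraphs.
Local Open Scope R_scope.

(** The case where the whole polarity graph fits; the constants meet because 9 * (1000/912)^3 =
    11.87 < 0.998 * 49/4 = 12.22. *)
Lemma small_field_arith (q m e : R) : 1000 <= q -> 0 <= m -> 912 * m <= 1000 * q ^ 2 ->
  q ^ 2 * (q - 1) <= 2 * e -> 9 * m ^ 3 <= 49 * e ^ 2.
Proof.
move=> q0 m0 mq he.
have x0 : 0 <= q ^ 2 by nra.
have h1 : (q ^ 2 * (q - 1)) ^ 2 <= (2 * e) ^ 2 by apply: pow_incr; nra.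
have h2 : 0.998 * q ^ 2 <= (q - 1) ^ 2 by nra.
have h3 : m ^ 3 <= (1000 / 912 * q ^ 2) ^ 3 by apply: pow_incr; lra.
have h4 : (q ^ 2) ^ 2 * (0.998 * q ^ 2) <= (q ^ 2) ^ 2 * (q - 1) ^ 2.
  by apply: Rmult_le_compat_l => //; nra.
have h5 : 0 <= q ^ 2 * q ^ 2 * q ^ 2 by apply: Rmult_le_pos => //; nra.
have e1 : (q ^ 2 * (q - 1)) ^ 2 = (q ^ 2) ^ 2 * (q - 1) ^ 2 by ring.
have e2 : (2 * e) ^ 2 = 4 * e ^ 2 by ring.
have e3 : (1000 / 912 * q ^ 2) ^ 3 = (1000 / 912) ^ 3 * (q ^ 2 * q ^ 2 * q ^ 2) by ring.
have e4 : (q ^ 2) ^ 2 * (0.998 * q ^ 2) = 0.998 * (q ^ 2 * q ^ 2 * q ^ 2) by ring.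
rewrite e3 in h3; rewrite e1 e2 in h1; rewrite e4 in h4; lra.
Qed.

(** The case of an induced subgraph; 1.347 is 1.215^2 * 0.912 rounded up, and 36 * 1.3511 = 48.64 <
    49 * 0.998 = 48.90. *)
Lemma large_field_arith (q m e : R) : 1000 <= q -> 1000 <= m ->
  1000 * q ^ 2 <= 1347 * m ->
  m * (m - 1) <= 2 * e * (q + 1) -> 9 * m ^ 3 <= 49 * e ^ 2.
Proof.
move=> q0 m0 qm he.
have h1 : (m * (m - 1)) ^ 2 <= (2 * e * (q + 1)) ^ 2 by apply: pow_incr; nra.
have h2 : (q + 1) ^ 2 <= 1.003 * q ^ 2 by nra.
have h3 : 0.998 * m ^ 2 <= (m - 1) ^ 2 by nra.
have h4 : m ^ 2 * (0.998 * m ^ 2) <= m ^ 2 * (m - 1) ^ 2.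
  by apply: Rmult_le_compat_l => //; nra.
have h5 : (q + 1) ^ 2 <= 1.3511 * m by lra.
have h6 : e ^ 2 * (q + 1) ^ 2 <= e ^ 2 * (1.3511 * m) by apply: Rmult_le_compat_l; nra.
have h7 : m * (0.998 * m ^ 3) <= m * (4 * (1.3511 * e ^ 2)) by nra.
have h8 : 0.998 * m ^ 3 <= 4 * (1.3511 * e ^ 2) by apply: (Rmult_le_reg_l m); lra.
have : 0 <= m ^ 3 by apply: pow_le; lra.
lra.
Qed.

End DenseGraphs.

Lemma INR_pred n : 0 < n -> INR n.-1 = (INR n - 1)%Re.
Proof. by case: n => // n _; rewrite S_INR /=; lra. Qed.

Lemma INR_expn m n : INR (m ^ n) = (INR m ^ n)%Re.
Proof. by elim: n => // n IH; rewrite expnS mult_INR IH. Qed.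

Ltac nat_to_R := apply/leP/INR_le; rewrite ?(mult_INR, plus_INR, INR_expn).

(* The constant 3/7 matters: (3/7)^4 > 4!/6!. With [N ^ 2] about 0.912 m and a prime power [q] in
   ]N, 1.215 N], either [q ^ 2 <= m] and the whole polarity graph fits, or an induced subgraph
   on [m] vertices loses only the factor [q / sqrt m <= 1.161]. *)
Theorem dense_c4free_graph : exists M0 : nat, forall (U : finType) (A : {set U}), M0 <= #|A| ->
  exists K : {set {set U}}, [/\ graph K, c4free K, forall e, e \in K -> e \subset A
    & 9 * #|A| ^ 3 <= 49 * #|K| ^ 2].
Proof.
have [N0 HN0] := prime_power_between.
exists (maxn 1000 (2 * (maxn N0 1000).+1 ^ 2)) => U A; set m := #|A|; rewrite geq_max => /andP[m1000 mN].
(* Up to lower order terms, the ratio x = N^2 / m must satisfy x^3 > 36/49 when the whole graph fits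
   and 1.215^2 x < 49/36 otherwise, roughly 0.902 < x < 0.922; 0.912 is the middle. *)
pose N := Nat.sqrt (912 * m %/ 1000).
have [/leP loN /ltP hiN] := Nat.sqrt_spec (912 * m %/ 1000) (Nat.le_0_l _).
rewrite -/N in loN hiN.
have NN : maxn N0 1000 <= N.
  rewrite leqNgt; apply/negP => lt.
  have h : N.+1 * N.+1 <= (maxn N0 1000).+1 ^ 2 by rewrite -mulnn leq_mul // ltnW.
  by move: ((maxn N0 1000).+1 ^ 2) mN h hiN => z; move: (N.+1 * N.+1)%coq_nat (erefl : N.+1 * N.+1 = (N.+1 * N.+1)%coq_nat) => y <-; lia.
have [N0N N1000] : N0 <= N /\ 1000 <= N by apply/andP; rewrite -geq_max.
have [p [k [pp k0 Nq qN]]] := HN0 N N0N.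
have [F _ cF] := pPrimePowerField pp k0; rewrite -cF in Nq qN.
set q := #|F| in Nq qN.
have q1000 : 1000 <= q by apply: leq_trans N1000 (ltnW Nq).
have mq : 912 * m <= 1000 * q ^ 2.
  have : N.+1 * N.+1 <= q ^ 2 by rewrite -mulnn leq_mul.
  have -> : N.+1 * N.+1 = (N.+1 * N.+1)%coq_nat by [].
  by move: (q ^ 2) (N.+1 * N.+1)%coq_nat hiN => x y; lia.
have qm : 1000 * q ^ 2 <= 1347 * m.
  have {}loN : N ^ 2 * 1000 <= 912 * m by rewrite -leq_divRL // -mulnn.
  nat_to_R; move: qN loN => /leP/le_INR + /leP/le_INR.
  rewrite !(mult_INR, INR_expn) !INR_IZR_INZ /= -!INR_IZR_INZ.
  by have := pos_INR q; have := pos_INR N; nra.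
have he := polarity_edges F; rewrite -/q in he.
have gP := polarity_is_graph F; have cP := @polarity_c4free F.
have q0 : 0 < q by apply: leq_trans q1000.
have m0 : 0 < m by apply: leq_trans m1000.
case: (leqP (q ^ 2) m) => qm2.
  have cS : #|[set: F * F]| <= #|A| by rewrite cardsT card_prod mulnn.
  have [K [gK cK sK eK]] := embed_c4free gP cP cS; exists K; split=> //.
  have {}eK : #|K| = #|polarity_graph F|.
    by rewrite eK; apply: eq_card => e; rewrite inE subsetT andbT.
  rewrite -eK in he; nat_to_R; rewrite -/m.
  move: q1000 mq he => /leP/le_INR + /leP/le_INR + /leP/le_INR.
  rewrite !(mult_INR, INR_expn) (INR_pred q0).
  rewrite !INR_IZR_INZ /= -!INR_IZR_INZ => h1 h2 h3.
  by apply: (small_field_arith (q := INR q)) => //; apply: pos_INR.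
have mV : m <= #|{: F * F}| by rewrite card_prod mulnn ltnW.
have [S cS hS] := dense_induced gP mV.
have leS : #|S| <= #|A| by rewrite cS.
have [K [gK cK sK eK]] := embed_c4free gP cP leS.
exists K; split=> //; rewrite -eK card_prod in hS.
(* The polarity graph has density at least 1 / (q + 1), since q^2 - 1 = (q - 1)(q + 1). *)
have h3 : m * m.-1 <= 2 * #|K| * q.+1.
  have q2 : 0 < q ^ 2 * q.-1 by rewrite muln_gt0 expn_gt0 q0 /=; move: q1000; lia.
  rewrite -(leq_pmul2l q2).
  apply: (@leq_trans (2 * #|polarity_graph F| * (m * m.-1))); first by rewrite leq_mul2r he orbT.
  apply: (@leq_trans (2 * (q * q * (q * q).-1 * #|K|))); first by rewrite -mulnA leq_mul2l hS.
  rewrite (_ : (q * q).-1 = q.-1 * q.+1); last by case: (q) q0 => // a _; rewrite /=; lia.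
  by rewrite -mulnn; apply: eq_leq; move: q.-1 q.+1 (q * q) #|K| => a b c d; clear; lia.
nat_to_R; rewrite -/m.
move: q1000 m1000 qm h3 => /leP/le_INR + /leP/le_INR + /leP/le_INR + /leP/le_INR.
rewrite !(mult_INR, INR_expn) (INR_pred m0).
rewrite [INR q.+1]S_INR !INR_IZR_INZ /= -!INR_IZR_INZ => h1 h2 h4 h5.
by apply: (large_field_arith (q := INR q)).
Qed.

(** * The matching regime *)

Section MatchingRegimeArithmetic.
Local Open Scope R_scope.

Lemma pow_eventually_leq C a b : (a < b)%N ->
  exists W, 1 <= W /\ forall w, W <= w -> C * w ^ a <= w ^ b.
Proof.
move=> ab; exists (Rmax 1 C); split; first exact: Rmax_l.
move=> w hw; have w1 : 1 <= w by apply: Rle_trans hw; apply: Rmax_l.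
have Cw : C <= w by apply: Rle_trans hw; apply: Rmax_r.
have wa : 0 <= w ^ a by apply: pow_le; lra.
apply: (Rle_trans _ (w ^ a.+1)); first by rewrite /=; nra.
by apply: Rle_pow => //; apply/leP.
Qed.

Lemma pow_add_geq a b t : 0 <= a -> 0 <= b -> (2 <= t)%N ->
  a ^ t + b ^ t + a ^ t.-1 * b <= (a + b) ^ t.
Proof.
move=> a0 b0; case: t => // -[//|t] _.
elim: t => [|t IH]; first by rewrite /=; nra.
rewrite [(a + b) ^ _]/=; have := IH; rewrite /=.
have hb : 0 <= b ^ t by apply: pow_le.
have ha : 0 <= a ^ t by apply: pow_le.
move: (a ^ t) (b ^ t) ha hb => x y x0 y0 {}IH.
have h : (a + b) * (a * (a * x) + b * (b * y) + a * x * b) <= (a + b) * ((a + b) * ((a + b) * (a + b) ^ t)).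
  by apply: Rmult_le_compat_l; lra.
have p1 : 0 <= a * x by nra.
have p2 : 0 <= b * y by nra.
have p3 : 0 <= a * x * b by nra.
have p4 : 0 <= b * y * b by nra.
nra.
Qed.

Section Replace.
(* [w ^ 8] is the number of vertices; [b] vertices have blue degree at least [w ^ 6], these
   degrees sum to [D] and the blue neighborhoods cover [A] vertices; [e2'] of the [e2] red edges
   avoid the covered vertices, on which a graph with [eK] edges is placed. *)
Variables (k t : nat) (c kap fr w D b A e2 e2' eK : R).
Hypotheses (k2 : (2 <= k)%N) (t2 : (2 <= t)%N) (c0 : 0 < c) (kap0 : 0 < kap) (fr0 : 0 <= fr).
Hypothesis w4 : 4 <= w.
Hypothesis w_c : c * w ^ 2 + (2 * INR t + 1) * w + 12 / 7 <= 3 / 7 * w ^ 2.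
Hypothesis w_low : 2 * fr * w ^ (6 * (k - 2) + 16) <= kap ^ t.-1 * c * w ^ (12 * t.-1 + 9).
Hypothesis w_high : ((2 * k = 3 * t)%N /\ fr <= c ^ t) \/
  2 * fr * (2 ^ (2 * k - 3) * w ^ (4 * (2 * k - 3))) <= kap ^ t.-1 * c * w ^ (12 * t.-1).
Hypotheses (b1 : 1 <= b) (bD : b * w ^ 6 <= D) (bw : b * (w ^ 6 * (w ^ 6 - 1)) <= w ^ 16).
Hypotheses (DA : D <= A + b ^ 2) (An : A <= w ^ 8).
Hypotheses (AK : 9 * A ^ 3 <= 49 * eK ^ 2) (eK0 : 0 <= eK).
Hypotheses (e2b : e2 <= e2' + b * w ^ 8) (kap_e2 : kap * w ^ 12 <= e2).

(** The graph placed on [A] has about (3/7) D^(3/2) edges; in terms of z the numbers D^(3/2) and D^k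
    become z^3 and z^(2k). *)
Let z := sqrt D.
Let D0 : 0 < D. Proof. by have : 0 < w ^ 6 by [apply: pow_lt; lra]; nra. Qed.
Let zD : D = z ^ 2. Proof. by rewrite pow2_sqrt //; lra. Qed.
Let z0 : 0 < z. Proof. exact: sqrt_lt_R0. Qed.

Let wz : w ^ 3 <= z.
Proof.
have p : 0 <= w ^ 3 by apply: pow_le; lra.
apply: Rsqr_incr_0 => //; last by lra.
rewrite /Rsqr; have : z * z = D by rewrite zD; ring.
have -> : w ^ 3 * w ^ 3 = w ^ 6 by ring.
have : 0 < w ^ 6 by apply: pow_lt; lra.
move=> h1 ->; nra.
Qed.

Let b_w4 : b <= 2 * w ^ 4.
Proof.
have h6 : 2 <= w ^ 6 by have : 4 ^ 6 <= w ^ 6 by [apply: pow_incr; lra]; lra.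
have h : w ^ 16 = w ^ 4 * (w ^ 6 * w ^ 6) by ring.
have h4 : 0 < w ^ 4 by apply: pow_lt; lra.
apply: (Rmult_le_reg_r (w ^ 6 * (w ^ 6 - 1))); first nra.
apply: Rle_trans bw _; rewrite h.
have : w ^ 6 * w ^ 6 <= 2 * (w ^ 6 * (w ^ 6 - 1)) by nra.
move=> h'; have := Rmult_le_compat_l (w ^ 4) _ _ (Rlt_le _ _ h4) h'; lra.
Qed.

Let b_D : b ^ 2 * w ^ 2 <= 2 * D.
Proof.
have h4 : 0 < w ^ 4 by apply: pow_lt; lra.
have h : b * b * w ^ 2 * w ^ 4 <= b * w ^ 6 * (2 * w ^ 4).
  have -> : b * b * w ^ 2 * w ^ 4 = b * w ^ 6 * b by ring.
  apply: Rmult_le_compat_l => //; have : 0 < w ^ 6 by apply: pow_lt; lra.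
  nra.
apply: (Rmult_le_reg_r (w ^ 4)) => //.
have -> : b ^ 2 * w ^ 2 * w ^ 4 = b * b * w ^ 2 * w ^ 4 by ring.
apply: Rle_trans h _.
nra.
Qed.

(** There are b <= 2 n^(1/2) vertices of high degree, so b^2 / D <= b / n^(3/4) <= 2 n^(-1/4) = 2 /
    w^2: their neighborhoods are almost disjoint. *)
Lemma high_union_geq : D * (1 - 2 / w ^ 2) <= A.
Proof.
have w2 : 0 < w ^ 2 by apply: pow_lt; lra.
have : b ^ 2 <= 2 * D / w ^ 2.
  by apply/Rle_div_r => //; lra.
have -> : D * (1 - 2 / w ^ 2) = D - 2 * D / w ^ 2 by field; lra.
lra.
Qed.

Let inv_w2 : 0 < 2 / w ^ 2 <= 1 / 8.
Proof.
have w2 : 16 <= w ^ 2 by nra.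
split; first by apply: Rdiv_lt_0_compat; lra.
by apply/Rle_div_l; lra.
Qed.

Let z_leq : z <= 2 * w ^ 4.
Proof.
have p4 : 0 < w ^ 4 by apply: pow_lt; lra.
apply: Rsqr_incr_0; rewrite /Rsqr; try lra.
have -> : z * z = D by rewrite zD; ring.
have -> : 2 * w ^ 4 * (2 * w ^ 4) = 4 * w ^ 8 by ring.
have := high_union_geq; nra.
Qed.

Let eK_geq : 3 / 7 * z ^ 3 * (1 - 4 / w ^ 2) <= eK.
Proof.
move: inv_w2 high_union_geq; set x := 2 / w ^ 2 => ix ax.
have w2 : 0 < w ^ 2 by apply: pow_lt; lra.
have x4 : 4 / w ^ 2 = 2 * x by rewrite /x; field; lra.
have z3 : 0 < z ^ 3 by apply: pow_lt.
apply: Rsqr_incr_0; rewrite /Rsqr //; last by rewrite x4; nra.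
have h1 : (D * (1 - x)) ^ 3 <= A ^ 3 by apply: pow_incr; split=> //; nra.
have h2 : (1 - 2 * x) ^ 2 <= (1 - x) ^ 3 by nra.
have e1 : (D * (1 - x)) ^ 3 = z ^ 3 * z ^ 3 * (1 - x) ^ 3 by rewrite zD; ring.
rewrite e1 in h1; rewrite x4.
have h3 : z ^ 3 * z ^ 3 * (1 - 2 * x) ^ 2 <= z ^ 3 * z ^ 3 * (1 - x) ^ 3.
  by apply: Rmult_le_compat_l; nra.
have -> : 3 / 7 * z ^ 3 * (1 - 2 * x) * (3 / 7 * z ^ 3 * (1 - 2 * x)) =
  9 / 49 * (z ^ 3 * z ^ 3 * (1 - 2 * x) ^ 2) by field.
have -> : eK * eK = eK ^ 2 by ring.
lra.
Qed.

(** Clearing the covered vertices costs b n red edges, and b n w = (b w^6) w^3 <= D z = z^3, so the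
    cost is smaller than z^3 by the factor w. *)
Let loss_leq : (b + 2 * INR t) * w ^ 8 * w <= z ^ 3 * (1 + 2 * INR t).
Proof.
have t0 := pos_INR t.
have p3 : 0 < w ^ 3 by apply: pow_lt; lra.
have h1 : b * w ^ 8 * w <= z ^ 3.
  have -> : b * w ^ 8 * w = b * w ^ 6 * w ^ 3 by ring.
  apply: (Rle_trans _ (D * z)); last by rewrite zD; lra.
  by apply: Rmult_le_compat; try lra; have : 0 < w ^ 6 by [apply: pow_lt; lra]; nra.
have h2 : w ^ 8 * w <= z ^ 3.
  have -> : w ^ 8 * w = (w ^ 3) ^ 3 by ring.
  by apply: pow_incr; lra.
have := Rmult_le_compat_l (2 * INR t) _ _ ltac:(lra) h2; lra.
Qed.

(** The net gain is still c D^(3/2) edges after the lost red edges and the error 2tn of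
    [matchings_geq] are paid out of the difference between 3/7 and c. *)
Lemma replace_base_geq : e2 + c * z ^ 3 <= e2' + eK - 2 * INR t * w ^ 8.
Proof.
have z3 : 0 < z ^ 3 by apply: pow_lt.
have h : (b + 2 * INR t) * w ^ 8 <= z ^ 3 * (1 + 2 * INR t) / w.
  by apply/Rle_div_r; [lra|exact: loss_leq].
suff : c * z ^ 3 + z ^ 3 * (1 + 2 * INR t) / w <= 3 / 7 * z ^ 3 * (1 - 4 / w ^ 2).
  by have := eK_geq; lra.
have -> : c * z ^ 3 + z ^ 3 * (1 + 2 * INR t) / w = (c * w ^ 2 + (2 * INR t + 1) * w) * (z ^ 3 / w ^ 2).
  by field; lra.
have -> : 3 / 7 * z ^ 3 * (1 - 4 / w ^ 2) = (3 / 7 * w ^ 2 - 12 / 7) * (z ^ 3 / w ^ 2).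
  by field; lra.
apply: Rmult_le_compat_r; last by lra.
by apply/Rlt_le/Rdiv_lt_0_compat => //; apply: pow_lt; lra.
Qed.

(** Expanding (e2 + c z^3)^t leaves two gains: the pure term (c z^3)^t, equal to c^t D^k on the
    boundary 2k = 3t, and the cross term e2^(t-1) c z^3. Half of the cross term pays for the stars
    at low degrees; the other half pays for D^k off the boundary, where z <= 2 w^4 makes D^k of
    smaller order. *)
Lemma replace_arith :
  e2 ^ t + fr * (D ^ k + w ^ (6 * (k - 2) + 16)) <= (e2' + eK - 2 * INR t * w ^ 8) ^ t.
Proof.
have z3 : 0 < z ^ 3 by apply: pow_lt.
have p12 : 0 < w ^ 12 by apply: pow_lt; lra.
have e20 : 0 < e2 by nra.
have cz0 : 0 < c * z ^ 3 by nra.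
apply: (Rle_trans _ ((e2 + c * z ^ 3) ^ t)); last by apply: pow_incr; have := replace_base_geq; lra.
have := pow_add_geq (Rlt_le _ _ e20) (Rlt_le _ _ cz0) t2.
have slack : kap ^ t.-1 * c * w ^ (12 * t.-1) * z ^ 3 <= e2 ^ t.-1 * (c * z ^ 3).
  have -> : kap ^ t.-1 * c * w ^ (12 * t.-1) * z ^ 3 = (kap * w ^ 12) ^ t.-1 * (c * z ^ 3).
    have ew : (w ^ 12) ^ t.-1 = w ^ (12 * t.-1) by rewrite -pow_mult.
    by rewrite Rpow_mult_distr ew; ring.
  apply: Rmult_le_compat_r; first by lra.
  by apply: pow_incr; split=> //; nra.
have kc0 : 0 < kap ^ t.-1 * c by apply: Rmult_lt_0_compat => //; apply: pow_lt.
have p12t : 0 < w ^ (12 * t.-1) by apply: pow_lt; lra.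
have low : 2 * fr * w ^ (6 * (k - 2) + 16) <= kap ^ t.-1 * c * w ^ (12 * t.-1) * z ^ 3.
  apply: Rle_trans w_low _; rewrite pow_add -Rmult_assoc; apply: Rmult_le_compat_l; first by nra.
  have -> : w ^ 9 = (w ^ 3) ^ 3 by ring.
  by apply: pow_incr; split=> //; apply: pow_le; lra.
have ct0 : 0 < (c * z ^ 3) ^ t by apply: pow_lt.
have high : 2 * fr * D ^ k <= 2 * (c * z ^ 3) ^ t + kap ^ t.-1 * c * w ^ (12 * t.-1) * z ^ 3.
  have pos : 0 <= kap ^ t.-1 * c * w ^ (12 * t.-1) * z ^ 3 by apply: Rmult_le_pos; nra.
  rewrite zD -pow_mult; case: w_high => [[kt hc]|hw].
    rewrite (_ : Nat.mul 2 k = 3 * t)%N // Rpow_mult_distr -pow_mult.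
    have : 0 < z ^ (3 * t) by apply: pow_lt.
    move: (z ^ (3 * t)%N) => y y0; nra.
  have -> : z ^ Nat.mul 2 k = z ^ 3 * z ^ (2 * k - 3).
    by rewrite -pow_add; congr (_ ^ _); lia.
  have h : z ^ (2 * k - 3) <= 2 ^ (2 * k - 3) * w ^ (4 * (2 * k - 3)).
    by rewrite pow_mult -Rpow_mult_distr; apply: pow_incr; have := z_leq; lra.
  have h' : fr * z ^ (2 * k - 3) <= fr * (2 ^ (2 * k - 3) * w ^ (4 * (2 * k - 3))).
    exact: Rmult_le_compat_l.
  have := Rmult_le_compat_r (z ^ 3) _ _ (Rlt_le _ _ z3) hw.
  have := Rmult_le_compat_r (z ^ 3) _ _ (Rlt_le _ _ z3) h'.
  move: ct0; lra.
lra.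
Qed.

End Replace.
End MatchingRegimeArithmetic.

Lemma leq_ffact_exp m k : m ^_ k <= m ^ k.
Proof. by elim: k => // k IH; rewrite ffactnSr expnSr leq_mul // leq_subr. Qed.

Lemma leq_ffact_exp2 m k : m ^_ k.+2 <= m * m.-1 * m ^ k.
Proof.
elim: k => [|k IH]; first by rewrite !ffactnSr ffactn0 mul1n subn0 subn1 expn0 muln1.
by rewrite ffactnSr expnSr mulnA leq_mul // leq_subr.
Qed.

Lemma fact_bin_ffact m k : k`! * 'C(m, k) = m ^_ k.
Proof. by rewrite mulnC bin_ffact. Qed.

(** * Star counts by degree range *)

Section StarBounds.
Variables (T : finType) (E : {set {set T}}).
Hypotheses (gE : graph E) (cE : c4free E).

Lemma leq_deg_card v : deg E v <= #|T|.
Proof. exact: max_card. Qed.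

(** A degree d <= tau gives d^k <= d tau^(k-1), and the degrees sum to 2|E|. For k = 1 the power of
    tau is 1 whatever the degrees, hence the disjunction. *)
Lemma stars_leq_low k tau : 0 < k -> (forall v, k = 1 \/ deg E v <= tau) ->
  k`! * \sum_v 'C(deg E v, k) <= 2 * #|E| * tau ^ k.-1.
Proof.
move=> k0 h; rewrite -handshake // big_distrr big_distrl; apply: leq_sum => v _ /=.
rewrite fact_bin_ffact; apply: leq_trans (leq_ffact_exp _ _) _.
case: k k0 h => // k _ h; rewrite expnS leq_mul2l; apply/orP; right => /=.
case: (h v) => [[->] //|le].
by case: (posnP k) => [-> //|k0]; rewrite leq_exp2r.
Qed.

Lemma stars_leq_trivial k : 0 < k -> k`! * \sum_v 'C(deg E v, k) <= #|T| ^ maxn k 2.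
Proof.
case: k => // -[_|k _].
  rewrite mul1n -mulnn -sum_nat_const; apply: leq_sum => v _.
  by rewrite bin1 leq_deg_card.
rewrite (maxn_idPl _) // big_distrr /=.
apply: (@leq_trans (\sum_v deg E v * (deg E v).-1 * #|T| ^ k)).
  apply: leq_sum => v _; rewrite fact_bin_ffact; apply: leq_trans (leq_ffact_exp2 _ _) _.
  rewrite leq_mul2l; apply/orP; right; case: (posnP k) => [-> //|k0].
  by rewrite leq_exp2r // leq_deg_card.
rewrite -big_distrl /= !expnS mulnA leq_mul2r; apply/orP; right.
by apply: leq_trans (sum_deg_pred cE) _; rewrite leq_mul2l leq_pred orbT.
Qed.

Lemma sum_exp_leq (B : {set T}) (d : T -> nat) k :
  \sum_(v in B) d v ^ k.+1 <= (\sum_(v in B) d v) ^ k.+1.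
Proof.
apply: (@leq_trans (\sum_(v in B) d v * (\sum_(v in B) d v) ^ k)).
  apply: leq_sum => v vB; rewrite expnS leq_mul2l; apply/orP; right.
  case: (posnP k) => [-> //|k0]; rewrite leq_exp2r //.
  by rewrite (bigD1 v) //= leq_addr.
by rewrite -big_distrl /= expnS.
Qed.

(** Above tau the sum of k-th powers is at most the k-th power of the sum; below it, each star count
    is at most tau^(k-2) times d (d - 1), whose total is at most n^2. *)
Lemma stars_leq_split k tau : 2 <= k ->
  k`! * \sum_v 'C(deg E v, k) <=
    (\sum_(v in [set v | tau < deg E v]) deg E v) ^ k + tau ^ (k - 2) * #|T| ^ 2.
Proof.
case: k => // -[//|k _]; rewrite !subSS subn0.
rewrite big_distrr /= (bigID (mem [set v | tau < deg E v])) /=; apply: leq_add.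
  apply: leq_trans (sum_exp_leq _ _ _); apply: leq_sum => v _.
  by rewrite fact_bin_ffact leq_ffact_exp.
apply: (@leq_trans (\sum_v deg E v * (deg E v).-1 * tau ^ k)).
  rewrite [X in X <= _]big_mkcond /=; apply: leq_sum => v _; case: ifP => //.
  rewrite inE -leqNgt => le; rewrite fact_bin_ffact; apply: leq_trans (leq_ffact_exp2 _ _) _.
  rewrite leq_mul2l; apply/orP; right; case: (posnP k) => [-> //|k0].
  by rewrite leq_exp2r.
rewrite -big_distrl /= mulnC leq_mul2l; apply/orP; right.
by apply: leq_trans (sum_deg_pred cE) _; rewrite -mulnn leq_mul2l leq_pred orbT.
Qed.

Lemma card_high_degree tau (B := [set v | tau < deg E v]) :
  #|B| * (tau.+1) <= \sum_(v in B) deg E v /\ #|B| * (tau.+1 * tau) <= #|T| ^ 2.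
Proof.
rewrite -!sum_nat_const; split.
  by apply: leq_sum => v; rewrite inE.
apply: (@leq_trans (\sum_v deg E v * (deg E v).-1)).
  rewrite big_mkcond /=; apply: leq_sum => v _; case: ifP => //.
  by rewrite inE; case: (deg E v) => // d td; rewrite leq_mul.
by apply: leq_trans (sum_deg_pred cE) _; rewrite -mulnn leq_mul2l leq_pred orbT.
Qed.

End StarBounds.

(** * The constants of the matching regime *)

Section Constants.
Local Open Scope R_scope.

(** For t = 2j and k = 3j this says t! / k! < (3/7)^t. It is closest at j = 2, where 57624 < 58320;
    increasing j multiplies the right side by more than the left. *)
Lemma tight_factorials j : (2 <= j)%N -> (49 ^ j * (2 * j)`! < 9 ^ j * (3 * j)`!)%N.
Proof.
case: j => // -[//|j _]; elim: j => [|j IH].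
  have -> : ((2 * 2)`! = 24)%N by [].
  have -> : ((3 * 2)`! = 30 * 24)%N by [].
  by rewrite -!mulnn; lia.
have e1 : (2 * j.+3 = (2 * j.+2).+2)%N by lia.
have e2 : (3 * j.+3 = (3 * j.+2).+3)%N by lia.
rewrite e1 e2 (factS (2 * j.+2).+1) (factS (2 * j.+2)) (factS (3 * j.+2).+2) (factS (3 * j.+2).+1) (factS (3 * j.+2)) ![(_ ^ j.+3)%N]expnS.
move: IH; move: (49 ^ j.+2)%N (9 ^ j.+2)%N (2 * j.+2)`! (3 * j.+2)`! => a b x y h.
have h1 : (49 * ((2 * j.+2).+2 * (2 * j.+2).+1) <= 9 * ((3 * j.+2).+3 * ((3 * j.+2).+2 * (3 * j.+2).+1)))%N.
  by move: (j.+1) => m; clear; nia.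
have -> : (49 * a * ((2 * j.+2).+2 * ((2 * j.+2).+1 * x)) = 49 * ((2 * j.+2).+2 * (2 * j.+2).+1) * (a * x))%N by lia.
have -> : (9 * b * ((3 * j.+2).+3 * ((3 * j.+2).+2 * ((3 * j.+2).+1 * y))) =
  9 * ((3 * j.+2).+3 * ((3 * j.+2).+2 * (3 * j.+2).+1)) * (b * y))%N by lia.
apply: leq_ltn_trans (leq_mul h1 (leqnn _)) _.
by rewrite ltn_pmul2l // !muln_gt0.
Qed.

Lemma bernoulli x m : 0 <= x <= 1 -> 1 - INR m * x <= (1 - x) ^ m.
Proof.
move=> hx; elim: m => [|m IH]; first by rewrite /=; lra.
have := pos_INR m; rewrite [_ ^ m.+1]/= S_INR; nra.
Qed.

Variables (k t : nat).
Hypotheses (k1 : (1 <= k)%N) (t2 : (2 <= t)%N) (kt : (2 * k <= 3 * t)%N) (nkt : (k, t) <> (3, 2)%N).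
Let fr := INR t`! / INR k`!.

Let fact_pos m : 0 < INR m`!. Proof. by apply/lt_0_INR/ltP/fact_gt0. Qed.

(** The inequality of exponents 3(k-1)/4 < 3(t-1)/2 behind the recoloring. The excluded pair (3, 2)
    violates it. *)
Lemma two_t_gt : (k.+2 <= 2 * t)%N.
Proof.
case: (t =P 2%N) => [t_2|]; last by move: kt t2; lia.
have : k <> 3%N by move=> k3; apply: nkt; rewrite k3 t_2.
by move: kt; rewrite t_2; lia.
Qed.

Lemma tight_ratio : (2 * k = 3 * t)%N -> fr < (3 / 7) ^ t.
Proof.
move=> e; pose j := (t %/ 2)%N.
have [tj kj] : t = (2 * j)%N /\ k = (3 * j)%N by rewrite /j; lia.
have j2 : (2 <= j)%N by rewrite ltnNge; apply/negP => j1; have := two_t_gt; lia.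
rewrite /fr; apply/Rlt_div_l => //.
have /ltP/lt_INR := tight_factorials j2; rewrite tj kj !mult_INR !INR_expn => h.
have -> : (3 / 7) ^ (2 * j) = INR 9 ^ j / INR 49 ^ j.
  rewrite (pow_mult (3 / 7) 2 j) (_ : (3 / 7) ^ 2 = INR 9 / INR 49); last first.
    by rewrite !INR_IZR_INZ /=; field.
  by rewrite /Rdiv Rpow_mult_distr pow_inv.
have p49 : 0 < INR 49 ^ j by apply: pow_lt; rewrite INR_IZR_INZ /=; lra.
rewrite (_ : _ * _ = INR 9 ^ j * INR (3 * j)`! / INR 49 ^ j); last by field; lra.
by apply: (Rmult_lt_reg_l (INR 49 ^ j)) => //; move: h; rewrite (_ : _ * (_ / _) = INR 9 ^ j * INR (3 * j)`!) //; field; lra.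
Qed.

(* [c] is slightly below 3/7, so that error terms can be absorbed, and [kap * n ^ (3/2)] is the
   number of red edges below which the red matchings are negligible. *)
Lemma regime_constants : exists c kap sig,
  [/\ 0 < c < 3 / 7, 0 < kap, 0 < sig, sig + kap ^ t <= c ^ t &
      (2 * k = 3 * t)%N -> fr <= sig].
Proof.
pose g := (3 / 7) ^ t; have g0 : 0 < g by apply: pow_lt; lra.
have [s0 [s00 s0g hs0]] : exists s0, [/\ 0 <= s0, s0 < g & (2 * k = 3 * t)%N -> fr <= s0].
  case: (2 * k =P 3 * t)%N => [e|ne]; last by exists 0; split; [lra| |].
  exists fr; split; [|exact: tight_ratio|lra].
  by apply/Rlt_le/Rdiv_lt_0_compat.
have t1 : 2 <= INR t by rewrite (_ : 2 = INR 2) //; apply/le_INR/leP.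
have g1 : g <= 1 by rewrite /g -(pow1 t); apply: pow_incr; lra.
(* By Bernoulli's inequality, passing from 3/7 to 3/7 (1 - dl) costs at most half of g - s0; the
   other half is shared equally by [sig] and kap^t. *)
pose dl := (g - s0) / (2 * INR t * g).
have dl0 : 0 < dl by apply: Rdiv_lt_0_compat; nra.
have tdl : INR t * dl = (g - s0) / (2 * g) by rewrite /dl; field; lra.
have dl1 : dl < 1.
  by rewrite /dl; apply/Rlt_div_l; nra.
exists (3 / 7 * (1 - dl)), ((g - s0) / 4), (s0 + (g - s0) / 4); split; try lra.
  have hk : ((g - s0) / 4) ^ t <= (g - s0) / 4.
    case: (t) t2 => // m _; rewrite /=.
    have : ((g - s0) / 4) ^ m <= 1 by rewrite -(pow1 m); apply: pow_incr; lra.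
    by nra.
  rewrite Rpow_mult_distr -/g.
  have hb := @bernoulli dl t ltac:(lra).
  have : g * (1 - INR t * dl) <= g * (1 - dl) ^ t by apply: Rmult_le_compat_l; lra.
  have -> : g * (1 - INR t * dl) = g - (g - s0) / 2 by rewrite tdl; field; lra.
  lra.
by move=> /hs0; lra.
Qed.

End Constants.

(** * Comparison of a coloring with the extremal matching count *)

Section MatchingRegime.
Local Open Scope R_scope.

Lemma pow_eventually_leq_scaled A B a b : 0 < B -> (a < b)%N ->
  exists W, forall w, W <= w -> A * w ^ a <= B * w ^ b.
Proof.
move=> B0 ab; have [W [W1 hW]] := pow_eventually_leq (A / B) ab.
exists W => w /hW; have -> : A * w ^ a = B * (A / B * w ^ a) by field; lra.
by move=> h; apply: Rmult_le_compat_l; lra.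
Qed.

Lemma Rmax_leq x y w : Rmax x y <= w -> x <= w /\ y <= w.
Proof. by move=> h; split; apply: Rle_trans h; [apply: Rmax_l|apply: Rmax_r]. Qed.

Lemma pow_leq_inv m x y : (0 < m)%N -> 0 <= y -> x ^ m <= y ^ m -> x <= y.
Proof.
case: m => // m _ y0 h; apply: Rnot_lt_le => lt.
have : y ^ m.+1 < x ^ m.+1; last by lra.
elim: m {h} => [|m IH]; first by rewrite /=; lra.
have : 0 <= y ^ m.+1 by apply: pow_le.
rewrite -[y ^ m.+2]/(y * y ^ m.+1) -[x ^ m.+2]/(x * x ^ m.+1).
by nra.
Qed.

(** With n = w^8 the thresholds n^(3/4), n and n^(3/2) are the integral powers w^6, w^8 and w^12,
    and w^9 bounds D^(3/2) from below. *)
Lemma eighth_root W : exists N0 : nat, forall n : nat, (N0 <= n)%N ->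
  exists w, [/\ W <= w, 0 <= w & w ^ 8 = INR n].
Proof.
have [N0 hN] := nat_upper_bound (W ^ 8); exists N0 => n /leP/le_INR h.
have n0 := pos_INR n; exists (sqrt (sqrt (sqrt (INR n)))).
have s1 := sqrt_pos (INR n); have s2 := sqrt_pos (sqrt (INR n)).
have s3 := sqrt_pos (sqrt (sqrt (INR n))).
have e8 : sqrt (sqrt (sqrt (INR n))) ^ 8 = INR n.
  rewrite (_ : 8%N = 2 * (2 * 2))%N // pow_mult pow2_sqrt // pow_mult pow2_sqrt //.
  exact: pow2_sqrt.
by split=> //; apply: (@pow_leq_inv 8) => //; rewrite e8; lra.
Qed.

Lemma fourth_root_floor m : exists tau, (tau ^ 4 <= m < tau.+1 ^ 4)%N.
Proof.
have sq x : exists s, (s ^ 2 <= x < s.+1 ^ 2)%N.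
  have [/leP h1 /ltP h2] := Nat.sqrt_spec x (Nat.le_0_l _).
  by exists (Nat.sqrt x); rewrite -!mulnn; apply/andP.
have [s /andP[s1 s2]] := sq m; have [u /andP[u1 u2]] := sq s; exists u.
rewrite (_ : 4 = 2 * 2)%N // !expnM; apply/andP; split.
  by apply: leq_trans s1; rewrite leq_exp2r.
by apply: leq_trans s2 _; rewrite leq_exp2r.
Qed.

Variables (k t : nat).
Hypotheses (k1 : (1 <= k)%N) (t2 : (2 <= t)%N) (kt : (2 * k <= 3 * t)%N) (nkt : (k, t) <> (3, 2)%N).
Let fr := INR t`! / INR k`!.
Let fact_pos m : 0 < INR m`!. Proof. by apply/lt_0_INR/ltP/fact_gt0. Qed.
Let fr0 : 0 <= fr. Proof. by apply/Rlt_le/Rdiv_lt_0_compat. Qed.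

(** The first three groups feed the replacement argument. The bound by [sig] and the one by 3/7 - c
    serve the case of few red edges, the two with kap / 2 serve the recoloring, and the last makes
    dense graphs available on sets of at least w^6 / 2 vertices. *)
Definition large_enough c kap sig (M0 : nat) w :=
  (4 <= w /\ c * w ^ 2 + (2 * INR t + 1) * w + 12 / 7 <= 3 / 7 * w ^ 2) /\
  (2 * fr * w ^ (6 * (k - 2) + 16) <= kap ^ t.-1 * c * w ^ (12 * t.-1 + 9)) /\
  (((2 * k = 3 * t)%N /\ fr <= c ^ t) \/
    2 * fr * (2 ^ (2 * k - 3) * w ^ (4 * (2 * k - 3))) <= kap ^ t.-1 * c * w ^ (12 * t.-1)) /\
  (fr * w ^ (8 * maxn k 2) <= sig * w ^ (12 * t)) /\
  (2 * INR t * w ^ 8 <= (3 / 7 - c) * w ^ 12) /\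
  (2 * (INR t.-1`! / INR k`!) * w ^ (6 * k.-1) <= (kap / 2) ^ t.-1 * w ^ (12 * t.-1)) /\
  (2 * INR t * w ^ 8 <= kap / 2 * w ^ 12) /\
  2 * INR M0 <= w ^ 6.

Lemma large_enough_eventually c kap sig M0 :
  0 < c < 3 / 7 -> 0 < kap -> 0 < sig -> sig + kap ^ t <= c ^ t ->
  ((2 * k = 3 * t)%N -> fr <= sig) ->
  exists W, forall w, W <= w -> large_enough c kap sig M0 w.
Proof.
move=> hc kap0 sig0 sum hs; have := two_t_gt k1 t2 kt nkt => t2k.
have t0 := pos_INR t.
have kc0 : 0 < kap ^ t.-1 * c by apply: Rmult_lt_0_compat; [apply: pow_lt|lra].
have kt0 : 0 < kap ^ t by apply: pow_lt.
have [Wa ha] := @pow_eventually_leq_scaled (2 * INR t + 1 + 12 / 7) (3 / 7 - c) 1 2 ltac:(lra) isT.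
have [Wb hb] := @pow_eventually_leq_scaled (2 * fr) _ (6 * (k - 2) + 16) (12 * t.-1 + 9) kc0 ltac:(lia).
have [Wc hcc] : exists W, forall w, W <= w -> ((2 * k = 3 * t)%N /\ fr <= c ^ t) \/
    2 * fr * (2 ^ (2 * k - 3) * w ^ (4 * (2 * k - 3))) <= kap ^ t.-1 * c * w ^ (12 * t.-1).
  case: (2 * k =P 3 * t)%N => [e|ne].
    by exists 0 => w _; left; split=> //; have := hs e; lra.
  have [W hW] := @pow_eventually_leq_scaled (2 * fr * 2 ^ (2 * k - 3)) _ (4 * (2 * k - 3)) (12 * t.-1) kc0 ltac:(lia).
  by exists W => w /hW; right; lra.
have [Wd hd] : exists W, forall w, W <= w -> fr * w ^ (8 * maxn k 2) <= sig * w ^ (12 * t).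
  case: (2 * k =P 3 * t)%N => [e|ne].
    exists 1 => w w1; rewrite (_ : 8 * maxn k 2 = 12 * t)%N; last by lia.
    by apply: Rmult_le_compat_r; [apply: pow_le; lra|exact: hs].
  by apply: pow_eventually_leq_scaled; [lra|lia].
have [We he] := @pow_eventually_leq_scaled (2 * INR t) (3 / 7 - c) 8 12 ltac:(lra) isT.
have kk0 : 0 < (kap / 2) ^ t.-1 by apply: pow_lt; lra.
have [Wf hf] := @pow_eventually_leq_scaled (2 * (INR t.-1`! / INR k`!)) _ (6 * k.-1) (12 * t.-1) kk0 ltac:(lia).
have [Wg hg] := @pow_eventually_leq_scaled (2 * INR t) (kap / 2) 8 12 ltac:(lra) isT.
have [Wh hh] := @pow_eventually_leq_scaled (2 * INR M0) 1 0 6 ltac:(lra) isT.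
exists (Rmax 4 (Rmax (Rmax (Rmax Wa Wb) (Rmax Wc Wd)) (Rmax (Rmax We Wf) (Rmax Wg Wh)))) => w.
move=> /Rmax_leq[w4 /Rmax_leq[/Rmax_leq[/Rmax_leq[wa wb] /Rmax_leq[wc wd]] /Rmax_leq[/Rmax_leq[we wf] /Rmax_leq[wg wh]]]].
split; first by split=> //; have := ha _ wa; rewrite pow_1; nra.
split; first exact: hb.
split; first exact: hcc.
split; first exact: hd.
split; first exact: he.
split; first exact: hf.
split; first exact: hg.
by have := hh _ wh; rewrite /=; lra.
Qed.


Section Coloring.
Variables (n : nat) (E E1 : {set {set 'I_n}}).
Hypotheses (gE : graph E) (cE : c4free E) (sE1 : E1 \subset E).
Let E2 := E :\: E1.
Let S := (\sum_v 'C(deg E1 v, k))%N.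
Let M := #|matchings t E2|.
Let X := ex n (Mmatch t) C4.
Let g1 : graph E1. Proof. exact: graph_sub sE1 gE. Qed.
Let c1 : c4free E1. Proof. exact: c4free_sub sE1 cE. Qed.
Let g2 : graph E2. Proof. by apply: graph_sub gE; apply: subsetDl. Qed.
Let c2 : c4free E2. Proof. by apply: c4free_sub cE; apply: subsetDl. Qed.

Variables (c kap sig w : R) (M0 : nat).
Hypotheses (hc : 0 < c < 3 / 7) (kap0 : 0 < kap) (sig0 : 0 < sig) (hsum : sig + kap ^ t <= c ^ t).
Hypotheses (hw : large_enough c kap sig M0 w) (wn : w ^ 8 = INR n).
Hypothesis dense : forall A : {set 'I_n}, (M0 <= #|A|)%N ->
  exists K : {set {set 'I_n}}, [/\ graph K, c4free K, forall e, e \in K -> e \subset A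
    & (9 * #|A| ^ 3 <= 49 * #|K| ^ 2)%N].

Let w4 : 4 <= w. Proof. by case: hw => -[]. Qed.

Lemma matchings_leq_R : INR t`! * INR M <= INR #|E2| ^ t.
Proof. by rewrite -mult_INR -INR_expn; apply/le_INR/leP/matchings_leq. Qed.

Lemma subn_INR_geq a b : INR a - INR b <= INR (a - b).
Proof.
case: (leqP a b) => [le|lt].
  by have /leP/le_INR := le; have := pos_INR (a - b); lra.
by rewrite minus_INR; [lra|apply/leP/ltnW].
Qed.

Lemma ex_matchings_geq (K : {set {set 'I_n}}) x : graph K -> c4free K ->
  0 <= x -> x <= INR #|K| - 2 * INR t * w ^ 8 -> x ^ t <= INR t`! * INR X.
Proof.
move=> gK cK x0 hx.
apply: (Rle_trans _ (INR ((#|K| - 2 * t * n) ^ t))).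
  rewrite INR_expn; apply: pow_incr; split=> //; apply: Rle_trans hx _.
  apply: Rle_trans (subn_INR_geq _ _); rewrite !mult_INR wn.
  by rewrite -[INR 2]/2; lra.
rewrite -mult_INR; apply/le_INR/leP; apply: leq_trans (matchings_geq t gK) _.
rewrite leq_mul2l -Ncount_match //; last by apply: ltnW.
by rewrite (@ex_geq n _ (Mmatch t) K) ?orbT.
Qed.

Lemma value_from_factorials : INR t`! * INR S + INR t`! * INR M <= INR t`! * INR X -> (S + M <= X)%N.
Proof.
move=> h; apply/leP/INR_le; rewrite plus_INR.
by apply: (Rmult_le_reg_l (INR t`!)) => //; lra.
Qed.

Lemma fr_stars y : INR k`! * INR S <= y -> INR t`! * INR S <= fr * y.
Proof.
move=> h; have -> : INR t`! * INR S = fr * (INR k`! * INR S).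
  by rewrite /fr; field; have := fact_pos k; lra.
exact: Rmult_le_compat_l.
Qed.

(** Multiplied by t!, the stars contribute at most sig n^(3t/2) and the red matchings at most kap^t
    n^(3t/2). A dense C4-free graph on all vertices has c^t n^(3t/2) at the same scale. *)
Lemma few_red_edges : INR #|E2| <= kap * w ^ 12 -> (S + M <= X)%N.
Proof.
move=> e2; apply: value_from_factorials.
have [_ [_ [_ [hd [he [_ [_ hh]]]]]]] := hw.
have w0 : 0 < w by lra.
have nM0 : (M0 <= #|[set: 'I_n]|)%N.
  rewrite cardsT card_ord; apply/leP/INR_le; rewrite -wn.
  have := pos_INR M0; have : w ^ 6 <= w ^ 8 by apply: Rle_pow; [lra|lia].
  lra.
have [K [gK cK _ hK]] := dense nM0.
have eK : 3 / 7 * w ^ 12 <= INR #|K|.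
  apply: (@pow_leq_inv 2) => //; first exact: pos_INR.
  move: hK => /leP/le_INR; rewrite cardsT card_ord (mult_INR 9) (mult_INR 49) !INR_expn -wn.
  rewrite (INR_IZR_INZ 9) (INR_IZR_INZ 49) -[IZR (Z.of_nat 9)]/9 -[IZR (Z.of_nat 49)]/49; lra.
have cw0 : 0 <= c * w ^ 12 by apply: Rmult_le_pos; [lra|apply: pow_le; lra].
have := ex_matchings_geq gK cK cw0 ltac:(lra).
have hS : INR k`! * INR S <= w ^ (8 * maxn k 2).
  rewrite (pow_mult w 8) wn -mult_INR -INR_expn; apply/le_INR/leP.
  by have := stars_leq_trivial c1 k1; rewrite card_ord.
have := fr_stars hS; have := matchings_leq_R.
have : INR #|E2| ^ t <= (kap * w ^ 12) ^ t by apply: pow_incr; split=> //; apply: pos_INR.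
have ew : (w ^ 12) ^ t = w ^ (12 * t) by rewrite -pow_mult.
rewrite (Rpow_mult_distr kap) (Rpow_mult_distr c) !ew.
have : 0 < w ^ (12 * t) by apply: pow_lt.
have : (sig + kap ^ t) * w ^ (12 * t) <= c ^ t * w ^ (12 * t).
  by apply: Rmult_le_compat_r => //; apply: pow_le; lra.
by move: hd; lra.
Qed.

(** All blue edges are recolored at once. By [matchings_recolor] each of them gains at least (kap/2
    n^(3/2))^(t-1) / (t-1)! matchings, more than its share of the lost stars. *)
Lemma no_large_star tau : INR tau <= w ^ 6 -> (forall v, k = 1%N \/ (deg E1 v <= tau)%N) ->
  kap * w ^ 12 <= INR #|E2| -> (S + M <= X)%N.
Proof.
move=> tauw hdeg e2; have [_ [_ [_ [_ [_ [hf [hg _]]]]]]] := hw.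
have w0 : 0 < w by lra.
have t1 : t = t.-1.+1 by rewrite prednK //; apply: ltnW.
have := matchings_recolor t.-1 gE sE1; rewrite -t1 => hr.
have hX : (#|matchings t E| <= X)%N.
  by rewrite -Ncount_match //; [apply: ex_geq|apply: ltnW].
have hgain : (kap / 2 * w ^ 12) ^ t.-1 <= INR ((#|E2| - 2 * t * n) ^ t.-1).
  rewrite INR_expn; apply: pow_incr; split.
    by apply: Rmult_le_pos; [lra|apply: pow_le; lra].
  apply: Rle_trans (subn_INR_geq _ _); rewrite !mult_INR -wn.
  by rewrite -[INR 2]/2; lra.
have hS : INR k`! * INR S <= 2 * INR #|E1| * w ^ (6 * k.-1).
  apply: (Rle_trans _ (INR (2 * #|E1| * tau ^ k.-1))).
    by rewrite -mult_INR; apply/le_INR/leP/stars_leq_low.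
  rewrite !mult_INR INR_expn -[INR 2]/2 (pow_mult w 6).
  apply: Rmult_le_compat_l; first by have := pos_INR #|E1|; lra.
  by apply: pow_incr; split=> //; apply: pos_INR.
have hS' : INR t.-1`! * INR S <= INR #|E1| * INR ((#|E2| - 2 * t * n) ^ t.-1).
  apply: (Rle_trans _ (INR #|E1| * (kap / 2 * w ^ 12) ^ t.-1)); last first.
    by apply: Rmult_le_compat_l => //; apply: pos_INR.
  have -> : INR t.-1`! * INR S = INR t.-1`! / INR k`! * (INR k`! * INR S).
    by field; have := fact_pos k; lra.
  apply: (Rle_trans _ (INR t.-1`! / INR k`! * (2 * INR #|E1| * w ^ (6 * k.-1)))).
    by apply: Rmult_le_compat_l => //; apply/Rlt_le/Rdiv_lt_0_compat.
  have -> : INR t.-1`! / INR k`! * (2 * INR #|E1| * w ^ (6 * k.-1)) =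
    INR #|E1| * (2 * (INR t.-1`! / INR k`!) * w ^ (6 * k.-1)) by ring.
  apply: Rmult_le_compat_l; first exact: pos_INR.
  have ew : (w ^ 12) ^ t.-1 = w ^ (12 * t.-1) by rewrite -pow_mult.
  by rewrite (Rpow_mult_distr (kap / 2)) ew.
rewrite -(@leq_pmul2l t.-1`!) ?fact_gt0 // mulnDr addnC.
apply: leq_trans (leq_mul (leqnn _) hX); apply: leq_trans hr; rewrite leq_add2l.
by apply/leP/INR_le; rewrite !mult_INR.
Qed.

Lemma some_large_star tau : (2 <= k)%N -> INR tau <= w ^ 6 -> w ^ 6 <= INR tau.+1 ->
  (exists v, (tau < deg E1 v)%N) -> kap * w ^ 12 <= INR #|E2| -> (S + M <= X)%N.
Proof.
move=> k2 tauw wtau [v0 hv0] e2.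
have [[_ w_c] [w_low [w_high [_ [_ [_ [_ hh]]]]]]] := hw.
have w0 : 0 < w by lra.
have w6 : 2 <= w ^ 6 by have : 4 ^ 6 <= w ^ 6 by [apply: pow_incr; lra]; lra.
pose B := [set v | tau < deg E1 v]%N.
pose D := (\sum_(v in B) deg E1 v)%N.
pose A := \bigcup_(v in B) nb E1 v.
have [hB1 hB2] := card_high_degree c1 tau; rewrite -/B -/D in hB1 hB2.
have hDA : (D <= #|A| + 'C(#|B|, 2))%N := sum_deg_leq_bigcup B c1.
have b1 : 1 <= INR #|B|.
  rewrite -[1]/(INR 1); apply/le_INR/leP/card_gt0P; exists v0; by rewrite inE.
have bD : INR #|B| * w ^ 6 <= INR D.
  move: hB1 => /leP/le_INR; rewrite mult_INR; nra.
have bw : INR #|B| * (w ^ 6 * (w ^ 6 - 1)) <= w ^ 16.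
  move: hB2 => /leP/le_INR; rewrite card_ord (mult_INR #|B|) (mult_INR tau.+1) INR_expn -wn.
  rewrite S_INR in wtau *; have -> : (w ^ 8) ^ 2 = w ^ 16 by ring.
  apply: Rle_trans; apply: Rmult_le_compat_l; first by lra.
  by apply: Rmult_le_compat; lra.
have DA : INR D <= INR #|A| + INR #|B| ^ 2.
  move: hDA => /leP/le_INR; rewrite plus_INR.
  have : INR 'C(#|B|, 2) <= INR #|B| ^ 2.
    rewrite -INR_expn; apply/le_INR/leP.
    rewrite -(@leq_pmul2l 2) // double_bin2 -mulnn; move: #|B| => x; clear; nia.
  lra.
have An : INR #|A| <= w ^ 8.
  by rewrite wn; apply/le_INR/leP; rewrite -[n in (_ <= n)%N]card_ord max_card.
have DM0 : (M0 <= #|A|)%N.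
  apply/leP/INR_le; have h := high_union_geq w4 b1 bD bw DA.
  have w2 : 16 <= w ^ 2 by nra.
  have hx : 2 / w ^ 2 <= 1 / 8 by apply/Rle_div_l; lra.
  have hD : w ^ 6 <= INR D by nra.
  have : INR D * (7 / 8) <= INR D * (1 - 2 / w ^ 2) by apply: Rmult_le_compat_l; lra.
  by move: hh; lra.
have [K [gK cK sK hK]] := dense DM0.
have AK : 9 * INR #|A| ^ 3 <= 49 * INR #|K| ^ 2.
  move: hK => /leP/le_INR; rewrite (mult_INR 9) (mult_INR 49) !INR_expn.
  by rewrite (INR_IZR_INZ 9) (INR_IZR_INZ 49) -[IZR (Z.of_nat 9)]/9 -[IZR (Z.of_nat 49)]/49.
have e2b : INR #|E2| <= INR #|avoiding E2 A| + INR #|B| * w ^ 8.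
  rewrite wn -mult_INR -plus_INR; apply/le_INR/leP.
  by have := card_avoiding_bigcup_nb B gE cE sE1; rewrite card_ord.
have gE' : graph (avoiding E2 A) := graph_sub (avoiding_sub _ _) g2.
have cE' : c4free (avoiding E2 A) := c4free_sub (avoiding_sub _ _) c2.
have dE' e : e \in avoiding E2 A -> [disjoint e & A] by rewrite inE => /andP[].
have cU := card_glue gE' dE' sK.
have gU := graphU gE' gK; have cfU := c4free_glue dE' sK cE' cK.
have base := replace_base_geq w4 w_c b1 bD bw DA AK (pos_INR _) e2b.
have := replace_arith k2 t2 (proj1 hc) kap0 fr0 w4 w_c w_low w_high b1 bD bw DA An AK (pos_INR _) e2b e2.
have hS : INR k`! * INR S <= INR D ^ k + w ^ (6 * (k - 2) + 16).
  apply: (Rle_trans _ (INR (D ^ k + tau ^ (k - 2) * n ^ 2))).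
    by rewrite -mult_INR; apply/le_INR/leP; have := stars_leq_split c1 tau k2; rewrite card_ord.
  rewrite plus_INR (mult_INR (tau ^ _)) !INR_expn -wn; apply: Rplus_le_compat_l.
  rewrite pow_add (pow_mult w 6) (_ : (w ^ 8) ^ 2 = w ^ 16); last by ring.
  apply: Rmult_le_compat_r; first by apply: pow_le; lra.
  by apply: pow_incr; split=> //; apply: pos_INR.
have := fr_stars hS => hS' hrep.
have x0 : 0 <= INR #|avoiding E2 A| + INR #|K| - 2 * INR t * w ^ 8.
  apply: Rle_trans base; have := pos_INR #|E2|.
  have : 0 <= sqrt (INR D) ^ 3 by apply/pow_le/sqrt_pos.
  by move: hc => [? _]; nra.
have := ex_matchings_geq gU cfU x0 ltac:(rewrite cU plus_INR; lra).
have := matchings_leq_R => hM hX.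
by apply: value_from_factorials; lra.
Qed.

Lemma colored_value_leq : (S + M <= X)%N.
Proof.
case: (Rle_lt_dec (INR #|E2|) (kap * w ^ 12)) => [|/Rlt_le e2]; first exact: few_red_edges.
(* The threshold tau is the integer part of n^(3/4). *)
have [tau /andP[lo hi]] := fourth_root_floor (n ^ 3).
have w24 : INR n ^ 3 = (w ^ 6) ^ 4 by rewrite -wn; ring.
have p6 : 0 <= w ^ 6 by apply: pow_le; lra.
have tauw : INR tau <= w ^ 6.
  apply: (@pow_leq_inv 4) => //; rewrite -w24 -!INR_expn.
  exact/le_INR/leP.
have wtau : w ^ 6 <= INR tau.+1.
  apply: (@pow_leq_inv 4) => //; first exact: pos_INR.
  by rewrite -w24 -!INR_expn; apply/le_INR/leP/ltnW.
case: (boolP [exists v, tau < deg E1 v]%N) => [/existsP ev|/existsPn nv]; last first.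
  by apply: (no_large_star tauw) => // v; right; rewrite leqNgt.
(* For k = 1 the stars are edges, and recoloring gains whatever the blue degrees. *)
case: (eqVneq k 1%N) => [k_1|k_n1]; first by apply: (no_large_star tauw) => // v; left.
by apply: (some_large_star _ tauw wtau) => //; rewrite ltn_neqAle eq_sym k_n1.
Qed.

End Coloring.

Theorem excol_matching_regime : exists N0 : nat, forall n : nat, (N0 <= n)%N ->
  excol n (Sstar k.+1) (Mmatch t) C4 = ex n (Mmatch t) C4.
Proof.
have [M0 dense] := dense_c4free_graph.
have [c [kap [sig [hc kap0 sig0 hsum htight]]]] := regime_constants k1 t2 kt nkt.
have [W hW] := large_enough_eventually M0 hc kap0 sig0 hsum htight.
have [N0 hN0] := eighth_root W; exists N0 => n /hN0[w [Ww w0 wn]].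
apply/eqP; rewrite eqn_leq; apply/andP; split.
  apply: excol_leq => E E1 gE cE sE1.
  have g1 := graph_sub sE1 gE; have g2 := graph_sub (subsetDl E E1) gE.
  have t0 : (0 < t)%N by apply: ltnW.
  apply: leq_trans (leq_add (Ncount_star_leq k g1) (eq_leq (Ncount_match g2 t0))) _.
  exact: (colored_value_leq gE cE sE1 hc kap0 hsum (hW _ Ww) wn (dense _)).
apply: ex_leq => E gE cE; apply: leq_trans (excol_geq _ _ gE cE (sub0set E)).
by rewrite /Ncol Ncount_star0 // setD0.
Qed.

End MatchingRegime.

(** * The star regime *)

Lemma matchings_leq_bin n k (E : {set {set 'I_n}}) : #|matchings k E| <= 'C(#|E|, k).
Proof.
rewrite -cards_draws; apply/subset_leq_card/subsetP => F.
by rewrite !inE => /and3P[-> ->].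
Qed.

Lemma ffact_geq m k : (m - k) ^ k <= m ^_ k.
Proof.
elim: k => // k IH; rewrite ffactnSr expnSr leq_mul //; last by lia.
apply: leq_trans IH; case: (posnP k) => [-> //|k0]; rewrite leq_exp2r //; lia.
Qed.

Lemma ffact_succ m k : m.+1 ^_ k.+1 = m ^_ k.+1 + k.+1 * m ^_ k.
Proof.
rewrite ffactSS ffactnSr; case: (leqP k m) => [le|lt].
  by rewrite [m.+1 * _]mulnC [k.+1 * _]mulnC -mulnDr; congr (_ * _); lia.
by rewrite ffact_small // !muln0.
Qed.

(** A discrete mean value inequality: each unit step from m to m + a gains at least (k + 1) m^_k.
    With m = d it bounds from below the loss caused by a missing blue edges at the center. *)
Lemma ffact_gap m a k : m ^_ k.+1 + a * (k.+1 * m ^_ k) <= (m + a) ^_ k.+1.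
Proof.
elim: a => [|a IH]; first by rewrite mul0n !addn0.
have le : m ^_ k <= (m + a) ^_ k.
  by rewrite -!fact_bin_ffact leq_mul2l leq_bin2l ?orbT // leq_addr.
have le' : k.+1 * m ^_ k <= k.+1 * (m + a) ^_ k by rewrite leq_mul2l le orbT.
by rewrite addnS ffact_succ mulSn addnCA addnC; apply: leq_add.
Qed.

Section StarRegimeStructure.
Variables (n : nat) (E E1 : {set {set 'I_n}}) (v : 'I_n).
Hypotheses (gE : graph E) (cE : c4free E) (sE1 : E1 \subset E).
Hypothesis vmax : forall u, deg E1 u <= deg E1 v.
Let E2 := E :\: E1.
Let a := n.-1 - deg E1 v.
Let Q := \sum_(u | u != v) deg E1 u * (deg E1 u).-1.
Let Q2 := \sum_u deg E2 u * (deg E2 u).-1.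

Lemma max_deg_add : deg E1 v + a = n.-1.
Proof.
have := card_outside v gE sE1; rewrite card_ord => h.
by rewrite subnKC // -h leq_addl.
Qed.

Lemma square_budget : deg E1 v * (deg E1 v).-1 + Q + Q2 <= n * n.-1.
Proof.
have := sum_deg_pred_colored cE sE1; rewrite card_ord; apply: leq_trans.
by rewrite leq_add2r [X in _ <= X](bigD1 v).
Qed.

Lemma red_edges_square : 4 * #|E2| ^ 2 <= n * (Q2 + 2 * #|E2|).
Proof.
have g2 : graph E2 by apply: graph_sub gE; apply: subsetDl.
by have := edges_square_leq g2; rewrite card_ord.
Qed.

Lemma red_edges_few : 2 * #|E2| <= n.-1 + a ^ 2 + 3 * a.
Proof.
have := edges_color2_leq v gE cE sE1; have := card_outside v gE sE1.
rewrite card_ord -max_deg_add addnC => /addnI ->.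
by rewrite max_deg_add.
Qed.

(** By [deg_other] the blue degrees of the other vertices are at most n + 1 - d = a + 2; this is
    efficient when a is small. *)
Lemma stars_leq_max k : k.+2`! * \sum_u 'C(deg E1 u, k.+2) <= deg E1 v ^_ k.+2 + (a + 2) ^ k * Q.
Proof.
rewrite (bigD1 v) //= mulnDr fact_bin_ffact leq_add2l !big_distrr /=; apply: leq_sum => u uv.
rewrite fact_bin_ffact mulnC; apply: leq_trans (leq_ffact_exp2 _ _) _.
rewrite leq_mul2l; apply/orP; right; case: (posnP k) => [-> //|k0]; rewrite leq_exp2r //.
have := deg_other gE cE sE1 uv; have := deg_sub u sE1; have := max_deg_add; rewrite card_ord.
by move: (deg E1 u) (deg E u) (deg E1 v) a; clear; lia.
Qed.

(** The counterpart for large a, where d itself is smaller than n by a constant factor. *)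
Lemma stars_leq_max_deg k :
  k.+2`! * \sum_u 'C(deg E1 u, k.+2) <= deg E1 v ^ k * (deg E1 v * (deg E1 v).-1 + Q).
Proof.
have -> : deg E1 v * (deg E1 v).-1 + Q = \sum_u deg E1 u * (deg E1 u).-1.
  by rewrite [RHS](bigD1 v).
rewrite !big_distrr /=.
apply: leq_sum => u _; rewrite fact_bin_ffact mulnC; apply: leq_trans (leq_ffact_exp2 _ _) _.
by rewrite leq_mul2l; apply/orP; right; case: (posnP k) => [-> //|k0]; rewrite leq_exp2r.
Qed.

Lemma star_full k t : deg E1 v = n.-1 -> 
  \sum_u 'C(deg E1 u, k.+3) + #|matchings t E2| <= 'C(n.-1, k.+3) + 'C(n.-1./2, t).
Proof.
move=> dv; have a0 : a = 0 by rewrite /a dv subnn.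
apply: leq_add; last first.
  apply: leq_trans (matchings_leq_bin _ _) _; apply: leq_bin2l.
  by have := red_edges_few; rewrite a0; lia.
rewrite (bigD1 v) //= dv big1 ?addn0 // => u uv; apply: bin_small.
have := deg_other gE cE sE1 uv; have := deg_sub u sE1; rewrite card_ord dv.
by move: (deg E1 u) (deg E u); clear; lia.
Qed.

End StarRegimeStructure.

(** * The loss of the largest star against the remaining degree budget *)

Section StarRegimeArithmetic.
Local Open Scope R_scope.

(* [a] is the number of other vertices not joined in blue to the vertex of largest blue degree [d],
   and [q], [q2] are the sums of [x (x - 1)] over the blue degrees [x] of the other vertices and
   over all red degrees. *)
Variables (n d a q q2 e2 : R).
Hypotheses (a1 : 1 <= a) (da : d + a = n - 1) (d0 : 0 <= d) (q0 : 0 <= q) (q20 : 0 <= q2).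
Hypothesis budget : d * (d - 1) + q + q2 <= n * (n - 1).
Hypothesis e2sq : 4 * e2 ^ 2 <= n * (q2 + 2 * e2).
Hypotheses (e20 : 0 <= e2) (dd0 : 0 <= d * (d - 1)).

Let an : a <= n. Proof. lra. Qed.

(** The budget left is n(n - 1) - d(d - 1) = (a + 1)(2d + a), with 2d + a <= 2n and a + 1 <= 2a. *)
Lemma q_sum_leq : q + q2 <= 4 * a * n.
Proof. have -> : n = d + a + 1 by lra. move: budget; rewrite (_ : n = d + a + 1); [nra|lra]. Qed.

(** Cauchy-Schwarz with q2 <= 4 a n. The bound interpolates between order n for bounded a and order
    n^(3/2) for a of order n. *)
Lemma e2_leq_sqrt : e2 <= 2 * n * sqrt a.
Proof.
have s1 : 1 <= sqrt a by rewrite -sqrt_1; apply: sqrt_le_1; lra.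
have sa : sqrt a * sqrt a = a by apply: sqrt_sqrt; lra.
have q2an : q2 <= 4 * a * n by have := q_sum_leq; lra.
apply: Rnot_lt_le => lt.
have n1 : 1 <= n by lra.
have h : n * q2 <= n * (4 * a * n) by apply: Rmult_le_compat_l; lra.
have h2 : 4 * n * sqrt a <= 2 * e2 by lra.
have h3 : 0 <= n * (sqrt a - 1) by apply: Rmult_le_pos; lra.
have h4 : 2 * n * sqrt a * (6 * n * sqrt a) < e2 * (4 * e2 - 2 * n).
  by apply: Rmult_le_0_lt_compat; nra.
have : 2 * n * sqrt a * (6 * n * sqrt a) = 12 * (n * n * a) by rewrite -[in RHS]sa; ring.
have : 0 < n * n * a by nra.
nra.
Qed.

Let n1 : 1 <= n. Proof. lra. Qed.
Let s1 : 1 <= sqrt a. Proof. by rewrite -sqrt_1; apply: sqrt_le_1; lra. Qed.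
Let sa : sqrt a * sqrt a = a. Proof. by apply: sqrt_sqrt; lra. Qed.

Variables (x : R).
Hypotheses (x0 : 0 <= x) (xn : x ^ 2 = n).
Let sx : sqrt a <= x.
Proof. by apply: Rsqr_incr_0; rewrite /Rsqr; nra. Qed.

Section SmallExponent.
Variables (j t : nat) (fk S M ffd ffd1 ffn : R).
Hypotheses (j1 : (1 <= j)%N) (t1 : (1 <= t)%N) (jt : (3 * t < 2 * j.+2)%N) (fk0 : 0 <= fk).
Hypotheses (Mt : M <= e2 ^ t).
Hypotheses (S_max : S <= ffd + (a + 2) ^ j * q) (S_deg : S <= d ^ j * (d * (d - 1) + q)).
Hypotheses (gap : ffd + a * (INR j.+2 * ffd1) <= ffn).
Hypotheses (ffd1_geq : (d - INR j.+1) ^ j.+1 <= ffd1 \/ d < INR j.+1).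
Hypotheses (ffn_geq : (n - 1 - INR j.+2) ^ j.+2 <= ffn \/ n - 1 < INR j.+2).
Hypothesis n_large : 1536 * (INR j.+2 * INR j.+3) <= n.
Hypothesis x_large1 : fk * 2 ^ t * 2 ^ j.+1 * x ^ (2 * t + (t - 2)) <= x ^ (2 * j.+1).
Hypothesis x_large2 : 1536 * fk * 2 ^ t * x ^ (3 * t) <= x ^ (2 * j.+2).

Let j3 : 3 <= INR j.+2.
Proof. by rewrite (_ : 3 = INR 3); [apply/le_INR/leP|rewrite /=; lra]. Qed.

Let j4 : INR j.+3 = INR j.+2 + 1. Proof. exact: S_INR. Qed.
Let j2 : INR j.+1 = INR j.+2 - 1. Proof. by rewrite [INR j.+2]S_INR; lra. Qed.

(** The loss is at least 3 a (n/2)^(k-1), where k = j + 2. The other blue stars and the red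
    matchings cost at most a (n/2)^(k-1) each: a + 2 <= n/256 makes the former small, and 3t < 2k
    the latter. *)
Lemma near_star_arith : a <= n / 768 -> S + fk * M <= ffn.
Proof.
move=> a_small; suff h : (a + 2) ^ j * q + fk * M <= a * (INR j.+2 * ffd1) by lra.
have nj : 8 * INR j.+2 <= n by nra.
have dj : n / 2 <= d - INR j.+1 by lra.
have f1 : (n / 2) ^ j.+1 <= ffd1.
  case: ffd1_geq => [|]; last by lra.
  by apply: Rle_trans; apply: pow_incr; lra.
have p0 : 0 < (n / 2) ^ j.+1 by apply: pow_lt; lra.
have hS : (a + 2) ^ j * q <= a * (n / 2) ^ j.+1.
  have hq : q <= 4 * a * n by have := q_sum_leq; lra.
  have h1 : (a + 2) ^ j <= (n / 2 / 128) ^ j by apply: pow_incr; lra.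
  have h2 : (n / 2 / 128) ^ j * 128 <= (n / 2) ^ j.
    rewrite {1}/Rdiv Rpow_mult_distr pow_inv.
    have p128 : 128 <= 128 ^ j.
      by rewrite -{1}(pow_1 128); apply: Rle_pow; [lra|apply/leP].
    have pn : 0 < (n / 2) ^ j by apply: pow_lt; lra.
    rewrite Rmult_assoc -{2}(Rmult_1_r ((n / 2) ^ j)); apply: Rmult_le_compat_l; first by lra.
    by rewrite Rmult_comm; apply/(Rle_div_l 128 1); lra.
  have p1 : 0 <= (a + 2) ^ j by apply: pow_le; lra.
  have h3 : (a + 2) ^ j * q <= (n / 2 / 128) ^ j * (4 * a * n).
    by apply: Rmult_le_compat.
  have an0 : 0 <= a * n by nra.
  have h4 : a * n * ((n / 2 / 128) ^ j * 128) <= a * n * (n / 2) ^ j by apply: Rmult_le_compat_l.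
  have -> : a * (n / 2) ^ j.+1 = a * n * (n / 2) ^ j / 2 by rewrite /=; field.
  have : 0 <= a * n * (n / 2) ^ j.
    by apply: Rmult_le_pos => //; apply: pow_le; lra.
  lra.
have hM : fk * M <= a * (n / 2) ^ j.+1.
  have st : sqrt a ^ t <= a * x ^ (t - 2).
    case: (t) t1 => [//|[|m]] _; first by rewrite /=; nra.
    have -> : sqrt a ^ m.+2 = a * sqrt a ^ m by rewrite -[X in _ = X * _]sa /=; ring.
    have -> : (m.+2 - 2 = m)%N by lia.
    by apply: Rmult_le_compat_l; [lra|apply: pow_incr; lra].
  have h1 : M <= 2 ^ t * x ^ (2 * t) * (a * x ^ (t - 2)).
    apply: Rle_trans Mt _; apply: (Rle_trans _ ((2 * n * sqrt a) ^ t)).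
      by apply: pow_incr; have := e2_leq_sqrt; lra.
    rewrite !Rpow_mult_distr -xn -pow_mult.
    by apply: Rmult_le_compat_l => //; apply: Rmult_le_pos; apply: pow_le; lra.
  have h2 := Rmult_le_compat_l _ _ _ fk0 h1.
  have e1 : fk * (2 ^ t * x ^ (2 * t) * (a * x ^ (t - 2))) = a * (fk * 2 ^ t * x ^ (2 * t + (t - 2))).
    rewrite (pow_add x (2 * t) (t - 2)); move: (x ^ (2 * t)) (x ^ (t - 2)) (2 ^ t) => u v y. ring.
  apply: Rle_trans h2 _; rewrite e1; apply: Rmult_le_compat_l; first by lra.
  have p2 : 0 < 2 ^ j.+1 by apply: pow_lt; lra.
  have -> : (n / 2) ^ j.+1 = x ^ (2 * j.+1) / 2 ^ j.+1.
    by rewrite {1}/Rdiv Rpow_mult_distr pow_inv -xn -pow_mult.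
  by apply/Rle_div_r => //; move: x_large1; lra.
have : a * (3 * (n / 2) ^ j.+1) <= a * (INR j.+2 * ffd1).
  apply: Rmult_le_compat_l; first by lra.
  by apply: Rmult_le_compat; lra.
have : 0 < a * (n / 2) ^ j.+1 by apply: Rmult_lt_0_compat; lra.
lra.
Qed.

(** All blue stars together fall short of n^k by n^k / 768. Half of this pays for the red matchings,
    of smaller order since 3t < 2k, and half for the difference between n^k and the falling
    factorial of n - 1. *)
Lemma far_star_arith : n / 768 <= a -> S + fk * M <= ffn.
Proof.
move=> a_large; have nj : 8 * INR j.+2 <= n by nra.
have dn : d <= 767 / 768 * n by lra.
have nk : n ^ j.+2 = n ^ j * n ^ 2 by rewrite -pow_add; congr (_ ^ _); lia.
have pn : 0 < n ^ j by apply: pow_lt; lra.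
have hS : S <= 767 / 768 * n ^ j.+2.
  apply: Rle_trans S_deg _; rewrite nk -Rmult_assoc; apply: Rmult_le_compat.
  - by apply: pow_le.
  - by lra.
  - rewrite -(prednK j1) /=; have h : d ^ j.-1 <= n ^ j.-1 by apply: pow_incr; lra.
    have p : 0 <= d ^ j.-1 by apply: pow_le.
    rewrite -Rmult_assoc; apply: Rmult_le_compat => //.
  - by have := budget; nra.
have hM : fk * M <= 1 / 1536 * n ^ j.+2.
  have h1 : M <= 2 ^ t * x ^ (3 * t).
    apply: Rle_trans Mt _; have -> : 2 ^ t * x ^ (3 * t) = (2 * n * x) ^ t.
      have -> : 2 * n * x = 2 * x ^ 3 by rewrite -xn; ring.
      by rewrite (Rpow_mult_distr 2) -pow_mult.
    apply: pow_incr; split=> //; have := e2_leq_sqrt.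
    have : 2 * n * sqrt a <= 2 * n * x by apply: Rmult_le_compat_l; lra.
    lra.
  have h2 := Rmult_le_compat_l _ _ _ fk0 h1.
  have -> : n ^ j.+2 = x ^ (2 * j.+2) by rewrite -xn -pow_mult.
  by move: x_large2 h2; lra.
have hn : (1 - 1 / 1536) * n ^ j.+2 <= ffn.
  case: ffn_geq => [|]; last by lra.
  apply: Rle_trans; have -> : n - 1 - INR j.+2 = n * (1 - INR j.+3 / n) by rewrite j4; field; lra.
  rewrite Rpow_mult_distr Rmult_comm; apply: Rmult_le_compat_l.
    by apply: pow_le; lra.
  have y1 : 0 <= INR j.+3 / n <= 1.
    split; first by apply/Rlt_le/Rdiv_lt_0_compat; lra.
    by apply/Rle_div_l; lra.
  apply: Rle_trans (bernoulli _ y1).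
  suff : INR j.+2 * (INR j.+3 / n) <= 1 / 1536 by lra.
  have -> : INR j.+2 * (INR j.+3 / n) = INR j.+2 * INR j.+3 / n by field; lra.
  by apply/Rle_div_l; lra.
have : 0 < n ^ j.+2 by apply: pow_lt; lra.
lra.
Qed.

Lemma star_arith : S + fk * M <= ffn.
Proof. by case: (Rle_lt_dec a (n / 768)) => [|/Rlt_le]; [exact: near_star_arith|exact: far_star_arith]. Qed.

End SmallExponent.

Section ThreeLeavesTwoEdges.
Variables (S M ffd ffd1 ffn : R).
Hypotheses (M2 : 2 * M <= e2 ^ 2) (few : 2 * e2 <= n - 1 + a ^ 2 + 3 * a).
Hypotheses (S_max : S <= ffd + (a + 2) * q) (S_deg : S <= d * (d * (d - 1) + q)).
Hypotheses (gap : ffd + a * (3 * ffd1) <= ffn).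
Hypotheses (ffd1_geq : (d - 2) ^ 2 <= ffd1 \/ d < 2) (ffn_geq : (n - 4) ^ 3 <= ffn \/ n - 1 < 3).
Hypothesis x_large : 4000 <= x.

Let n_large : 16000000 <= n.
Proof. by rewrite -xn; have : 4000 ^ 2 <= x ^ 2 by [apply: pow_incr; lra]; lra. Qed.

(** Here 3t = 2k and red matchings have the order n^3 of the stars, so they must share the budget
    instead of being bounded separately: 6M <= 3/4 n (q2 + 2 e2) together with q + q2 <= 2(a + 1) n
    costs about 3/2 (a + 1) n^2 plus 3/2 n e2, against a loss of about 3 a n^2. *)
Lemma star3_arith : S + 6 * M <= ffn.
Proof.
have M6 : 6 * M <= 3 * e2 ^ 2 by lra.
have M6' : 6 * M <= 3 / 4 * (n * (q2 + 2 * e2)) by lra.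
have e2s := e2_leq_sqrt.
have budget' : q + q2 <= 2 * (a + 1) * n.
  have -> : n = d + a + 1 by lra.
  by move: budget; rewrite (_ : n = d + a + 1); [nra|lra].
case: (Rle_lt_dec a (n / 768)) => [a_small|/Rlt_le a_large].
  suff : (a + 2) * q + 6 * M <= a * (3 * ffd1) by lra.
  have f1 : (99 / 100 * n) ^ 2 <= ffd1.
    case: ffd1_geq => [|]; last by lra.
    by apply: Rle_trans; apply: pow_incr; lra.
  have h1 : a * (3 * (99 / 100 * n) ^ 2) <= a * (3 * ffd1) by apply: Rmult_le_compat_l; lra.
  (* From a = 16 on, sqrt a <= a/4 gives e2 <= a n / 2, and the cost (2.25 a + 1.5) n^2 stays below
     2.94 a n^2. *)
  case: (Rle_lt_dec 16 a) => [a16|/Rlt_le a16].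
    have s4 : 4 <= sqrt a.
      by apply: Rsqr_incr_0; rewrite /Rsqr; lra.
    have s4a : 4 * sqrt a <= a by rewrite -[X in _ <= X]sa; apply: Rmult_le_compat_r; lra.
    have e2a : e2 <= n * a / 2.
      have : n * (4 * sqrt a) <= n * a by apply: Rmult_le_compat_l; lra.
      by lra.
    have h2 : (a + 2) * q + 3 / 4 * n * q2 <= 3 / 4 * n * (q + q2).
      by have : (a + 2) * q <= 3 / 4 * n * q by [apply: Rmult_le_compat_r; lra]; lra.
    have h3 : 3 / 4 * n * (q + q2) <= 3 / 4 * n * (2 * (a + 1) * n) by apply: Rmult_le_compat_l; lra.
    have h4 : n * e2 <= n * (n * a / 2) by apply: Rmult_le_compat_l; lra.
    have h5 : n * n * 16 <= n * n * a.
      by apply: Rmult_le_compat_l => //; apply: Rmult_le_pos; lra.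
    by move: M6' h1; lra.
  (* For small a the shared budget is too weak; instead [few] gives e2 <= 3n/4, so that 6M <= 27/16
     n^2, while q is only linear in n. *)
  have hq : (a + 1) * n <= 17 * n by apply: Rmult_le_compat_r; lra.
  have h2 : (a + 2) * q <= 18 * (34 * n) by apply: Rmult_le_compat; lra.
  have a256 : a ^ 2 <= 16 ^ 2 by apply: pow_incr; lra.
  have h3 : e2 ^ 2 <= (3 / 4 * n) ^ 2 by apply: pow_incr; lra.
  have h5 : n * n * 1 <= n * n * a.
    by apply: Rmult_le_compat_l => //; apply: Rmult_le_pos; lra.
  have h6 : n * 16000000 <= n * n by apply: Rmult_le_compat_l; lra.
  by move: h1; lra.
(* For a of order n, both d and 3n/4 are at most 767/768 n, so blue and red share the total budget
   n(n - 1) at this rate. *)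
have dn : d <= 767 / 768 * n by lra.
have nx : n * sqrt a <= n * x by apply: Rmult_le_compat_l; lra.
have h1 : n * e2 <= n * (2 * n * x) by apply: Rmult_le_compat_l; lra.
have h2 : d * (d * (d - 1) + q) <= 767 / 768 * n * (d * (d - 1) + q) by apply: Rmult_le_compat_r; lra.
have f : (n - 4) ^ 3 <= ffn by case: ffn_geq => //; lra.
have h3 : n ^ 3 - 12 * n ^ 2 <= (n - 4) ^ 3 by lra.
have h4 : d * (d * (d - 1) + q) + 3 / 4 * n * q2 <= 767 / 768 * n * (n * (n - 1)).
  have : 767 / 768 * n * (d * (d - 1) + q + q2) <= 767 / 768 * n * (n * (n - 1)).
    by apply: Rmult_le_compat_l; lra.
  have : 0 <= n * q2 by apply: Rmult_le_pos; lra.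
  lra.
have h5 : 3 * (n * (n * x)) + 12 * n ^ 2 <= 1 / 768 * n ^ 3.
  have : n ^ 2 * (3 * x + 12) <= n ^ 2 * (1 / 768 * n).
    have : 4000 * x <= x * x by apply: Rmult_le_compat_r; lra.
    by move=> h; apply: Rmult_le_compat_l; [apply: pow_le|]; lra.
  lra.
by move: M6' S_deg; lra.
Qed.

End ThreeLeavesTwoEdges.
End StarRegimeArithmetic.

(** * From real inequalities back to colored graphs *)

Section StarRegime.

(** A coloring with a blue vertex of full degree n - 1 is settled by [star_full]; any other coloring
    is compared with the blue star of F_n alone. *)
Lemma star_regime_reduction k t N : 0 < t ->
  (forall n, N <= n -> forall (E E1 : {set {set 'I_n}}) v, graph E -> c4free E -> E1 \subset E ->
    (forall u, deg E1 u <= deg E1 v) -> deg E1 v < n.-1 ->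
    \sum_u 'C(deg E1 u, k.+3) + #|matchings t (E :\: E1)| <= 'C(n.-1, k.+3)) ->
  exists N0 : nat, forall n : nat, N0 <= n ->
    excol n (Sstar k.+4) (Mmatch t) C4 = Ncol (Sstar k.+4) (Mmatch t) (Fn_blue n) (Fn_red n).
Proof.
move=> t0 h; exists (maxn 1 N) => n; rewrite geq_max => /andP[n0 nN].
apply/eqP; rewrite eqn_leq; apply/andP; split; last first.
  by rewrite -Fn_colors; apply: excol_geq; [apply: Fn_graph|apply: Fn_c4free|apply: subsetUl].
apply: excol_leq => E E1 gE cE sE1.
have g1 := graph_sub sE1 gE; have g2 := graph_sub (subsetDl E E1) gE.
apply: leq_trans (leq_add (Ncount_star_leq _ g1) (eq_leq (Ncount_match g2 t0))) _.
apply: (@leq_trans ('C(n.-1, k.+3) + 'C(n.-1./2, t))); last first.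
  exact: leq_add (@Ncount_Fn_blue n k.+3 isT) (Ncount_Fn_red n t0).
pose v := [arg max_(v > Ordinal n0) deg E1 v].
have vmax u : deg E1 u <= deg E1 v by rewrite /v; case: arg_maxnP => // w _; apply.
case: (ltnP (deg E1 v) n.-1) => dv; first exact: leq_trans (h n nN E E1 v gE cE sE1 vmax dv) (leq_addr _ _).
apply: (star_full gE cE sE1 (v := v)); apply/eqP; rewrite eqn_leq dv andbT.
by have := max_deg_add v gE sE1; lia.
Qed.

Local Open Scope R_scope.

Lemma INR_mul_pred m : INR (m * m.-1) = INR m * (INR m - 1).
Proof. by case: m => [|m]; rewrite mult_INR ?S_INR /=; lra. Qed.

Lemma value_from_factorial k s m b : INR k`! * INR s + INR k`! * INR m <= INR (b ^_ k) ->
  (s + m <= 'C(b, k))%N.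
Proof.
rewrite -fact_bin_ffact mult_INR => h.
have k0 : 0 < INR k`! by apply/lt_0_INR/ltP/fact_gt0.
by apply/leP/INR_le; rewrite plus_INR; apply: (Rmult_le_reg_l (INR k`!)) => //; lra.
Qed.

Lemma INR_ffact_geq m k : (INR m - INR k) ^ k <= INR (m ^_ k) \/ INR m < INR k.
Proof.
case: (leqP k m) => [le|lt]; last by right; apply/lt_INR/ltP.
left; rewrite -minus_INR; last exact/leP.
by rewrite -INR_expn; apply/le_INR/leP/ffact_geq.
Qed.

Section Gap.
Variables (n : nat) (E E1 : {set {set 'I_n}}) (v : 'I_n).
Hypotheses (gE : graph E) (cE : c4free E) (sE1 : E1 \subset E).
Hypotheses (vmax : forall u, (deg E1 u <= deg E1 v)%N) (dv : (deg E1 v < n.-1)%N).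
Let E2 := E :\: E1.
Let d := deg E1 v.
Let a := (n.-1 - d)%N.
Let q := (\sum_(u | u != v) deg E1 u * (deg E1 u).-1)%N.
Let q2 := (\sum_u deg E2 u * (deg E2 u).-1)%N.

Let da : INR d + INR a = INR n - 1.
Proof. have n0 : (0 < n)%N by case: (v) => i; lia.
by rewrite -(INR_pred n0) -(max_deg_add v gE sE1) plus_INR. Qed.
Let a1 : 1 <= INR a. Proof. by rewrite -[1]/(INR 1); apply/le_INR/leP; rewrite /a subn_gt0. Qed.
Let d0 : 0 <= INR d. Proof. exact: pos_INR. Qed.
Let q0 : 0 <= INR q. Proof. exact: pos_INR. Qed.
Let q20 : 0 <= INR q2. Proof. exact: pos_INR. Qed.
Let e20 : 0 <= INR #|E2|. Proof. exact: pos_INR. Qed.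
Let dd0 : 0 <= INR d * (INR d - 1). Proof. by rewrite -INR_mul_pred; apply: pos_INR. Qed.
Let budget : INR d * (INR d - 1) + INR q + INR q2 <= INR n * (INR n - 1).
Proof.
rewrite -!INR_mul_pred -!plus_INR; apply/le_INR/leP.
exact: square_budget v cE sE1.
Qed.
Let e2sq : 4 * INR #|E2| ^ 2 <= INR n * (INR q2 + 2 * INR #|E2|).
Proof.
have /leP/le_INR := red_edges_square E1 gE; rewrite (mult_INR 4) (mult_INR n) plus_INR INR_expn mult_INR.
by rewrite (INR_IZR_INZ 4) (INR_IZR_INZ 2) -[IZR (Z.of_nat 4)]/4 -[IZR (Z.of_nat 2)]/2.
Qed.
Let x0 : 0 <= sqrt (INR n). Proof. exact: sqrt_pos. Qed.
Let xn : sqrt (INR n) ^ 2 = INR n. Proof. by rewrite pow2_sqrt //; apply: pos_INR. Qed.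
Let ffn j : (INR n - 1 - INR j) ^ j <= INR (n.-1 ^_ j) \/ INR n - 1 < INR j.
Proof. by rewrite -INR_pred; [exact: INR_ffact_geq|lia]. Qed.
Let gap j : INR (d ^_ j.+1) + INR a * (INR j.+1 * INR (d ^_ j)) <= INR (n.-1 ^_ j.+1).
Proof.
rewrite -(mult_INR j.+1) -(mult_INR a) -plus_INR; apply/le_INR/leP.
by have := ffact_gap d a j; rewrite (max_deg_add v gE sE1).
Qed.

Lemma gap_small_exponent j t : (1 <= j)%N -> (1 <= t)%N -> (3 * t < 2 * j.+2)%N ->
  1536 * (INR j.+2 * INR j.+3) <= INR n ->
  INR j.+2`! * 2 ^ t * 2 ^ j.+1 * sqrt (INR n) ^ (2 * t + (t - 2)) <= sqrt (INR n) ^ (2 * j.+1) ->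
  1536 * INR j.+2`! * 2 ^ t * sqrt (INR n) ^ (3 * t) <= sqrt (INR n) ^ (2 * j.+2) ->
  (\sum_u 'C(deg E1 u, j.+2) + #|matchings t E2| <= 'C(n.-1, j.+2))%N.
Proof.
move=> j1 t1 jt n_large x1 x2; apply: value_from_factorial.
apply: (star_arith a1 da d0 q0 q20 budget e2sq e20 dd0 x0 xn j1 t1 jt (pos_INR _)
  (ffd := INR (d ^_ j.+2)) (ffd1 := INR (d ^_ j.+1))) => //.
- rewrite -INR_expn; apply/le_INR/leP; apply: leq_trans (matchings_leq_bin _ _) _.
  apply: leq_trans (leq_ffact_exp _ _); rewrite -fact_bin_ffact.
  by rewrite -{1}['C(_, _)]mul1n leq_mul2r fact_gt0 orbT.
- rewrite (_ : INR a + 2 = INR (a + 2)); last by rewrite plus_INR /=; lra.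
  rewrite -INR_expn -!mult_INR -plus_INR; apply/le_INR/leP.
  exact: (stars_leq_max v gE cE sE1 j).
- rewrite -INR_mul_pred -INR_expn -plus_INR -!mult_INR; apply/le_INR/leP.
  exact: stars_leq_max_deg.
- exact: INR_ffact_geq.
Qed.

Lemma gap_three_two : 4000 <= sqrt (INR n) ->
  (\sum_u 'C(deg E1 u, 3) + #|matchings 2 E2| <= 'C(n.-1, 3))%N.
Proof.
move=> x_large; apply: value_from_factorial.
have i6 : INR 3`! = 6 by rewrite INR_IZR_INZ.
rewrite {2}i6.
have i3 : INR 3 = 3 by rewrite /=; lra.
apply: (star3_arith a1 da d0 q0 q20 budget e2sq e20 dd0 x0 xn
  (ffd := INR (d ^_ 3)) (ffd1 := INR (d ^_ 2))) => //.
- have : (2 * #|matchings 2 E2| <= #|E2| ^ 2)%N := matchings_leq 2 E2.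
  by move=> /leP/le_INR; rewrite mult_INR INR_expn.
- have := red_edges_few v gE cE sE1; rewrite -/E2 -/d -/a => /leP/le_INR.
  rewrite (mult_INR 2) (plus_INR (n.-1 + a ^ 2)) (plus_INR n.-1) (mult_INR 3) INR_expn INR_pred; last by case: (v) => i; lia.
  by rewrite (INR_IZR_INZ 3) (INR_IZR_INZ 2) -[IZR (Z.of_nat 3)]/3 -[IZR (Z.of_nat 2)]/2.
- rewrite (_ : INR a + 2 = INR (a + 2) ^ 1); last by rewrite plus_INR /=; lra.
  rewrite -INR_expn -!mult_INR -plus_INR; apply/le_INR/leP.
  exact: (stars_leq_max v gE cE sE1 1).
- rewrite -(INR_mul_pred d) -{1}(pow_1 (INR d)) -(INR_expn d 1) -plus_INR -!mult_INR.
  apply/le_INR/leP.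
  exact: (stars_leq_max_deg vmax 1).
- by have := gap 2; rewrite i3.
- by have := INR_ffact_geq d 2; rewrite (_ : INR 2 = 2).
- by have := ffn 3; rewrite i3 (_ : INR n - 1 - 3 = INR n - 4) //; lra.
Qed.

End Gap.

Lemma sqrt_eventually W : exists N0 : nat, forall n : nat, (N0 <= n)%N -> W <= sqrt (INR n).
Proof.
have [N0 h] := nat_upper_bound (Rmax 0 W ^ 2); exists N0 => n /leP/le_INR n0.
apply: Rle_trans (Rmax_r 0 W) _; apply: (@pow_leq_inv 2) => //; first exact: sqrt_pos.
by rewrite (pow2_sqrt (INR n)); [lra|apply: pos_INR].
Qed.

Theorem excol_star_regime j t : (1 <= j)%N -> (1 <= t)%N -> (3 * t < 2 * j.+2)%N ->
  exists N0 : nat, forall n : nat, (N0 <= n)%N ->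
    excol n (Sstar j.+3) (Mmatch t) C4 = Ncol (Sstar j.+3) (Mmatch t) (Fn_blue n) (Fn_red n).
Proof.
case: j => // j _ t1 jt.
have [W1 [_ h1]] := @pow_eventually_leq (INR j.+3`! * 2 ^ t * 2 ^ j.+2) (2 * t + (t - 2)) (2 * j.+2) ltac:(lia).
have [W2 [_ h2]] := @pow_eventually_leq (1536 * INR j.+3`! * 2 ^ t) (3 * t) (2 * j.+3) jt.
have [N1 hN1] := sqrt_eventually W1; have [N2 hN2] := sqrt_eventually W2.
have [N3 hN3] := nat_upper_bound (1536 * (INR j.+3 * INR j.+4)).
apply: (@star_regime_reduction j t (maxn N1 (maxn N2 N3))) => // n.
rewrite !geq_max => /and3P[n1 n2 /leP/le_INR n3] E E1 v gE cE sE1 vmax dv.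
apply: (gap_small_exponent gE cE sE1 vmax dv) => //.
- by lra.
- exact/h1/hN1.
- exact/h2/hN2.
Qed.

Theorem excol_S4_M2 : exists N0 : nat, forall n : nat, (N0 <= n)%N ->
  excol n (Sstar 4) (Mmatch 2) C4 = Ncol (Sstar 4) (Mmatch 2) (Fn_blue n) (Fn_red n).
Proof.
have [N hN] := sqrt_eventually 4000.
apply: (@star_regime_reduction 0 2 N) => // n nN E E1 v gE cE sE1 vmax dv.
by apply: (gap_three_two gE cE sE1 vmax dv); apply: hN.
Qed.

End StarRegime.

(** Both patterns are single edges, so every coloring of a graph has at most its number of edges as
    value. This is the only pair of case (4) with t = 1, since 2k <= 3 forces k = 1. *)
Lemma excol_S2_M1 n : excol n (Sstar 2) (Mmatch 1) C4 = ex n (Mmatch 1) C4.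
Proof.
apply/eqP; rewrite eqn_leq; apply/andP; split; last first.
  apply: ex_leq => E gE cE; apply: leq_trans (excol_geq _ _ gE cE (sub0set E)).
  by rewrite /Ncol Ncount_star0 // setD0.
apply: excol_leq => E E1 gE cE sE1; have g2 := graph_sub (subsetDl E E1) gE.
apply: leq_trans (@ex_geq n _ (Mmatch 1) E gE cE).
have star : Ncount (Sstar 2) E1 <= #|E1|.
  rewrite -[#|E1|]bin1 -cards_draws; apply/subset_leq_card/subsetP => F.
  case/copiesP=> sF [f fi FE]; rewrite inE sF FE card_imset ?card_Sstar //.
  exact: imset_inj.
have single : #|E| <= Ncount (Mmatch 1) E.
  rewrite Ncount_match // -(card_imset (mem E) set1_inj); apply/subset_leq_card/subsetP.
  move=> _ /imsetP[e eE ->]; rewrite inE sub1set eE cards1 eqxx /=.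
  by apply/trivIsetP => x y; rewrite !inE => /eqP-> /eqP->; rewrite eqxx.
apply: leq_trans single.
have red : Ncount (Mmatch 1) (E :\: E1) <= #|E :\: E1|.
  by rewrite Ncount_match //; have := matchings_leq 1 (E :\: E1); rewrite mul1n expn1.
by apply: leq_trans (leq_add star red) _; rewrite -(cardsID E1 E) (setIidPr sE1).
Qed.

Theorem mainTheorem10 (r t : nat) (hr : 2 <= r) (ht : 1 <= t) :
  [/\ (r = 3 /\ t = 1 ->
         forall n : nat, 3 <= n ->
           excol n (Sstar 3) (Mmatch 1) C4 = Ncount (Sstar 3) (Fn n)),
      (4 <= r -> 3 * t < 2 * (r - 1) ->
         exists N0 : nat, forall n : nat, N0 <= n ->
           excol n (Sstar r) (Mmatch t) C4 = Ncol (Sstar r) (Mmatch t) (Fn_blue n) (Fn_red n)),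
      (r = 4 /\ t = 2 ->
         exists N0 : nat, forall n : nat, N0 <= n ->
           excol n (Sstar 4) (Mmatch 2) C4 = Ncol (Sstar 4) (Mmatch 2) (Fn_blue n) (Fn_red n))
    & (2 * (r - 1) <= 3 * t -> (r, t) <> (3, 1) -> (r, t) <> (4, 2) ->
         exists N0 : nat, forall n : nat, N0 <= n ->
           excol n (Sstar r) (Mmatch t) C4 = ex n (Mmatch t) C4)].
Proof.
split.
- by move=> _; apply: excol_S3_M1.
- case: r hr => [|[|[|r]]] // _ r1; rewrite subn1 /= => rt.
  exact: excol_star_regime.
- by move=> _; apply: excol_S4_M2.
case: r hr => [|k] // k1; rewrite subn1 /= => kt _ nk.
case: (leqP 2 t) => [t2|t1].
  by apply: excol_matching_regime => // -[k3 t_2]; apply: nk; rewrite k3 t_2.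
have -> : t = 1 by lia.
have -> : k = 1 by lia.
by exists 0 => n _; apply: excol_S2_M1.
Qed.
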